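(* Let $\Omega\subset\mathbb{R}^n\times\mathbb{R}$ be a bounded domain and let $f:\partial\Omega\to\mathbb{R}$ be continuous. Then the upper Perron solution $\overline{H}_f$ and the lower Perron solution $\underline{H}_f$ are viscosity solutions of the normalised $\infty$-heat equation $u_t-\Delta_\infty^N u=0$ in $\Omega$.
   Context: Points of $\mathbb{R}^n\times\mathbb{R}$ are written $\zeta=(x,t)$; $D$ and $D^2$ are the gradient and Hessian in the spatial variable $x$ only; $\partial\Omega$ is the Euclidean boundary in $\mathbb{R}^{n+1}$. For $D\psi\ne0$, $\Delta_\infty^N\psi=\frac{1}{|D\psi|^2}\sum_{i,j=1}^n\psi_{x_i}\psi_{x_j}\psi_{x_ix_j}$. For a symmetric matrix $X$, $\lambda(X)$ and $\Lambda(X)$ are its smallest and largest eigenvalues. An upper semicontinuous $u:\Omega\to\mathbb{R}\cup\{-\infty\}$ is a viscosity subsolution in $\Omega$ if for every $\psi\in C^2(\Omega)$ such that $u-\psi$ has a maximum at $\zeta_0\in\Omega$ one has $\psi_t(\zeta_0)-\Delta_\infty^N\psi(\zeta_0)\le0$ if $D\psi(\zeta_0)\neq0$, and $\psi_t(\zeta_0)-\Lambda(D^2\psi(\zeta_0))\le0$ if $D\psi(\zeta_0)=0$. A lower semicontinuous $v:\Omega\to\mathbb{R}\cup\{\infty\}$ is a viscosity supersolution in $\Omega$ if for every $\psi\in C^2(\Omega)$ such that $v-\psi$ has a minimum at $\zeta_0\in\Omega$ one has $\psi_t(\zeta_0)-\Delta_\infty^N\psi(\zeta_0)\ge0$ if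 $D\psi(\zeta_0)\ne0$, and $\psi_t(\zeta_0)-\lambda(D^2\psi(\zeta_0))\ge0$ if $D\psi(\zeta_0)=0$. A function that is both is a viscosity solution. The upper class $\mathcal{U}_f$ consists of all viscosity supersolutions $u$ in $\Omega$ with $\liminf_{\eta\to\zeta,\,\eta\in\Omega}u(\eta)\ge f(\zeta)$ for all $\zeta\in\partial\Omega$; the lower class $\mathcal{L}_f$ consists of all viscosity subsolutions $v$ in $\Omega$ with $\limsup_{\eta\to\zeta,\,\eta\in\Omega}v(\eta)\le f(\zeta)$ for all $\zeta\in\partial\Omega$. For $\zeta\in\Omega$, $\overline{H}_f(\zeta)=\inf\{u(\zeta):u\in\mathcal{U}_f\}$ and $\underline{H}_f(\zeta)=\sup\{v(\zeta):v\in\mathcal{L}_f\}$. *)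

(* Defs.v *)
From HB Require Import structures.
From mathcomp Require Import all_boot all_order all_algebra.
From mathcomp Require Import all_classical all_reals all_analysis.

Set Implicit Arguments.
Unset Strict Implicit.
Unset Printing Implicit Defensive.

Import Order.TTheory GRing.Theory Num.Theory.
Import numFieldNormedType.Exports.

Local Open Scope classical_set_scope.
Local Open Scope ring_scope.

(* The spatial dimension is n.+1, so that eigenvalues of the spatial Hessian
   exist.  The norm of spacetime is a maximum norm; it is used only for the
   topology and for boundedness, where it is equivalent to the Euclidean one. *)
Notation spacetime R n := ('rV[R]_n.+1 * R)%type.

Section Domains.
Context {T : topologicalType}.

Definition boundary (A : set T) : set T := closure A `\` A°.

Definition domain (A : set T) : Prop := [/\ open A, connected A & A !=set0].

(* Mirrors lower_semicontinuous. *)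
Definition upper_semicontinuous {R : numFieldType} (f : T -> \bar R) : Prop :=
  forall x a, (f x < a%:E)%E ->
    exists2 V, nbhs x V & forall y, V y -> (f y < a%:E)%E.

End Domains.

Section Derivatives.
Context {R : realType} {n : nat}.
Implicit Types (psi : spacetime R n -> R) (z : spacetime R n).

(* Coordinate directions: Some i is the x_i-direction, None the t-direction. *)
Definition coord_dir (k : option 'I_n.+1) : spacetime R n :=
  if k is Some i then (delta_mx 0 i, 0) else (0, 1).

Definition pd (k : option 'I_n.+1) psi : spacetime R n -> R :=
  fun z => 'D_(coord_dir k) psi z.

(* psi is of class C^m on the open set Om, jointly in (x, t); the values of psi
   outside Om play no role. *)
Fixpoint class_C (m : nat) (Om : set (spacetime R n)) psi : Prop :=
  (forall z, Om z -> {for z, continuous psi}) /\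
  (if m is m'.+1 then
     forall k, (forall z, Om z -> derivable psi z (coord_dir k)) /\
               class_C m' Om (pd k psi)
   else True).

Definition dt psi z : R := pd None psi z.

Definition grad psi z : 'rV[R]_n.+1 := \row_i pd (Some i) psi z.

Definition hess psi z : 'M[R]_n.+1 :=
  \matrix_(i, j) pd (Some j) (pd (Some i) psi) z.

(* Only meaningful where grad psi z != 0. *)
Definition inf_laplacian psi z : R :=
  (\sum_i \sum_j grad psi z 0 i * grad psi z 0 j * hess psi z i j)
  / (\sum_i grad psi z 0 i ^+ 2).

End Derivatives.

(* For a symmetric real matrix the set of eigenvalues is finite and nonempty,
   so these are the smallest and the largest eigenvalue. *)
Definition min_eigenvalue {R : realType} {n : nat} (X : 'M[R]_n.+1) : R :=
  inf [set a | eigenvalue X a].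

Definition max_eigenvalue {R : realType} {n : nat} (X : 'M[R]_n.+1) : R :=
  sup [set a | eigenvalue X a].

Section Viscosity.
Context {R : realType} {n : nat}.
Implicit Types (Om : set (spacetime R n)) (u v : spacetime R n -> \bar R).
Implicit Types (f : spacetime R n -> R).

(* Functions on Om are represented by total functions of which only the values
   on Om matter.  In subspace Om the points outside Om are isolated, so
   semicontinuity there is semicontinuity of the restriction to Om. *)

Definition viscosity_subsolution Om u : Prop :=
  [/\ forall z, Om z -> u z != +oo%E,
      upper_semicontinuous (u : subspace Om -> \bar R)
    & forall psi z0, class_C 2 Om psi -> Om z0 ->
        (forall z, Om z -> (u z - (psi z)%:E <= u z0 - (psi z0)%:E)%E) ->
        (grad psi z0 != 0 -> dt psi z0 - inf_laplacian psi z0 <= 0) /\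
        (grad psi z0 = 0 ->
           dt psi z0 - max_eigenvalue (hess psi z0) <= 0)].

Definition viscosity_supersolution Om v : Prop :=
  [/\ forall z, Om z -> v z != -oo%E,
      lower_semicontinuous (v : subspace Om -> \bar R)
    & forall psi z0, class_C 2 Om psi -> Om z0 ->
        (forall z, Om z -> (v z0 - (psi z0)%:E <= v z - (psi z)%:E)%E) ->
        (grad psi z0 != 0 -> dt psi z0 - inf_laplacian psi z0 >= 0) /\
        (grad psi z0 = 0 ->
           dt psi z0 - min_eigenvalue (hess psi z0) >= 0)].

Definition viscosity_solution Om u : Prop :=
  viscosity_subsolution Om u /\ viscosity_supersolution Om u.

Definition upper_class Om f : set (spacetime R n -> \bar R) :=
  [set u | viscosity_supersolution Om u /\
     forall z, boundary Om z ->
       ((f z)%:E <= limf_einf u (within Om (nbhs z)))%E].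

Definition lower_class Om f : set (spacetime R n -> \bar R) :=
  [set v | viscosity_subsolution Om v /\
     forall z, boundary Om z ->
       (limf_esup v (within Om (nbhs z)) <= (f z)%:E)%E].

Definition upper_perron Om f : spacetime R n -> \bar R :=
  fun z => ereal_inf [set u z | u in upper_class Om f].

Definition lower_perron Om f : spacetime R n -> \bar R :=
  fun z => ereal_sup [set v z | v in lower_class Om f].

End Viscosity.

(* Main.v *)
(** The viscosity inequalities are equivalent to inequalities on parabolic
    second-order jets (Taylor expansion in one direction, coercive polynomial
    test functions in the other), so everything is done with jets.

    Boundary points may be irregular, so the upper Perron solution [H] itself
    need not belong to the upper class and its continuity cannot come from
    comparison on the whole domain.  Instead, every supersolution [u] of the
    class can be lowered, inside the class, to one with a local one-sided modulus
    of continuity that does not depend on [u].  In space, near a base point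
    [(x0, t0)], one takes the minimum of [u] with
      [inf_y u(y, t) + L |x - y|^(1/2) + k |x - x0|^2 + k (t - t0)^2],
    which is again a supersolution: the test function is smooth in [x], so it can
    be transported to [y] along an affine map that moves [x] against [y] in the
    direction of [x - y], and the concavity of the square root wins.  Forward in
    time one glues in a paraboloid barrier, and backward in time one compares
    with a strict paraboloid subsolution.

    Consequently [H] is continuous and is locally a uniform limit of members of
    the class.  It is a supersolution by stability of jets, and a subsolution by
    Perron's bump construction.  The lower solution is handled by [u |-> - u]. *)

Require Import Defs.
From HB Require Import structures.
From mathcomp Require Import all_boot all_order all_algebra.
From mathcomp Require Import all_classical all_reals all_analysis.
From mathcomp Require Import ring lra.
Import Order.TTheory GRing.Theory Num.Theory.
Import numFieldNormedType.Exports.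
Local Open Scope classical_set_scope.
Local Open Scope ring_scope.

Set Implicit Arguments.
Unset Strict Implicit.
Unset Printing Implicit Defensive.

(** * Quadratic forms and eigenvalues *)

Section QuadraticForms.
Context {R : realType} {n : nat}.
Local Notation V := 'rV[R]_n.+1.
Local Notation M := 'M[R]_n.+1.
Implicit Types (x y h e p q : V) (X Y : M).

(** The operator is degenerate: it sees second derivatives along the gradient only. Three features
    follow from this. Both points of the doubling share the time [t], and only one of the two
    functions involved is nonsmooth, so no theorem on sums is needed: as y varies, x is substituted
    as an affine function of y. The gradients at x and at y are not parallel, because the localising
    term k |x - x0|^2 tilts the first one; hence x is moved along its own gradient direction rather
    than along x - y, and L has to dominate k to keep the angle small. The second radial derivative
    of L |x - y|^(1/2) is at most - L / 4 at distances at most 1, and this gain pays for the Hessian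
    and the time derivative of the localisation. No smoothing in time is attempted: the modulus in
    space is turned into one in time by paraboloids whose speed beats their Hessian in every
    direction, so their gradient never has to be controlled. *)

Definition dot x y : R := \sum_i x 0 i * y 0 i.

Definition qf X h : R := \sum_i \sum_j X i j * (h 0 i * h 0 j).

Lemma dotC x y : dot x y = dot y x.
Proof. by apply: eq_bigr => i _; rewrite mulrC. Qed.

Lemma dotDl x y z : dot (x + y) z = dot x z + dot y z.
Proof. by rewrite /dot -big_split; apply: eq_bigr => i _; rewrite !mxE mulrDl. Qed.

Lemma dotZl c x y : dot (c *: x) y = c * dot x y.
Proof. by rewrite /dot mulr_sumr; apply: eq_bigr => i _; rewrite !mxE mulrA. Qed.

Lemma dotNl x y : dot (- x) y = - dot x y.
Proof. by rewrite -scaleN1r dotZl mulN1r. Qed.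

Lemma dotBl x y z : dot (x - y) z = dot x z - dot y z.
Proof. by rewrite dotDl dotNl. Qed.

Lemma dotDr x y z : dot z (x + y) = dot z x + dot z y.
Proof. by rewrite !(dotC z) dotDl. Qed.

Lemma dotZr c x y : dot y (c *: x) = c * dot y x.
Proof. by rewrite !(dotC y) dotZl. Qed.

Lemma dotNr x y : dot y (- x) = - dot y x.
Proof. by rewrite !(dotC y) dotNl. Qed.

Lemma dotBr x y z : dot z (x - y) = dot z x - dot z y.
Proof. by rewrite !(dotC z) dotBl. Qed.

Lemma dot0l x : dot 0 x = 0.
Proof. by rewrite -(scale0r (0 : V)) dotZl mul0r. Qed.

Lemma dot0r x : dot x 0 = 0.
Proof. by rewrite dotC dot0l. Qed.

Lemma dot_ge0 x : 0 <= dot x x.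
Proof. by apply: sumr_ge0 => i _; rewrite -expr2 sqr_ge0. Qed.

Lemma dot_coord x i : x 0 i ^+ 2 <= dot x x.
Proof.
rewrite /dot (bigD1 i)//= expr2 lerDl.
by apply: sumr_ge0 => j _; rewrite -expr2 sqr_ge0.
Qed.

Lemma dot_eq0 x : dot x x = 0 -> x = 0.
Proof.
move=> x0; apply/rowP => i; rewrite mxE; apply/eqP.
by rewrite -sqrf_eq0 eq_le sqr_ge0 andbT -x0 dot_coord.
Qed.

Lemma dot_gt0 x : x != 0 -> 0 < dot x x.
Proof.
by move=> x0; rewrite lt_def dot_ge0 andbT; apply: contraNN x0 => /eqP/dot_eq0 ->.
Qed.

Lemma norm_rVP x c : 0 <= c -> reflect (forall i, `|x 0 i| <= c) (`|x| <= c).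
Proof.
move=> c0; rewrite [leLHS]/Num.Def.normr/= mx_normrE.
apply: (iffP idP) => [/bigmax_leP[_ H] i|H].
  exact: (H (0, i)).
by apply/bigmax_leP; split => // -[i j] _ /=; rewrite ord1.
Qed.

Lemma coord_le_norm x i : `|x 0 i| <= `|x|.
Proof. exact: (norm_rVP x (normr_ge0 x) _). Qed.

(** The norm of row vectors is the maximum norm, while the unit vectors of the equation are
    Euclidean. This bound and [dot_le_sqr_norm] convert between the two and are the source of the
    factors [n.+1%:R] further on. *)
Lemma sqr_norm_le_dot x : `|x| ^+ 2 <= dot x x.
Proof.
have s0 := sqrtr_ge0 (dot x x).
rewrite -(sqr_sqrtr (dot_ge0 x)) ler_sqr ?nnegrE//.
apply/norm_rVP => // i.
by rewrite -(ler_sqr (normr_ge0 _) s0) real_normK ?num_real// sqr_sqrtr ?dot_ge0// dot_coord.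
Qed.

Lemma dot_le_sqr_norm x : dot x x <= n.+1%:R * `|x| ^+ 2.
Proof.
have -> : n.+1%:R * `|x| ^+ 2 = \sum_(i < n.+1) `|x| ^+ 2.
  by rewrite sumr_const card_ord mulr_natl.
apply: ler_sum => i _; rewrite -expr2 -real_normK ?num_real//.
by rewrite ler_sqr ?nnegrE// coord_le_norm.
Qed.

Lemma cauchy_schwarz x y : dot x y ^+ 2 <= dot x x * dot y y.
Proof.
have [->|y0] := eqVneq y 0; first by rewrite !dot0r mulr0 expr0n.
have yy := dot_gt0 y0.
have := dot_ge0 (dot y y *: x - dot x y *: y).
rewrite dotBl !dotBr !dotZl !dotZr (dotC y x) => H.
have : 0 <= dot y y * (dot x x * dot y y - dot x y ^+ 2) by nra.
by rewrite pmulr_rge0// subr_ge0.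
Qed.

Lemma dot_abs_le x y : `|dot x y| <= n.+1%:R * (`|x| * `|y|).
Proof.
have -> : n.+1%:R * (`|x| * `|y|) = \sum_(i < n.+1) (`|x| * `|y|).
  by rewrite sumr_const card_ord mulr_natl.
apply: le_trans (ler_norm_sum _ _ _) _.
by apply: ler_sum => i _; rewrite normrM ler_pM// coord_le_norm.
Qed.

Lemma qfE X h : qf X h = dot (h *m X) h.
Proof.
rewrite /qf /dot exchange_big/=; apply: eq_bigr => j _.
by rewrite mxE mulr_suml; apply: eq_bigr => i _; ring.
Qed.

Lemma qfDl X Y h : qf (X + Y) h = qf X h + qf Y h.
Proof. by rewrite !qfE mulmxDr dotDl. Qed.

Lemma qfNl X h : qf (- X) h = - qf X h.
Proof. by rewrite !qfE mulmxN dotNl. Qed.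

Lemma qfZl c X h : qf (c *: X) h = c * qf X h.
Proof. by rewrite !qfE -scalemxAr dotZl. Qed.

Lemma qf_scalar c h : qf c%:M h = c * dot h h.
Proof. by rewrite qfE mul_mx_scalar dotZl. Qed.

Lemma qfZ c X h : qf X (c *: h) = c ^+ 2 * qf X h.
Proof. by rewrite !qfE -scalemxAl dotZl dotZr mulrA -expr2. Qed.

Lemma dot_trmx X x y : dot (x *m X) y = dot x (y *m X^T).
Proof.
rewrite /dot.
under eq_bigr do rewrite mxE mulr_suml.
under [RHS]eq_bigr do rewrite mxE mulr_sumr.
rewrite exchange_big/=; apply: eq_bigr => i _; apply: eq_bigr => j _.
by rewrite mxE; ring.
Qed.

Definition outer p q : M := p^T *m q.

Lemma mul_outer h p q : h *m outer p q = dot h p *: q.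
Proof.
rewrite /outer mulmxA; apply/rowP => i; rewrite !mxE big_ord1 !mxE.
by congr (_ * _); apply: eq_bigr => j _; rewrite mxE.
Qed.

Lemma qf_outer p q h : qf (outer p q) h = dot p h * dot q h.
Proof. by rewrite qfE mul_outer dotZl (dotC h p). Qed.

(** The Hessian part of a jet is an arbitrary matrix, of which [qf] sees the symmetric part; hence
    [X + X^T] in the cross term. *)
Lemma qfD X x y :
  qf X (x + y) = qf X x + dot (x *m (X + X^T)) y + qf X y.
Proof.
rewrite !qfE mulmxDl !dotDl !dotDr mulmxDr dotDl (dot_trmx X y x).
by rewrite (dotC y (x *m X^T)); ring.
Qed.

Lemma continuous_qf X : continuous (qf X).
Proof.
apply: continuous_big => [|i _]; first exact: add_continuous.
apply: continuous_big => [|j _ x]; first exact: add_continuous.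
apply: (@continuousM R V (fun=> X i j) (fun h : V => h 0 i * h 0 j) x); first exact: cst_continuous.
apply: (@continuousM R V (fun h : V => h 0 i) (fun h : V => h 0 j) x); exact: coord_continuous.
Qed.

Lemma dot_continuousl y : continuous (fun x => dot x y).
Proof.
apply: continuous_big => [|i _ x]; first exact: add_continuous.
by apply: (@continuousM R V (fun h : V => h 0 i) (fun=> y 0 i) x); [exact: coord_continuous|exact: cst_continuous].
Qed.

Definition sphere : set V := [set e | dot e e = 1].

Lemma compact_sphere : compact sphere.
Proof.
apply: bounded_closed_compact.
  exists 1; split; first exact: num_real.
  move=> c c1 e; rewrite /sphere/= => e1.
  have := sqr_norm_le_dot e; rewrite e1 => H.
  by have := normr_ge0 e; nra.
have -> : sphere = qf 1%:M @^-1` [set 1].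
  by apply/seteqP; split => e; rewrite /sphere/= qf_scalar mul1r.
apply: preimage_closed; last exact: closed_eq.
by move=> x _; exact: continuous_qf.
Qed.

Lemma sphere_nonempty : sphere !=set0.
Proof.
exists (delta_mx 0 ord0); rewrite /sphere/= /dot (bigD1 ord0)//= !mxE !eqxx mulr1.
rewrite big1 ?addr0// => i i0; rewrite !mxE eqxx/=.
by rewrite (negbTE i0) mulr0.
Qed.

Lemma normalize x : x != 0 -> exists2 c : R, 0 < c & sphere (c *: x).
Proof.
move=> x0; have d0 := dot_gt0 x0; have s0 : 0 < Num.sqrt (dot x x) by rewrite sqrtr_gt0.
exists (Num.sqrt (dot x x))^-1; first by rewrite invr_gt0.
rewrite /sphere/= dotZl dotZr mulrA -expr2 exprVn sqr_sqrtr ?dot_ge0//.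
by rewrite mulVf// gt_eqF.
Qed.

Lemma qf_abs_le X : exists2 C : R, 0 <= C & forall h, `|qf X h| <= C * `|h| ^+ 2.
Proof.
exists (\sum_i \sum_j `|X i j|); first by apply: sumr_ge0 => i _; apply: sumr_ge0.
move=> h; apply: le_trans (ler_norm_sum _ _ _) _; rewrite mulr_suml.
apply: ler_sum => i _; apply: le_trans (ler_norm_sum _ _ _) _; rewrite mulr_suml.
apply: ler_sum => j _; rewrite !normrM ler_wpM2l// expr2.
by rewrite ler_pM// coord_le_norm.
Qed.

Lemma qf_sphere_min X :
  exists2 e, sphere e & forall e', sphere e' -> qf X e <= qf X e'.
Proof.
have [|e es H] := EVT_min_rV sphere_nonempty compact_sphere (f := qf X).
  by apply: continuous_subspaceT; exact: continuous_qf.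
exists e; [by rewrite inE in es|by move=> e' e's; apply: H; rewrite inE].
Qed.

End QuadraticForms.

Arguments sphere {R n}.

Section Eigenvalues.
Context {R : realType} {n : nat}.
Local Notation V := 'rV[R]_n.+1.
Implicit Types (X : 'M[R]_n.+1).

(* A minimiser of the Rayleigh quotient is an eigenvector: perturbing it in
   the direction [w := e *m X - m *: e] changes the form by a first-order
   term proportional to [dot w w]. *)
Lemma rayleigh_min X : X^T = X ->
  exists2 e, sphere e & qf X e = min_eigenvalue X /\
    forall e', sphere e' -> min_eigenvalue X <= qf X e'.
Proof.
move=> symX; have [e es emin] := qf_sphere_min X.
set m := qf X e.
have qge (h : V) : m * dot h h <= qf X h.
  have [->|h0] := eqVneq h 0; first by rewrite dot0l mulr0 qfE mul0mx dot0l.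
  have [c c0 cs] := normalize h0.
  have := emin _ cs; rewrite -/m qfZ => H.
  have : c ^+ 2 * dot h h = 1 by move: cs; rewrite /sphere/= dotZl dotZr mulrA -expr2.
  move=> c1; have c2 : 0 < c ^+ 2 by rewrite exprn_gt0.
  by rewrite -(ler_pM2l c2) mulrCA c1 mulr1.
have ev : e *m X = m *: e.
  apply/eqP; rewrite -subr_eq0; apply/eqP; apply: dot_eq0.
  have [w wE] : exists w, w = e *m X - m *: e by eexists.
  rewrite -wE.
  pose A := qf X w - m * dot w w.
  have A0 : 0 <= A by rewrite subr_ge0.
  have key s : 0 <= 2 * s * dot w w + s ^+ 2 * A.
    have := qge (e + s *: w).
    rewrite qfD symX -/m mulmxDr qfZ !dotDl !dotDr !dotZl !dotZr.
    rewrite (_ : dot e e = 1)// => H.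
    have ww : dot w w = dot (e *m X) w - m * dot e w.
      by rewrite {1}wE dotBl dotZl.
    rewrite (dotC w e) in H; rewrite /A; move: H; rewrite ww.
    set a := dot _ w; set b := dot e w; set c := qf X w; move=> H; lra.
  apply/eqP; rewrite eq_le dot_ge0 andbT leNgt; apply/negP => w0.
  (* Close to the minimiser of the quadratic in [s]; the extra [dot w w] keeps the denominator
     positive when [A = 0]. *)
  have := key (- dot w w / (A + dot w w)).
  have Aw : 0 < A + dot w w by rewrite ltr_wpDl.
  set t := dot w w / (A + dot w w).
  have t0 : 0 < t by rewrite divr_gt0.
  have tE : t * (A + dot w w) = dot w w by rewrite divfK// gt_eqF.
  rewrite mulNr -/t => H.
  have : t ^+ 2 * A <= t * dot w w by nra.
  by nra.
have e0 : e != 0.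
  apply/eqP => e0; move: es; rewrite /sphere/= e0 dot0l => /eqP.
  by rewrite eq_sym oner_eq0.
have mE : min_eigenvalue X = m.
  apply/eqP; rewrite eq_le; apply/andP; split.
    apply: ge_inf; last by apply/eigenvalueP; exists e.
    exists m => a /eigenvalueP[v va v0].
    have := qge v; rewrite qfE va dotZl.
    by rewrite ler_pM2r// dot_gt0.
  apply: lb_le_inf; first by exists m; apply/eigenvalueP; exists e.
  move=> a /eigenvalueP[v va v0].
  have := qge v; rewrite qfE va dotZl.
  by rewrite ler_pM2r// dot_gt0.
by exists e => //; split; rewrite mE.
Qed.

Lemma eigenvalueN X (a : R) : eigenvalue (- X) a = eigenvalue X (- a).
Proof.
by apply/eigenvalueP/eigenvalueP => -[v va v0]; exists v => //;
  move: va; rewrite mulmxN ?scaleNr => /(congr1 (@GRing.opp _));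
  rewrite ?opprK ?scaleNr // => ->; rewrite ?scaleNr ?opprK.
Qed.

Lemma min_eigenvalueN X : min_eigenvalue (- X) = - max_eigenvalue X.
Proof.
rewrite /min_eigenvalue /inf /max_eigenvalue; congr (- sup _).
apply/seteqP; split => a /=.
  by move=> [b]; rewrite eigenvalueN => H <-.
by move=> H; exists (- a); rewrite ?eigenvalueN opprK.
Qed.

End Eigenvalues.

(** * Semicontinuity and parabolic jets *)

Section LowerSemicontinuity.
Context {R : realType} {T : topologicalType}.
Implicit Types (u v g : T -> R) (A : set T).

Definition lsc_at v x := forall e, 0 < e -> \forall y \near x, v x - e < v y.

Lemma lsc_at_continuous g x : {for x, continuous g} -> lsc_at g x.
Proof.
move=> /cvgrPdist_lt cg e e0; near=> y.
have : `|g x - g y| < e by near: y; exact: cg.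
by rewrite ltr_norml => /andP[_]; lra.
Unshelve. all: by end_near. Qed.

Lemma lsc_atD u v x : lsc_at u x -> lsc_at v x -> lsc_at (fun y => u y + v y) x.
Proof.
move=> lu lv e e0; have e2 : 0 < e / 2 by rewrite divr_gt0.
near=> y.
have : u x - e / 2 < u y by near: y; exact: lu.
have : v x - e / 2 < v y by near: y; exact: lv.
lra.
Unshelve. all: by end_near. Qed.

Lemma lsc_at_min u v x :
  lsc_at u x -> lsc_at v x -> lsc_at (fun y => Num.min (u y) (v y)) x.
Proof.
move=> lu lv e e0; near=> y.
have h1 : u x - e < u y by near: y; exact: lu.
have h2 : v x - e < v y by near: y; exact: lv.
by rewrite lt_min; apply/andP; split; [apply: le_lt_trans h1|apply: le_lt_trans h2];
  rewrite lerD2r ge_min lexx ?orbT.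
Unshelve. all: by end_near. Qed.

Lemma near_eq_lsc_at u v x :
  (\forall y \near x, u y = v y) -> lsc_at u x -> lsc_at v x.
Proof.
move=> uv lu e e0; have uvx := nbhs_singleton uv; near=> y.
have <- : u y = v y by near: y.
by rewrite -uvx; near: y; exact: lu.
Unshelve. all: by end_near. Qed.

(** The sublevel sets of [v] in [A] form a filter base, since values of [v] are totally ordered.
    Compactness then yields one index [i] in [A] with [v i] strictly below [v] on all of [A], in
    particular below [v i] itself. *)
Lemma compact_near_lt v A :
  compact A -> (forall x, A x -> exists2 i, A i & \forall y \near x, v i < v y) ->
  A = set0.
Proof.
move=> cA H; apply/seteqP; split => // a0 Aa0 /=.
pose F := filter_from A (fun i => [set j | A j /\ v j <= v i]).
have FF : Filter F.
  apply: filter_from_filter; first by exists a0.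
  move=> i j Ai Aj; have [vij|/ltW vji] := leP (v i) (v j).
    by exists i => // k [Ak ki]; split; split => //; exact: le_trans ki vij.
  by exists j => // k [Ak kj]; split; split => //; exact: le_trans kj vji.
have := (iffLR (compact_near_coveringP A)) cA _ F (fun i x => v i < v x) FF.
case=> [x Ax|i Ai /(_ i (conj Ai (lexx _)) i Ai)]; last by rewrite ltxx.
have [i Ai Hi] := H x Ax.
exists ([set y | v i < v y], [set j | A j /\ v j <= v i]) => /=.
  by split => //; exists i.
by move=> [y j] /= [Hy [_ Hj]]; exact: le_lt_trans Hj Hy.
Qed.

Lemma lsc_compact_min v A : compact A -> A !=set0 ->
  (forall x, A x -> lsc_at v x) ->
  exists2 x, A x & forall y, A y -> v x <= v y.
Proof.
move=> cA A0 lv; apply: contrapT => H; move/set0P/eqP: A0; apply.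
apply: (compact_near_lt (v := v)) => // x Ax.
have [y Ay yx] : exists2 y, A y & v y < v x.
  apply: contrapT => H'; apply: H; exists x => // y Ay.
  by rewrite leNgt; apply/negP => yx; apply: H'; exists y.
exists y => //; have e0 : 0 < v x - v y by rewrite subr_gt0.
by have := lv x Ax _ e0; rewrite subKr.
Qed.

End LowerSemicontinuity.

(** A tube argument: by compactness of [B] the bound [m x - e < g y x'] holds for all [y] in [B] at
    once when [x'] is near [x], and [m x'] is bounded below by one of these values. *)
Lemma lsc_marginal (R : realType) (S T : topologicalType) (B : set T)
    (g : T -> S -> R) (m : S -> R) (x : S) : compact B ->
  (forall y, B y -> lsc_at (fun p : S * T => g p.2 p.1) (x, y)) ->
  (forall y, B y -> m x <= g y x) ->
  (\forall x' \near x, exists2 y, B y & g y x' <= m x') ->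
  lsc_at m x.
Proof.
move=> cB lg lem exm e e0.
have H : \forall x' \near x, B `<=` (fun y => m x - e < g y x').
  apply: ((iffLR (compact_near_coveringP B)) cB) => y By.
  have [[U V] /= [xU yV] UV] := lg y By e e0.
  exists (V, U) => //= -[y' x'] /= [Vy' Ux'].
  by apply: le_lt_trans (UV (x', y') (conj Ux' Vy')); rewrite /= lerD2r lem.
apply: filterS2 H exm => x' H [y By]; apply: lt_le_trans; exact: H.
Qed.

Section Spacetime.
Context {R : realType} {n : nat}.
Local Notation V := 'rV[R]_n.+1.
Implicit Types (z : spacetime R n) (P : set (spacetime R n)).

Lemma st_nearP z P : nbhs z P <->
  exists2 d, 0 < d & forall x t, `|x - z.1| < d -> `|t - z.2| < d -> P (x, t).
Proof.
split=> [/nbhs_ballP[d /= d0 H]|[d d0 H]].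
  by exists d => // x t xd td; apply: H; split; rewrite -ball_normE/= distrC.
apply/nbhs_ballP; exists d => // -[x t] [] /=; rewrite -!ball_normE /ball_/= => xd td.
by apply: H; rewrite distrC.
Qed.

Lemma compact_rV_ball (x : V) r : compact [set y | `|y - x| <= r].
Proof.
apply: bounded_closed_compact.
  exists (`|x| + r); split; first exact: num_real.
  move=> c cr y /= yx; rewrite (le_trans _ (ltW cr))//.
  by rewrite -[y](subrK x) addrC (le_trans (ler_normD _ _))// lerD2l.
have cf : continuous (fun y : V => `|y - x|).
  move=> y; apply: (@continuous_comp _ _ _ (fun y : V => y - x) (fun y : V => `|y|)).
    by apply: continuousB => //; exact: cst_continuous.
  exact: norm_continuous.
rewrite (_ : mkset _ = (fun y : V => `|y - x|) @^-1` [set s | s <= r])//.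
by apply: preimage_closed; [move=> y _; exact: cf|exact: closed_le].
Qed.

Lemma compact_cylinder (x : V) r a b :
  compact [set z : spacetime R n | `|z.1 - x| <= r /\ a <= z.2 <= b].
Proof.
rewrite (_ : mkset _ = [set y | `|y - x| <= r] `*` `[a, b]%classic).
  by apply: compact_setX; [exact: compact_rV_ball|exact: segment_compact].
by apply/seteqP; split => -[y s] /=; rewrite in_itv.
Qed.

Lemma st_bounded_closed_compact P : bounded_set P -> closed P -> compact P.
Proof.
move=> [M [_ HM]] cP.
apply: (subclosed_compact cP (@compact_cylinder 0 (M + 1) (- (M + 1)) (M + 1))).
move=> z Pz; have := HM (M + 1); rewrite ltrDl ltr01 => /(_ isT z Pz) Hz.
have : Num.max `|z.1| `|z.2| <= M + 1 by exact: Hz.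
by rewrite ge_max => /andP[h1 h2] /=; rewrite subr0 h1 -ler_norml.
Qed.

End Spacetime.

(** * Parabolic jets and the one-direction form of the equation *)

Section Jets.
Context {R : realType} {n : nat}.
Local Notation V := 'rV[R]_n.+1.
Local Notation M := 'M[R]_n.+1.
Implicit Types (a : R) (p e h : V) (X : M) (z : spacetime R n).
Implicit Types (v w b : spacetime R n -> R).

(* Both cases of the viscosity inequality at once: for [p != 0] the vector [e]
   is [p / |p|] up to sign, for [p = 0] it is an arbitrary unit vector. *)
Definition par_super a p X : Prop :=
  exists e, [/\ sphere e, exists c, p = c *: e & qf X e <= a].

Lemma unit_direction p : exists2 e, sphere e & exists c, p = c *: e.
Proof.
have [->|/normalize[c c0 cs]] := eqVneq p 0.
  by have [e es] := @sphere_nonempty R n; exists e => //; exists 0; rewrite scale0r.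
by exists (c *: p) => //; exists c^-1; rewrite scalerA mulVf ?scale1r// gt_eqF.
Qed.

(* [p] is parallel to the unit vector [e] iff [dot p p - dot p e ^+ 2] vanishes. *)
Lemma par_super_closed a p X :
  (forall k, 0 < k -> exists a' p' X', [/\ a' <= a + k, dot (p - p') (p - p') <= k,
     forall e, sphere e -> qf X e <= qf X' e + k & par_super a' p' X']) ->
  par_super a p X.
Proof.
move=> H.
pose F e := dot p p - dot e p ^+ 2 + Num.max 0 (qf X e - a).
have cF : continuous F.
  move=> e; apply: (@continuousD _ _ _ (fun e => dot p p - dot e p ^+ 2)
    (fun e => Num.max 0 (qf X e - a))).
    apply: (@continuousB _ _ _ (fun=> dot p p) (fun e => dot e p ^+ 2)).
      exact: cst_continuous.
    apply: (@continuous_comp _ _ _ (fun e => dot e p) (fun s => s ^+ 2)).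
      exact: dot_continuousl.
    exact: exprn_continuous.
  apply: (@continuous_max _ _ (fun=> 0) (fun e => qf X e - a)).
    exact: cst_continuous.
  apply: (@continuousB _ _ _ (fun e => qf X e) (fun=> a)).
    exact: continuous_qf.
  exact: cst_continuous.
have [e /[!inE] es emin] := EVT_min_rV sphere_nonempty compact_sphere
  (continuous_subspaceT cF).
have cs0 : 0 <= dot p p - dot e p ^+ 2.
  by have := cauchy_schwarz e p; rewrite es mul1r; lra.
have F0 : F e <= 0.
  apply/ler_addgt0Pr => k k0; rewrite add0r.
  have k3 : 0 < k / 3 by rewrite divr_gt0.
  have [a' [p' [X' [ha hp hX [e' [e's [c p'e] qe]]]]]] := H _ k3.
  have := emin e'; rewrite inE => /(_ e's)/le_trans; apply.
  have -> : F e' = dot (p - p') (p - p') - dot e' (p - p') ^+ 2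
      + Num.max 0 (qf X e' - a).
    rewrite /F p'e !dotBl !dotBr !dotZl !dotZr e's (dotC e' p); ring.
  have : Num.max 0 (qf X e' - a) <= k / 3 + k / 3.
    by rewrite ge_max; have := hX _ e's; lra.
  by have := sqr_ge0 (dot e' (p - p')); lra.
have m0 : 0 <= Num.max 0 (qf X e - a) by rewrite le_max lexx.
exists e; split => //.
  exists (dot e p); apply/eqP; rewrite -subr_eq0; apply/eqP; apply: dot_eq0.
  rewrite !dotBl !dotBr !dotZl !dotZr es (dotC p e).
  by move: F0; rewrite /F; lra.
have : Num.max 0 (qf X e - a) <= 0 by move: F0; rewrite /F; lra.
by rewrite ge_max lexx/=; lra.
Qed.

Definition quad a p X K (h : V) (s : R) : R :=
  a * s + dot p h + 2^-1 * qf X h - K * s ^+ 2.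

(* Lower parabolic second-order jets; the quadratic term in time is free, since
   the equation does not see it. *)
Definition jet v z a p X : Prop := exists K, \forall z' \near z,
  v z + quad a p X K (z'.1 - z.1) (z'.2 - z.2) <= v z'.

Definition jet_super v z : Prop := forall a p X, jet v z a p X -> par_super a p X.

(** A lower jet of [w] is also one of the larger function [v]. This is what makes minima and
    truncations of supersolutions supersolutions. *)
Lemma jet_super_touch v w z : w z = v z -> (\forall z' \near z, w z' <= v z') ->
  jet_super v z -> jet_super w z.
Proof.
move=> wv lewv sv a p X [K HK]; apply: sv; exists K.
near=> z'; rewrite -wv; apply: (@le_trans _ _ (w z')); last by near: z'.
by near: z'.
Unshelve. all: by end_near. Qed.

Lemma le_sqr_small (c C d : R) : 0 < d ->
  (forall s, `|s| < d -> c * s <= C * s ^+ 2) -> c = 0.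
Proof.
move=> d0 H; apply/eqP; rewrite -sqrf_eq0 eq_le sqr_ge0 andbT leNgt; apply/negP => c0.
have [s s0 [sd sC]] : exists2 s, 0 < s & s * `|c| < d /\ s * `|C| < 1.
  have D0 : 0 < 2 * (1 + `|c| + `|C|).
    by have := normr_ge0 c; have := normr_ge0 C; lra.
  have m0 : 0 < Num.min d 1 by rewrite lt_min d0 ltr01.
  exists (Num.min d 1 / (2 * (1 + `|c| + `|C|))); first by rewrite divr_gt0.
  have md : Num.min d 1 <= d by rewrite ge_min lexx.
  have m1 : Num.min d 1 <= 1 by rewrite ge_min lexx orbT.
  have := normr_ge0 c; have := normr_ge0 C => ? ?.
  by rewrite !(mulrAC _ _^-1) !ltr_pdivrMr//; split; nra.
have := H (s * c); rewrite normrM gtr0_norm// => /(_ sd).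
have : C <= `|C| by exact: ler_norm.
move=> hC hH.
have : s * c ^+ 2 <= s * (s * C) * c ^+ 2 by lra.
have sC1 : 0 < 1 - s * C by nra.
by have := mulr_gt0 (mulr_gt0 s0 c0) sC1; lra.
Qed.

(** Taking [h = 0] isolates the time slope, [s = 0] with [h] along [p - p'] isolates the gradient,
    and a fixed small multiple of [h] then compares the Hessians. *)
Lemma quad_le_quad a p X K a' p' X' K' d : 0 < d ->
  (forall h s, `|h| < d -> `|s| < d -> quad a p X K h s <= quad a' p' X' K' h s) ->
  [/\ a = a', p = p' & forall h, qf X h <= qf X' h].
Proof.
move=> d0 H.
have qf0 Y : qf Y (0 : V) = 0 by rewrite qfE mul0mx dot0l.
have aE : a = a'.
  apply/eqP; rewrite -subr_eq0; apply/eqP; apply: (le_sqr_small (C := K - K') d0) => s sd.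
  have := H 0 s; rewrite normr0 => /(_ d0 sd); rewrite /quad !dot0r !qf0; lra.
have small (h : V) : exists2 e, 0 < e & forall s, `|s| < e -> `|s *: h| < d.
  have h1 : 0 < `|h| + 1 by rewrite ltr_wpDl.
  exists (d / (`|h| + 1)); first by rewrite divr_gt0.
  move=> s; rewrite ltr_pdivlMr// normrZ; have := normr_ge0 s; have := normr_ge0 h; nra.
have pE : p = p'.
  apply/eqP; rewrite -subr_eq0; apply/eqP; apply: dot_eq0.
  have [e e0 He] := small (p - p').
  apply: (le_sqr_small (C := 2^-1 * (qf X' (p - p') - qf X (p - p'))) e0) => s se.
  have := H (s *: (p - p')) 0; rewrite normr0 => /(_ (He s se) d0).
  by rewrite /quad !qfZ !dotZr {1}dotBl; lra.
split => // h; rewrite leNgt; apply/negP => Xh.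
have [e e0 He] := small h.
have es : `|e / 2| < e by rewrite gtr0_norm; lra.
have := H ((e / 2) *: h) 0; rewrite normr0 => /(_ (He _ es) d0).
rewrite /quad !qfZ !dotZr pE.
have e2 : 0 < (e / 2) ^+ 2 by rewrite exprn_gt0// divr_gt0.
by have : 0 < (e / 2) ^+ 2 * (qf X h - qf X' h); [rewrite mulr_gt0// subr_gt0|lra].
Qed.

Lemma jet_touch_above b z a p X a' p' X' K' : jet b z a p X ->
  (\forall z' \near z, b z' <= b z + quad a' p' X' K' (z'.1 - z.1) (z'.2 - z.2)) ->
  [/\ a = a', p = p' & forall h, qf X h <= qf X' h].
Proof.
move=> [K HK] HB; have [d d0 H] := (st_nearP _ _).1 (filterI HK HB).
apply: (@quad_le_quad a p X K a' p' X' K' d d0) => h s hd sd.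
have := H (z.1 + h) (z.2 + s).
by rewrite /= (addrC z.1) (addrC z.2) !addrK => /(_ hd sd)[]; lra.
Qed.

(** The criterion for explicit barriers. For [p' = 0] every unit vector is parallel to [p'], so the
    inequality is then required in all directions. *)
Lemma jet_super_smooth b z a' p' X' K' :
  (forall e, sphere e -> (exists c, p' = c *: e) -> qf X' e <= a') ->
  (\forall z' \near z, b z' <= b z + quad a' p' X' K' (z'.1 - z.1) (z'.2 - z.2)) ->
  jet_super b z.
Proof.
move=> He Hb a p X /jet_touch_above/(_ Hb)[-> -> leX].
have [e es ec] := unit_direction p'.
by exists e; split => //; apply: le_trans (He _ es ec).
Qed.

Lemma jet_super_cst c z : jet_super (fun=> c) z.
Proof.
apply: (@jet_super_smooth _ z 0 0 0 0); last first.
  by apply/(st_nearP z _); exists 1 => // x t _ _; rewrite /quad qfE mulmx0 !dot0l; lra.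
by move=> e _ _; rewrite qfE mulmx0 dot0l.
Qed.

End Jets.

(** * Second-order Taylor expansion *)

Section Lines.
Context {R : realType} {E : normedModType R}.
Implicit Types (f g : E -> R) (z v w : E) (s r df : R).

Lemma is_derive_line f z v s df :
  is_derive (s *: v + z) v f df <-> is_derive s (1 : R) (fun r : R => f (r *: v + z)) df.
Proof.
have e : (fun h => h^-1 *: ((f \o shift (s *: v + z)) (h *: v) - f (s *: v + z)))
    = (fun h => h^-1 *: (((fun r : R => f (r *: v + z)) \o shift s) (h *: (1 : R))
        - f (s *: v + z))).
  by apply/funext => h /=; rewrite [h *: (1 : R)]mulr1 addrA -scalerDl.
by split => -[H1 H2]; split; move: H1 H2; rewrite /derivable /derive e.
Qed.

Lemma is_derive_line0 f z v df :
  is_derive z v f df <-> is_derive (0 : R) (1 : R) (fun r : R => f (r *: v + z)) df.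
Proof. by rewrite -is_derive_line scale0r add0r. Qed.

Lemma mvt_line f z v s :
  (forall r, `|r| <= `|s| -> derivable f (r *: v + z) v) ->
  exists2 c, `|c| <= `|s| & f (s *: v + z) - f z = s * 'D_v f (c *: v + z).
Proof.
move=> H; pose g r := f (r *: v + z).
have dg r : `|r| <= `|s| -> is_derive r (1 : R) g ('D_v f (r *: v + z)).
  by move=> rs; apply/is_derive_line; exact: derivableP (H r rs).
have [s0|/ltW s0] := leP 0 s.
  have rs r : r \in `[0, s] -> `|r| <= `|s|.
    by rewrite in_itv/= => /andP[r0 rs]; rewrite !ger0_norm.
  have [c cs] := @MVT_segment R g (fun r => 'D_v f (r *: v + z)) 0 s s0
    (fun r rI => dg r (rs r (subset_itv_oo_cc rI)))
    (@derivable_within_continuous _ _ g `[0, s] (fun r rI => @ex_derive _ _ _ _ _ _ _ (dg r (rs r rI)))).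
  rewrite /g scale0r add0r subr0 mulrC => ->.
  by exists c => //; exact: rs.
have rs r : r \in `[s, 0] -> `|r| <= `|s|.
  by rewrite in_itv/= => /andP[sr r0]; rewrite !ler0_norm ?lerN2.
have [c cs] := @MVT_segment R g (fun r => 'D_v f (r *: v + z)) s 0 s0
  (fun r rI => dg r (rs r (subset_itv_oo_cc rI)))
  (@derivable_within_continuous _ _ g `[s, 0] (fun r rI => @ex_derive _ _ _ _ _ _ _ (dg r (rs r rI)))).
rewrite /g scale0r add0r sub0r mulrN => /(congr1 (@GRing.opp _)); rewrite opprB opprK mulrC => ->.
by exists c => //; exact: rs.
Qed.

Lemma is_derive_translate f z v w df :
  is_derive (w + z) v f df -> is_derive z v (fun y => f (w + y)) df.
Proof.
have e : (fun h => h^-1 *: ((f \o shift (w + z)) (h *: v) - f (w + z)))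
    = (fun h => h^-1 *: (((fun y => f (w + y)) \o shift z) (h *: v) - f (w + z))).
  by apply/funext => h /=; rewrite addrCA.
by case=> H1 H2; split; move: H1 H2; rewrite /derivable /derive e.
Qed.

(** The mean value theorem applied along [v] to the increment of [f] by [s *: w], then along [w] to
    the derivative. The left-hand side is symmetric in [v] and [w], which is the source of the
    symmetry of second derivatives. *)
Lemma second_difference f z v w s :
  (forall a b, `|a| <= `|s| -> `|b| <= `|s| -> derivable f (a *: v + (b *: w + z)) v) ->
  (forall a b, `|a| <= `|s| -> `|b| <= `|s| ->
     derivable (fun y => 'D_v f y) (a *: v + (b *: w + z)) w) ->
  exists a b, [/\ `|a| <= `|s|, `|b| <= `|s| &
    f (s *: v + (s *: w + z)) - f (s *: v + z) - (f (s *: w + z) - f z) =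
    s * (s * 'D_w (fun y => 'D_v f y) (a *: v + (b *: w + z)))].
Proof.
move=> H1 H2; pose g y := f (s *: w + y) - f y.
have dg a : `|a| <= `|s| -> is_derive (a *: v + z) v g
    ('D_v f (s *: w + (a *: v + z)) - 'D_v f (a *: v + z)).
  move=> sa; apply: is_deriveB.
    apply: is_derive_translate; apply: derivableP.
    by rewrite addrCA; exact: H1.
  apply: derivableP; have := H1 a 0 sa.
  by rewrite normr0 scale0r add0r; apply.
have [a sa] := @mvt_line g z v s (fun r rs => @ex_derive _ _ _ _ _ _ _ (dg r rs)).
rewrite (@derive_val _ _ _ _ _ _ _ (dg a sa)).
have [b sb ->] := @mvt_line (fun y => 'D_v f y) (a *: v + z) w s
  (fun r rs => ltac:(rewrite addrCA; exact: H2)).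
move=> Hg; exists a, b; split; [exact: sa|exact: sb|].
by rewrite [X in 'D_w _ X]addrCA -Hg /g (addrCA (s *: v)).
Qed.

End Lines.

Section TaylorExpansion.
Context {R : realType} {n : nat}.
Local Notation V := 'rV[R]_n.+1.
Implicit Types (z d y : spacetime R n) (k l : option 'I_n.+1).
Implicit Types (psi g : spacetime R n -> R) (Om : set (spacetime R n)).

Definition coord k z : R := if k is Some i then z.1 0 i else z.2.

Lemma coordD k z d : coord k (z + d) = coord k z + coord k d.
Proof. by case: k => [i|] //=; rewrite mxE. Qed.

Lemma coordZ k s z : coord k (s *: z) = s * coord k z.
Proof. by case: k => [i|] //=; rewrite mxE. Qed.

Lemma coord_dirE k l : coord l (coord_dir k) = (l == k)%:R :> R.
Proof.
case: k => [i|]; case: l => [j|] //=; rewrite mxE ?eqxx//=.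
Qed.

Lemma coord_ext z d : (forall k, coord k z = coord k d) -> z = d.
Proof.
case: z d => [x t] [y s] H; congr pair; last exact: (H None).
by apply/rowP => i; exact: (H (Some i)).
Qed.

Definition box z r y := forall k, `|coord k y - coord k z| <= r.

Lemma boxP z r y : 0 <= r -> box z r y <-> `|y.1 - z.1| <= r /\ `|y.2 - z.2| <= r.
Proof.
move=> r0; split=> [H|[H1 H2] [i|]] /=.
- split; last exact: (H None).
  by apply/norm_rVP => // i; rewrite !mxE; exact: (H (Some i)).
- by have /norm_rVP/(_ i) := H1; rewrite !mxE; apply.
- exact: H2.
Qed.

(* Telescoping along the coordinate directions. *)
Lemma coordinate_mvt g z C r : 0 <= C ->
  (forall y k, box z r y -> derivable g y (coord_dir k) /\ `|pd k g y| <= C) ->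
  forall y, box z r y -> `|g y - g z| <= C * r *+ n.+2.
Proof.
move=> C0 H y yb.
have r0 : 0 <= r by apply: le_trans (yb None).
pose mid w := forall l, coord l w = coord l z \/ coord l w = coord l y.
have stepP (ks : seq (option 'I_n.+1)) : exists2 w, mid w &
    (forall l, l \in ks -> coord l w = coord l y) /\ `|g w - g z| <= C * r *+ size ks.
  elim: ks => [|k ks [w midw [wks wC]]].
    by exists z; [left|rewrite subrr normr0].
  pose s := coord k y - coord k w.
  have sr : `|s| <= r.
    by rewrite /s; case: (midw k) => ->; [exact: yb|rewrite subrr normr0].
  have cl q l : coord l (q *: coord_dir k + w) = q * (l == k)%:R + coord l w.
    by rewrite coordD coordZ coord_dirE.
  have mids : mid (s *: coord_dir k + w).
    move=> l; rewrite cl; have [->|_] := eqVneq l k; last by rewrite mulr0 add0r.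
    by right; rewrite /s mulr1 subrK.
  have bx q : `|q| <= `|s| -> box z r (q *: coord_dir k + w).
    move=> qs l; rewrite cl; have [->|_] := eqVneq l k; last first.
      rewrite mulr0 add0r; case: (midw l) => ->; last exact: yb.
      by rewrite subrr normr0.
    move: qs sr (yb k); rewrite mulr1 /s; case: (midw k) => ->.
      by move=> qs _ yk; rewrite addrK (le_trans qs).
    by rewrite subrr normr0 normr_le0 => /eqP -> _; rewrite add0r.
  have [c cs Hc] := @mvt_line R _ g w (coord_dir k) s (fun q qs => (H _ k (bx q qs)).1).
  exists (s *: coord_dir k + w) => //; split.
    move=> l; rewrite inE => /predU1P[->|lks].
      by rewrite cl eqxx mulr1 subrK.
    rewrite cl; have [->|_] := eqVneq l k; first by rewrite mulr1 subrK.
    by rewrite mulr0 add0r wks.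
  rewrite /= mulrS -(subrK (g w) (g (s *: _ + w))) -addrA.
  apply: le_trans (ler_normD _ _) _; apply: lerD => //.
  by rewrite Hc normrM mulrC ler_pM// (H _ k (bx c cs)).2.
have [w midw [wall wC]] := stepP (enum {: option 'I_n.+1}).
have <- : w = y by apply: coord_ext => k; apply: wall; rewrite mem_enum.
by rewrite -cardE card_option card_ord in wC.
Qed.

Lemma class_C2 Om psi : class_C 2 Om psi ->
  [/\ forall z, Om z -> {for z, continuous psi},
   forall k z, Om z -> derivable psi z (coord_dir k),
   forall k z, Om z -> {for z, continuous (pd k psi)},
   forall k l z, Om z -> derivable (pd k psi) z (coord_dir l) &
   forall k l z, Om z -> {for z, continuous (pd l (pd k psi))}].
Proof.
move=> [c0 H]; split; first exact: c0.
- by move=> k; have [dk _] := H k; exact: dk.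
- by move=> k; have [_ [ck _]] := H k; exact: ck.
- by move=> k l; have [_ [_ H2]] := H k; have [dl _] := H2 l; exact: dl.
by move=> k l; have [_ [_ H2]] := H k; have [_ [cl _]] := H2 l; exact: cl.
Qed.

Lemma open_box Om z : open Om -> Om z ->
  exists2 r, 0 < r & forall y, box z r y -> Om y.
Proof.
move=> oO Oz; have [d d0 H] := (st_nearP _ _).1 (open_nbhs_nbhs (conj oO Oz)).
have d2 : 0 < d / 2 by rewrite divr_gt0.
exists (d / 2) => // -[x t] /boxP[]; first exact: ltW.
by move=> /= h1 h2; apply: H; [apply: le_lt_trans h1 _|apply: le_lt_trans h2 _];
  rewrite ltr_pdivrMr// ltr_pMr// ltr1n.
Qed.

Lemma continuous_box g z e : {for z, continuous g} -> 0 < e ->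
  exists2 r, 0 < r & forall y, box z r y -> `|g y - g z| < e.
Proof.
move=> /cvgrPdist_lt/(_ e) + e0; move/(_ e0) => H.
have [d d0 Hd] := (st_nearP _ _).1 H.
have d2 : 0 < d / 2 by rewrite divr_gt0.
exists (d / 2) => // -[x t] /boxP[]; first exact: ltW.
by move=> /= h1 h2; rewrite distrC; apply: Hd; [apply: le_lt_trans h1 _|apply: le_lt_trans h2 _];
  rewrite ltr_pdivrMr// ltr_pMr// ltr1n.
Qed.

(** One mixed second difference is written in two ways as [s ^+ 2] times a mixed derivative at a
    nearby point; continuity brings both points back to [z]. *)
Lemma pd_comm Om psi z k l : open Om -> class_C 2 Om psi -> Om z ->
  pd l (pd k psi) z = pd k (pd l psi) z.
Proof.
move=> oO /class_C2[_ d1 _ d2 c2] Oz.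
apply/eqP; rewrite -subr_eq0 -normr_eq0 eq_le normr_ge0 andbT.
apply/ler_addgt0Pr => e e0; rewrite add0r.
have e2 : 0 < e / 2 by rewrite divr_gt0.
have [r0 r00 H0] := open_box oO Oz.
have [r1 r10 H1] := continuous_box (c2 k l z Oz) e2.
have [r2 r20 H2] := continuous_box (c2 l k z Oz) e2.
(* Halved because for [k = l] the two displacements add up in the same coordinate. *)
pose s := Num.min (Num.min r0 r1) r2 / 2.
have m0 : 0 < Num.min (Num.min r0 r1) r2 by rewrite !lt_min r00 r10 r20.
have s0 : 0 < s by rewrite divr_gt0.
have bx r i j a b : Num.min (Num.min r0 r1) r2 <= r -> `|a| <= `|s| -> `|b| <= `|s| ->
    box z r (a *: coord_dir i + (b *: coord_dir j + z)).
  move=> mr; rewrite (gtr0_norm s0) => la lb q.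
  rewrite !coordD !coordZ !addrA addrK !coord_dirE.
  apply: le_trans (ler_normD _ _) _; rewrite !normrM.
  have nb (c : bool) : 0 <= `|c%:R : R| <= 1 by case: c; rewrite ?normr1 ?normr0 ?lexx ?ler01.
  have /andP[? ?] := nb (q == i); have /andP[? ?] := nb (q == j).
  have := normr_ge0 a; have := normr_ge0 b; rewrite /s in la lb * => ? ?; nra.
have [mr0 mr1 mr2] : [/\ Num.min (Num.min r0 r1) r2 <= r0,
    Num.min (Num.min r0 r1) r2 <= r1 & Num.min (Num.min r0 r1) r2 <= r2].
  by rewrite !ge_min !lexx !orbT.
have [a [b [sa sb E1]]] := @second_difference R _ psi z (coord_dir k) (coord_dir l) s
  (fun a b ha hb => d1 k _ (H0 _ (bx r0 k l a b mr0 ha hb)))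
  (fun a b ha hb => d2 k l _ (H0 _ (bx r0 k l a b mr0 ha hb))).
have [c [q [sc sq E2]]] := @second_difference R _ psi z (coord_dir l) (coord_dir k) s
  (fun a b ha hb => d1 l _ (H0 _ (bx r0 l k a b mr0 ha hb)))
  (fun a b ha hb => d2 l k _ (H0 _ (bx r0 l k a b mr0 ha hb))).
have b1 := H1 _ (bx r1 k l a b mr1 sa sb).
have b2 := H2 _ (bx r2 l k c q mr2 sc sq).
have E : pd l (pd k psi) (a *: coord_dir k + (b *: coord_dir l + z)) =
    pd k (pd l psi) (c *: coord_dir l + (q *: coord_dir k + z)).
  apply: (mulfI (lt0r_neq0 s0)); apply: (mulfI (lt0r_neq0 s0)).
  by rewrite -[LHS]E1 -[RHS]E2 (addrCA (s *: coord_dir l)); ring.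
rewrite E distrC in b1.
rewrite -(subrK (pd k (pd l psi) (c *: coord_dir l + (q *: coord_dir k + z)))
  (pd l (pd k psi) z)) -addrA (splitr e).
apply: le_trans (ler_normD _ _) _.
by apply: lerD; apply: ltW; [exact: b1|exact: b2].
Qed.

End TaylorExpansion.

Section SecondOrderTaylor.
Context {R : realType} {n : nat}.
Local Notation V := 'rV[R]_n.+1.
Implicit Types (z d y : spacetime R n) (k l : option 'I_n.+1).
Implicit Types (psi g : spacetime R n -> R) (Om : set (spacetime R n)).

Lemma sum_option (F : option 'I_n.+1 -> R) :
  \sum_k F k = F None + \sum_i F (Some i).
Proof.
rewrite (bigD1 None)//=; congr (_ + _).
rewrite (reindex_omap Some id)/=; last by case.
by apply: eq_bigl => i; rewrite eqxx.
Qed.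

Lemma uniform_radius (I : finType) z (P : I -> spacetime R n -> Prop) :
  (forall i, exists2 r, 0 < r & forall y, box z r y -> P i y) ->
  exists2 r, 0 < r & forall i y, box z r y -> P i y.
Proof.
move=> H.
have [r r0 Hr] : exists2 r, 0 < r & forall i, i \in enum I -> forall y, box z r y -> P i y.
  elim: (enum I) => [|i s [r r0 Hr]]; first by exists 1.
  have [q q0 Hq] := H i; exists (Num.min q r); first by rewrite lt_min q0.
  move=> j; rewrite inE => /predU1P[->|js] y yb; [apply: Hq|apply: Hr => //] => m;
    by apply: le_trans (yb m) _; rewrite ge_min lexx ?orbT.
by exists r => // i; apply: Hr; rewrite mem_enum.
Qed.

Definition lin (a : option 'I_n.+1 -> R) z : R := \sum_k a k * coord k z.

Lemma linD a z d : lin a (z + d) = lin a z + lin a d.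
Proof. by rewrite -big_split; apply: eq_bigr => k _; rewrite coordD mulrDr. Qed.

Lemma linZ a s z : lin a (s *: z) = s * lin a z.
Proof. by rewrite mulr_sumr; apply: eq_bigr => k _; rewrite coordZ; ring. Qed.

Lemma lin_dir a k : lin a (coord_dir k) = a k.
Proof.
rewrite /lin (bigD1 k)//= coord_dirE eqxx mulr1 big1 ?addr0// => l lk.
by rewrite coord_dirE (negbTE lk) mulr0.
Qed.

Lemma is_derive_quadratic (c b e : R) :
  is_derive (0 : R) (1 : R) (fun r : R => c + r * b + r ^+ 2 * e) b.
Proof.
apply: is_derive_eq.
by rewrite /= ?scale0r ?scaler0 ?mulr0 ?mul0r ?expr0 ?add0r ?addr0 /GRing.scale/= ?mulr1 ?mulr0 ?mul0r ?addr0 ?add0r; ring.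
Qed.

Lemma is_derive_lin a z0 z k : is_derive z (coord_dir k) (fun y => lin a (y - z0)) (a k).
Proof.
apply/is_derive_line0.
rewrite (_ : (fun _ => _) = fun r : R => lin a (z - z0) + r * a k + r ^+ 2 * 0).
  exact: is_derive_quadratic.
by apply/funext => r; rewrite -[r *: _ + z - z0]addrA (linD _ (r *: _)) linZ lin_dir; ring.
Qed.

Lemma is_derive_bil (H : option 'I_n.+1 -> option 'I_n.+1 -> R) z0 z k :
  is_derive z (coord_dir k) (fun y => lin (fun l => lin (H l) (y - z0)) (y - z0))
    (lin (H k) (z - z0) + lin (H^~ k) (z - z0)).
Proof.
have linl (b c : option 'I_n.+1 -> R) d s :
    lin (fun l => b l + s * c l) d = lin b d + s * lin c d.
  by rewrite /lin mulr_sumr -big_split; apply: eq_bigr => l _; rewrite /=; ring.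
apply/is_derive_line0.
rewrite (_ : (fun _ => _) = fun r : R => lin (fun l => lin (H l) (z - z0)) (z - z0)
    + r * (lin (H k) (z - z0) + lin (H^~ k) (z - z0)) + r ^+ 2 * H k k).
  exact: is_derive_quadratic.
apply/funext => r; rewrite -[r *: _ + z - z0]addrA.
have -> : (fun l => lin (H l) (r *: coord_dir k + (z - z0)))
    = (fun l => lin (H l) (z - z0) + r * H l k).
  by apply/funext => l; rewrite (linD _ (r *: _)) linZ lin_dir addrC.
by rewrite linl !(linD _ (r *: _)) !linZ !lin_dir; ring.
Qed.

(** The difference [E] between [psi] and its full second-order polynomial has vanishing gradient at
    [z0] and small second derivatives nearby, so [coordinate_mvt] applied twice bounds it. The mixed
    space-time terms are split by Young's inequality into a small multiple of the squared spatial
    increment and a large multiple of the squared time increment, which leaves exactly the data of a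
    parabolic jet. *)
Lemma taylor2 Om psi z0 e : open Om -> class_C 2 Om psi -> Om z0 -> 0 < e ->
  exists K, nbhs z0 (fun z =>
    `|psi z - psi z0 - (dt psi z0 * (z.2 - z0.2) + dot (grad psi z0) (z.1 - z0.1)
        + 2^-1 * qf (hess psi z0) (z.1 - z0.1))|
      <= e * dot (z.1 - z0.1) (z.1 - z0.1) + K * (z.2 - z0.2) ^+ 2).
Proof.
move=> oO C2 Oz0 e0; have [c0 d1 c1 d2 c2] := class_C2 C2.
have [a aE] : exists a, forall k, a k = pd k psi z0 by eexists.
have [H HE] : exists H, forall k l, H k l = pd l (pd k psi) z0 by eexists.
have symH k l : H k l = H l k by rewrite !HE; exact: (pd_comm _ _ oO C2 Oz0).
pose T y := lin a (y - z0) + 2^-1 * lin (fun l => lin (H l) (y - z0)) (y - z0).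
pose E y := psi y - T y.
pose G k y := pd k psi y - (a k + lin (H k) (y - z0)).
have dE k y : Om y -> is_derive y (coord_dir k) E (G k y).
  move=> Oy; apply: is_deriveB; first exact: derivableP (d1 k y Oy).
  have -> : a k + lin (H k) (y - z0) =
      a k + 2^-1 *: (lin (H k) (y - z0) + lin (H^~ k) (y - z0)).
    have -> : lin (H^~ k) (y - z0) = lin (H k) (y - z0).
      by apply: eq_bigr => l _; rewrite symH.
    by rewrite /GRing.scale/=; field.
  by apply: is_deriveD; [exact: is_derive_lin|apply: is_deriveZ; exact: is_derive_bil].
have dG k l y : Om y -> is_derive y (coord_dir l) (G k) (pd l (pd k psi) y - H k l).
  move=> Oy; apply: is_deriveB; first exact: derivableP (d2 k l y Oy).
  rewrite -[X in is_derive _ _ _ X]add0r; apply: is_deriveD; exact: is_derive_lin.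
have N0 : (0 : R) < n.+2%:R by rewrite ltr0n.
(* Each of the two uses of [coordinate_mvt] loses a factor [n.+2], the number of space-time
   coordinates. *)
pose e1 := e / 2 / (n.+2%:R * n.+2%:R).
have e10 : 0 < e1 by rewrite !divr_gt0// mulr_gt0.
have [r0 r00 H0] := open_box oO Oz0.
have [r1 r10 H1] : exists2 r, 0 < r & forall kl y, box z0 r y ->
    `|pd kl.2 (pd kl.1 psi) y - H kl.1 kl.2| < e1.
  by apply: uniform_radius => -[k l]; rewrite HE; exact: continuous_box (c2 k l z0 Oz0) e10.
pose c : V := \row_i (H None (Some i) + H (Some i) None).
(* The weight in Young's inequality: [eta * dot c c] is at most [e / 2], where [c] collects the
   mixed space-time second derivatives. *)
pose eta := e / 2 / (dot c c + 1).
have cc1 : 0 < dot c c + 1 by rewrite ltr_wpDl ?dot_ge0.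
have eta0 : 0 < eta by rewrite !divr_gt0.
exists (e / 2 + (4 * eta)^-1 + `|H None None|); apply/st_nearP.
exists (Num.min r0 r1); first by rewrite lt_min r00.
move=> x t xr tr /=; set h := x - z0.1; set s := t - z0.2.
pose rho := Num.max `|h| `|s|.
have rho0 : 0 <= rho by rewrite le_max normr_ge0.
have bx y : box z0 rho y -> box z0 r0 y /\ box z0 r1 y.
  have rhor : rho < Num.min r0 r1 by rewrite gt_max; apply/andP.
  by move: rhor; rewrite lt_min => /andP[/ltW h1 /ltW h2] yb; split => k;
    apply: le_trans (yb k) _.
have zb : box z0 rho (x, t) by apply/boxP => //; rewrite !le_max !lexx orbT.
have lin0 b : lin b (z0 - z0) = 0.
  by rewrite subrr -(scale0r (0 : spacetime R n)) linZ mul0r.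
have GB k y : box z0 rho y -> `|G k y| <= e1 * rho *+ n.+2.
  move=> yb; have G0 : G k z0 = 0 by rewrite /G lin0 addr0 aE subrr.
  rewrite -[G k y]subr0 -G0; apply: coordinate_mvt (ltW e10) _ _ yb => w l wb.
  have dw := dG k l w (H0 w (bx w wb).1).
  split; first exact: ex_derive.
  by rewrite /pd (@derive_val _ _ _ _ _ _ _ dw); apply/ltW/(H1 (k, l)); exact: (bx w wb).2.
have EB : `|E (x, t) - E z0| <= e / 2 * rho ^+ 2.
  have -> : e / 2 * rho ^+ 2 = (e1 * rho *+ n.+2) * rho *+ n.+2.
    rewrite -(mulr_natl (e1 * rho)) -(mulr_natl (_ * rho)) /e1; move: (n.+2%:R : R) N0 => N N0.
    by field; rewrite gt_eqF.
  apply: coordinate_mvt zb; first by rewrite mulrn_wge0// mulr_ge0// ltW.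
  move=> w l wb; have dw := dE l w (H0 w (bx w wb).1).
  split; first exact: ex_derive.
  by rewrite /pd (@derive_val _ _ _ _ _ _ _ dw); exact: GB.
have TE : T (x, t) - T z0 = dt psi z0 * s + dot (grad psi z0) h + 2^-1 * qf (hess psi z0) h
    + 2^-1 * (H None None * s ^+ 2 + s * dot c h).
  have -> : T z0 = 0 by rewrite /T !lin0 mulr0 addr0.
  have -> : dot (grad psi z0) h = \sum_i a (Some i) * h 0 i.
    by apply: eq_bigr => i _; rewrite mxE aE.
  have -> : qf (hess psi z0) h = \sum_i \sum_j H (Some i) (Some j) * h 0 j * h 0 i.
    by apply: eq_bigr => i _; apply: eq_bigr => j _; rewrite mxE -HE; ring.
  have -> : s * dot c h = (\sum_i H None (Some i) * h 0 i) * s +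
      \sum_i H (Some i) None * s * h 0 i.
    rewrite mulr_sumr mulr_suml -big_split; apply: eq_bigr => i _; rewrite mxE/=; ring.
  have -> : T (x, t) = lin a (h, s) + 2^-1 * lin (fun l => lin (H l) (h, s)) (h, s).
    by rewrite /T (_ : (x, t) - z0 = (h, s)).
  rewrite /lin !sum_option /=.
  have -> : \sum_i (\sum_k H (Some i) k * coord k (h, s)) * h 0 i
     = \sum_i H (Some i) None * s * h 0 i + \sum_i \sum_j H (Some i) (Some j) * h 0 j * h 0 i.
    by rewrite -big_split; apply: eq_bigr => i _; rewrite sum_option mulrDl mulr_suml.
  by rewrite subr0 /dt -aE; ring.
have rho2 : rho ^+ 2 <= dot h h + s ^+ 2.
  have := sqr_norm_le_dot h; have := sqr_ge0 s; have := dot_ge0 h.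
  rewrite /rho; case: (leP `|h| `|s|) => _; first by rewrite real_normK ?num_real//; lra.
  lra.
have sc : `|s * dot c h| <= e / 2 * dot h h + (4 * eta)^-1 * s ^+ 2.
  have hc := cauchy_schwarz c h.
  have : eta * dot c h ^+ 2 <= e / 2 * dot h h.
    have -> : e / 2 = eta * (dot c c + 1) by rewrite /eta divfK ?gt_eqF.
    rewrite -mulrA ler_pM2l//; apply: le_trans hc _.
    by rewrite mulrDl mul1r lerDl dot_ge0.
  have : `|s * dot c h| <= eta * dot c h ^+ 2 + (4 * eta)^-1 * s ^+ 2.
    have sq w : eta * w ^+ 2 + (4 * eta)^-1 * s ^+ 2 - s * w = (4 * eta)^-1 * (2 * eta * w - s) ^+ 2.
      by field; rewrite gt_eqF.
    have i0 : 0 <= (4 * eta)^-1 by rewrite invr_ge0 mulr_ge0// ltW.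
    rewrite ler_norml; apply/andP; split.
      have := sq (- dot c h); have := mulr_ge0 i0 (sqr_ge0 (2 * eta * - dot c h - s)).
      by rewrite sqrrN; lra.
    by have := sq (dot c h); have := mulr_ge0 i0 (sqr_ge0 (2 * eta * dot c h - s)); lra.
  lra.
have -> : psi (x, t) - psi z0 - (dt psi z0 * s + dot (grad psi z0) h + 2^-1 * qf (hess psi z0) h)
   = (E (x, t) - E z0) + 2^-1 * (H None None * s ^+ 2) + 2^-1 * (s * dot c h).
  by rewrite /E; lra.
apply: le_trans (ler_normD _ _) _; apply: le_trans (lerD (ler_normD _ _) (lexx _)) _.
rewrite !(normrM 2^-1) (normrM (H None None)) (ger0_norm (sqr_ge0 s)).
rewrite (gtr0_norm (_ : 0 < 2^-1 :> R)) ?invr_gt0//.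
have := normr_ge0 (H None None); have := sqr_ge0 s; have := dot_ge0 h => p1 p2 p3.
have p4 := mulr_ge0 p3 p2.
have : e / 2 * rho ^+ 2 <= e / 2 * (dot h h + s ^+ 2) by rewrite ler_pM2l// divr_gt0.
have p5 : 0 <= (4 * eta)^-1 * s ^+ 2 by rewrite mulr_ge0// invr_ge0 mulr_ge0// ltW.
have p6 : 0 <= e / 2 * dot h h by rewrite mulr_ge0// divr_ge0// ltW.
lra.
Qed.

End SecondOrderTaylor.

(** * Viscosity inequalities in terms of jets *)

Section PolynomialTests.
Context {R : realType} {n : nat}.
Implicit Types (z : spacetime R n) (k : option 'I_n.+1).

(** Polynomials are reified because the syntax is closed under [pderiv]: smoothness of every order
    follows by one induction. *)
Inductive pexpr : Type :=
  | PCst of R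
  | PVar of option 'I_n.+1
  | PAdd of pexpr & pexpr
  | PMul of pexpr & pexpr.

Fixpoint peval (E : pexpr) z : R :=
  match E with
  | PCst c => c
  | PVar k => coord k z
  | PAdd E1 E2 => peval E1 z + peval E2 z
  | PMul E1 E2 => peval E1 z * peval E2 z
  end.

Fixpoint pderiv k (E : pexpr) : pexpr :=
  match E with
  | PCst c => PCst 0
  | PVar l => PCst (l == k)%:R
  | PAdd E1 E2 => PAdd (pderiv k E1) (pderiv k E2)
  | PMul E1 E2 => PAdd (PMul E1 (pderiv k E2)) (PMul E2 (pderiv k E1))
  end.

Definition psum (I : finType) (F : I -> pexpr) := foldr PAdd (PCst 0) [seq F i | i <- enum I].

Lemma peval_psum (I : finType) (F : I -> pexpr) z :
  peval (psum F) z = \sum_i peval (F i) z.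
Proof.
rewrite /psum -big_enum /=; elim: (enum I) => [|i s IH] /=.
  by rewrite big_nil.
by rewrite big_cons IH.
Qed.

Lemma continuous_coord k : continuous (coord k : spacetime R n -> R).
Proof.
case: k => [i|] z.
  apply: (@continuous_comp _ _ _ (fun z : spacetime R n => z.1) (fun x : 'rV[R]_n.+1 => x 0 i)).
    exact: cvg_fst.
  exact: coord_continuous.
exact: cvg_snd.
Qed.

Lemma continuous_peval E : continuous (peval E).
Proof.
elim: E => [c|k|E1 H1 E2 H2|E1 H1 E2 H2] z.
- exact: cst_continuous.
- exact: continuous_coord.
- by apply: (@continuousD _ _ _ (peval E1) (peval E2)); [exact: H1|exact: H2].
- by apply: (@continuousM _ _ (peval E1) (peval E2)); [exact: H1|exact: H2].
Qed.

Lemma is_derive_peval E z k : is_derive z (coord_dir k) (peval E) (peval (pderiv k E) z).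
Proof.
elim: E => [c|l|E1 H1 E2 H2|E1 H1 E2 H2] /=.
- exact: is_derive_cst.
- apply/is_derive_line0.
  rewrite (_ : (fun _ => _) = fun r : R => coord l z + r * (l == k)%:R + r ^+ 2 * 0).
    exact: is_derive_quadratic.
  by apply/funext => r; rewrite coordD coordZ coord_dirE; ring.
- exact: is_deriveD.
- exact: is_deriveM.
Qed.

Lemma pd_peval E k : pd k (peval E) = peval (pderiv k E).
Proof.
by apply/funext => z; exact: (@derive_val _ _ _ _ _ _ _ (is_derive_peval E z k)).
Qed.

Lemma class_C_peval m Om E : class_C m Om (peval E).
Proof.
elim: m E => [|m IH] E /=; split.
- by move=> z _; exact: continuous_peval.
- by [].
- by move=> z _; exact: continuous_peval.
move=> k; split; last by rewrite pd_peval; exact: IH.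
by move=> z _; exact: (@ex_derive _ _ _ _ _ _ _ (is_derive_peval E z k)).
Qed.

(* A jet polynomial, made coercive by a quartic term so that it can be used as
   a global test function on a bounded set. *)
Lemma jet_test_function (z : spacetime R n) (r a : R) (p : 'rV[R]_n.+1) (X : 'M[R]_n.+1) (K C : R) :
  exists E, forall y, peval E y = r + quad a p X K (y.1 - z.1) (y.2 - z.2)
    - C * (\sum_i (y.1 - z.1) 0 i ^+ 4 + (y.2 - z.2) ^+ 2).
Proof.
pose H k := PAdd (PVar k) (PCst (- coord k z)).
have evH i y : peval (H (Some i)) y = (y.1 - z.1) 0 i by rewrite /= !mxE.
pose sq E := PMul E E.
have [E1 HE1] : exists E, forall y, peval E y = dot p (y.1 - z.1).
  exists (psum (fun i => PMul (PCst (p 0 i)) (H (Some i)))) => y.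
  by rewrite peval_psum; apply: eq_bigr => i _; rewrite -evH.
have [E2 HE2] : exists E, forall y, peval E y = qf X (y.1 - z.1).
  exists (psum (fun i => psum (fun j => PMul (PCst (X i j)) (PMul (H (Some i)) (H (Some j)))))) => y.
  rewrite peval_psum; apply: eq_bigr => i _; rewrite peval_psum; apply: eq_bigr => j _.
  by rewrite -!evH.
have [E3 HE3] : exists E, forall y, peval E y = \sum_i (y.1 - z.1) 0 i ^+ 4.
  exists (psum (fun i => sq (sq (H (Some i))))) => y.
  by rewrite peval_psum; apply: eq_bigr => i _; rewrite -evH /=; ring.
exists (PAdd (PAdd (PCst r) (PAdd (PAdd (PAdd (PMul (PCst a) (H None)) E1)
    (PMul (PCst 2^-1) E2)) (PMul (PCst (- K)) (sq (H None)))))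
  (PMul (PCst (- C)) (PAdd E3 (sq (H None))))).
by move=> y; rewrite /= HE1 HE2 HE3 /quad; ring.
Qed.

End PolynomialTests.

Section ViscosityJets.
Context {R : realType} {n : nat}.
Implicit Types (z : spacetime R n) (k : option 'I_n.+1) (psi : spacetime R n -> R).
Implicit Types (Om : set (spacetime R n)) (u : spacetime R n -> \bar R).

(** For a nonzero gradient the unit vector is determined up to sign and the quadratic form is even,
    so its value is the normalised infinity Laplacian. For a zero gradient some direction is
    admissible iff the minimum of the Rayleigh quotient is, and by symmetry of the Hessian this
    minimum is the least eigenvalue. *)
Lemma viscosity_par_superP Om psi z : open Om -> class_C 2 Om psi -> Om z ->
  ((grad psi z != 0 -> dt psi z - inf_laplacian psi z >= 0) /\
   (grad psi z = 0 -> dt psi z - min_eigenvalue (hess psi z) >= 0)) <->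
  par_super (dt psi z) (grad psi z) (hess psi z).
Proof.
move=> oO C2 Oz.
have symH : (hess psi z)^T = hess psi z.
  by apply/matrixP => i j; rewrite !mxE; exact: (pd_comm _ _ oO C2 Oz).
have [e0 e0s [He0 Hmin]] := rayleigh_min symH.
have ilE : inf_laplacian psi z = qf (hess psi z) (grad psi z) / dot (grad psi z) (grad psi z).
  rewrite /inf_laplacian; congr (_ / _).
    by apply: eq_bigr => i _; apply: eq_bigr => j _; rewrite mulrC.
have ilc c e : sphere e -> grad psi z = c *: e -> grad psi z != 0 ->
    inf_laplacian psi z = qf (hess psi z) e.
  move=> es ge g0; rewrite ilE ge qfZ dotZl dotZr es mulr1 -expr2 mulrAC mulfV ?mul1r//.
  by rewrite sqrf_eq0; apply: contraNneq g0 => c0; rewrite ge c0 scale0r.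
split=> [[H1 H2]|[e [es [c gc] qe]]].
  have [g0|g0] := eqVneq (grad psi z) 0.
    exists e0; split => //; first by exists 0; rewrite scale0r.
    by have := H2 g0; rewrite -He0 subr_ge0.
  have [e es [c gc]] := unit_direction (grad psi z).
  exists e; split => //; first by exists c.
  by have := H1 g0; rewrite (ilc c e)// subr_ge0.
split=> g0; rewrite subr_ge0; first by rewrite (ilc c e).
exact: le_trans (Hmin e es) qe.
Qed.

(** The jet polynomial lies below [u] only near [z], whereas test functions must lie below on all of
    [Om]. Subtracting a multiple of the coercive term leaves the jet essentially unchanged at [z]
    and, since [u] is bounded below and [Om] is bounded, pushes the polynomial under [u]
    elsewhere. *)
Lemma viscosity_supersolution_jet Om u (m : R) z (r a : R) p X K :
  open Om -> bounded_set Om -> viscosity_supersolution Om u ->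
  (forall y, Om y -> (m%:E <= u y)%E) -> Om z -> u z = r%:E ->
  nbhs z (fun y => ((r + quad a p X K (y.1 - z.1) (y.2 - z.2))%:E <= u y)%E) ->
  par_super a p X.
Proof.
move=> oO bO [_ _ Hu] mu Oz uz /st_nearP[d d0 Hd].
have [B [B0 HB]] : exists B : R, 0 <= B /\
    forall y, Om y -> `|y.1 - z.1| <= B /\ `|y.2 - z.2| <= B.
  have [M [_ HM]] := bO; have := HM (M + 1); rewrite ltrDl ltr01 => /(_ isT) {}HM.
  have nb y : Om y -> `|y.1| <= M + 1 /\ `|y.2| <= M + 1.
    move=> Oy; have : Num.max `|y.1| `|y.2| <= M + 1 by exact: (HM y Oy).
    by rewrite ge_max => /andP.
  have [h1 h2] := nb z Oz.
  exists ((M + 1) + (M + 1)); split; first by have := normr_ge0 z.2; lra.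
  by move=> y /nb[h3 h4]; split; apply: le_trans (ler_normB _ _) _; apply: lerD.
have [CX CX0 HX] := qf_abs_le X.
pose Q := `|a| * B + n.+1%:R * (`|p| * B) + 2^-1 * (CX * B ^+ 2) + `|K| * B ^+ 2.
have Q0 : 0 <= Q.
  by rewrite !addr_ge0// !mulr_ge0// ?exprn_ge0// ?invr_ge0// mulr_ge0 ?exprn_ge0.
have QH y : Om y -> quad a p X K (y.1 - z.1) (y.2 - z.2) <= Q.
  move=> /HB[]; set h := y.1 - z.1; set s := y.2 - z.2 => hB sB.
  rewrite /quad /Q; apply: lerD; last first.
    rewrite -mulNr; apply: le_trans (ler_norm _) _; rewrite normrM normrN normrX.
    by rewrite ler_wpM2l// ler_pXn2r// ?nnegrE.
  apply: lerD; first (apply: lerD).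
  - by apply: le_trans (ler_norm _) _; rewrite normrM ler_wpM2l.
  - apply: le_trans (ler_norm _) _; apply: le_trans (dot_abs_le _ _) _.
    by rewrite ler_wpM2l// ler_wpM2l.
  rewrite ler_wpM2l ?invr_ge0//; apply: le_trans (ler_norm _) _.
  by apply: le_trans (HX h) _; rewrite ler_wpM2l// ler_pXn2r// ?nnegrE.
pose q := Num.min (d ^+ 4) (d ^+ 2).
have q0 : 0 < q by rewrite lt_min !exprn_gt0.
(* [Q] bounds the jet polynomial on [Om] and [q] bounds the coercive term from below outside the
   [d]-box, so [C * q] lowers the polynomial below [m] there. *)
pose C := (`|r| + Q + `|m|) / q.
have C0 : 0 <= C by apply: divr_ge0; [exact: addr_ge0 (addr_ge0 (normr_ge0 r) Q0) (normr_ge0 m)|exact: ltW].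
have Cq : C * q = `|r| + Q + `|m| by rewrite /C divfK// gt_eqF.
have sum40 (h : 'rV[R]_n.+1) : 0 <= \sum_i h 0 i ^+ 4.
  by apply: sumr_ge0 => i _; rewrite exprn_even_ge0.
have [E HE] := jet_test_function z r a p X K C.
have C2 : class_C 2 Om (peval E) by exact: class_C_peval.
have PE y : peval E y = r + quad a p X (K + C) (y.1 - z.1) (y.2 - z.2)
    - C * (\sum_i (y.1 - z.1) 0 i ^+ 4).
  by rewrite HE /quad; ring.
have Pz : peval E z = r.
  rewrite HE !subrr /quad qfE mul0mx !dot0r big1 ?mulr0; first by ring.
  by move=> i _; rewrite mxE expr0n.
have ge0 y : 0 <= C * (\sum_i (y.1 - z.1) 0 i ^+ 4 + (y.2 - z.2) ^+ 2).
  by rewrite mulr_ge0// addr_ge0// sqr_ge0.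
have touch y : Om y -> ((peval E y)%:E <= u y)%E.
  move=> Oy; have [[h1 h2]|far] := pselect (`|y.1 - z.1| < d /\ `|y.2 - z.2| < d).
    have := Hd y.1 y.2 h1 h2; rewrite -surjective_pairing; apply: le_trans.
    by rewrite lee_fin HE lerBlDr lerDl ge0.
  apply: le_trans (mu y Oy); rewrite lee_fin HE.
  have : q <= \sum_i (y.1 - z.1) 0 i ^+ 4 + (y.2 - z.2) ^+ 2.
    have [h1|h1] := ltP `|y.1 - z.1| d; last first.
      have [i hi] : exists i, d <= `|(y.1 - z.1) 0 i|.
        apply: contrapT => /forallNP H; have : `|y.1 - z.1| < d.
          have [i [_ Hi]] : exists i : 'I_n.+1, True /\ `|y.1 - z.1| <= `|(y.1 - z.1) 0 i|.
            apply: contrapT => /forallNP H'.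
            have := @mx_norm_neq0 _ _ _ (y.1 - z.1); rewrite -/(Num.norm _).
            case; first by rewrite gt_eqF// (lt_le_trans d0).
            by move=> [i0 j] Hij; apply: (H' j); split => //; rewrite {1}/Num.Def.normr/= Hij ord1.
          by apply: le_lt_trans Hi _; rewrite ltNge; apply/negP/H.
        by rewrite ltNge h1.
      rewrite (bigD1 i)//= -addrA; apply: (@le_trans _ _ ((y.1 - z.1) 0 i ^+ 4)).
        rewrite /q ge_min; apply/orP; left.
        have -> : (y.1 - z.1) 0 i ^+ 4 = `|(y.1 - z.1) 0 i| ^+ 4.
          by rewrite -normrX ger0_norm// exprn_even_ge0.
        by rewrite ler_pXn2r// nnegrE// ltW.
      by rewrite lerDl addr_ge0 ?sqr_ge0//; apply: sumr_ge0 => j _; rewrite exprn_even_ge0.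
    have h2 : d <= `|y.2 - z.2| by rewrite leNgt; apply/negP => h2; apply: far.
    apply: (@le_trans _ _ ((y.2 - z.2) ^+ 2)); last by rewrite lerDr.
    rewrite /q ge_min; apply/orP; right.
    by rewrite -[leRHS]real_normK ?num_real// ler_pXn2r// nnegrE// ltW.
  move=> /(ler_wpM2l C0); rewrite Cq; have := QH y Oy.
  have := ler_norm r; have := ler_norm (- m); rewrite normrN.
  lra.
have /(viscosity_par_superP oO C2 Oz) PS : (grad (peval E) z != 0 -> dt (peval E) z - inf_laplacian (peval E) z >= 0) /\
   (grad (peval E) z = 0 -> dt (peval E) z - min_eigenvalue (hess (peval E) z) >= 0).
  apply: Hu => // y Oy; rewrite uz Pz -EFinB subrr.
  have := touch y Oy; case: (u y) => [s| |].
  - by rewrite lee_fin => H; rewrite -EFinB lee_fin subr_ge0.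
  - by move=> _; rewrite addye// leey.
  - by rewrite leeNy_eq.
(* The derivatives of the polynomial at [z] are not computed: they are identified by comparing its
   Taylor expansion with its explicit form. The Hessians agree up to [4 * e], half of which comes
   from the Taylor remainder and half from the quartic term. *)
have close e : 0 < e -> [/\ a = dt (peval E) z, p = grad (peval E) z &
    forall h, qf (X - (2 * e)%:M) h <= qf (hess (peval E) z + (2 * e)%:M) h].
  move=> e0; have [K' /st_nearP[d' d'0 Hd']] := taylor2 oO C2 Oz e0.
  pose eta := Num.min d' (Num.min 1 (e / (C + 1))).
  have C10 : 0 < C + 1 by rewrite ltr_wpDl.
  have eta0 : 0 < eta by rewrite !lt_min d'0 ltr01 divr_gt0.
  apply: (@quad_le_quad R n a p (X - (2 * e)%:M) (K + C) _ _ _ (- K') eta eta0) => h s.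
  rewrite !lt_min => /andP[hd /andP[h1 he]] /andP[sd _].
  have := Hd' (z.1 + h) (z.2 + s); rewrite /= (addrC z.1) (addrC z.2) !addrK => /(_ hd sd).
  rewrite Pz PE /= !addrK ler_norml => /andP[_].
  have : C * \sum_i h 0 i ^+ 4 <= e * dot h h.
    have : \sum_i h 0 i ^+ 4 <= `|h| ^+ 2 * dot h h.
      rewrite /dot mulr_sumr; apply: ler_sum => i _.
      have -> : h 0 i ^+ 4 = `|h 0 i| ^+ 2 * (h 0 i * h 0 i).
        by rewrite real_normK ?num_real//; ring.
      rewrite ler_wpM2r// -?expr2 ?sqr_ge0//.
      by rewrite ler_pXn2r ?nnegrE// coord_le_norm.
    move=> /(ler_wpM2l C0)/le_trans; apply; rewrite mulrA ler_wpM2r ?dot_ge0//.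
    move: he; rewrite ltr_pdivlMr// => he.
    have : `|h| ^+ 2 <= `|h| by rewrite expr2 ler_piMl// ltW.
    by have := normr_ge0 h; nra.
  rewrite /quad !qfDl !qfNl !qf_scalar; lra.
have [aE pE _] := close 1 ltr01; rewrite aE pE.
have [e [es pe qe]] := PS; exists e; split => //; apply: le_trans qe.
apply/ler_addgt0Pr => k k0; have k4 : 0 < k / 4 by rewrite divr_gt0.
have [_ _ /(_ e)] := close _ k4.
by rewrite !qfDl !qfNl !qf_scalar (_ : dot e e = 1)//; lra.
Qed.

(** Lowering the Hessian of [psi] by [k%:M] absorbs the Taylor remainder and produces a genuine jet
    of [v]; [par_super_closed] then removes [k]. *)
Lemma jet_super_viscosity Om (v : spacetime R n -> R) u : open Om ->
  (forall z, Om z -> u z = (v z)%:E) ->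
  (forall z, Om z -> lsc_at v z) -> (forall z, Om z -> jet_super v z) ->
  viscosity_supersolution Om u.
Proof.
move=> oO uv lv jv; split.
- by move=> z Oz; rewrite uv.
- move=> z a az; have [Oz|nOz] := pselect (Om z); last first.
    have H : @nbhs_subspace _ Om z [set z] by rewrite /nbhs_subspace memNset.
    by exists [set z]; [exact: H|move=> y ->].
  have H : @nbhs_subspace _ Om z [set y | Om y /\ a < v y].
    rewrite /nbhs_subspace mem_set//.
    have e0 : 0 < v z - a by move: az; rewrite uv// lte_fin subr_gt0.
    by apply: filterS (lv z Oz _ e0) => y; rewrite subKr.
  by exists [set y | Om y /\ a < v y]; [exact: H|move=> y [Oy ay]; rewrite uv// lte_fin].
- move=> psi z C2 Oz Hmin; apply/(viscosity_par_superP oO C2 Oz).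
  apply: par_super_closed => k k0; have k2 : 0 < k / 2 by rewrite divr_gt0.
  exists (dt psi z), (grad psi z), (hess psi z - k%:M); split.
  - by rewrite lerDl ltW.
  - by rewrite subrr dot0l ltW.
  - by move=> e es; rewrite qfDl qfNl qf_scalar (_ : dot e e = 1)//; lra.
  apply: (jv z Oz); have [K HK] := taylor2 oO C2 Oz k2; exists K.
  apply: filterS2 (open_nbhs_nbhs (conj oO Oz)) HK => y Oy.
  have := Hmin y Oy; rewrite !uv// -!EFinB lee_fin ler_norml => H1 /andP[+ _].
  rewrite /quad qfDl qfNl qf_scalar; lra.
Qed.

Lemma class_CN m Om psi : open Om -> class_C m Om psi -> class_C m Om (fun z => - psi z).
Proof.
move=> oO.
(* The induction needs two functions related on [Om] only: the identity between the partial
   derivatives of [- psi] and [psi] is available there and not elsewhere. *)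
have H psi1 psi2 : (forall z, Om z -> psi1 z = - psi2 z) -> class_C m Om psi2 -> class_C m Om psi1.
  elim: m psi1 psi2 => [|m IH] psi1 psi2 e [c2 H]; (split; [|]) => //.
  - move=> z Oz; have ez := e z Oz.
    have nz : nbhs z (fun y => - psi2 y = psi1 y).
      by apply: filterS (open_nbhs_nbhs (conj oO Oz)) => y Oy; rewrite e.
    have cz : (fun y => - psi2 y) @ z --> psi1 z by rewrite ez; apply: cvgN; exact: c2.
    exact: cvg_trans (near_eq_cvg nz) cz.
  - move=> z Oz; have ez := e z Oz.
    have nz : nbhs z (fun y => - psi2 y = psi1 y).
      by apply: filterS (open_nbhs_nbhs (conj oO Oz)) => y Oy; rewrite e.
    have cz : (fun y => - psi2 y) @ z --> psi1 z by rewrite ez; apply: cvgN; exact: c2.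
    exact: cvg_trans (near_eq_cvg nz) cz.
  move=> k; have [d2 C2] := H k.
  have D z : Om z -> is_derive z (coord_dir k) psi1 (- pd k psi2 z).
    move=> Oz; have nz : nbhs z (fun y => (- psi2) y = psi1 y).
      by apply: filterS (open_nbhs_nbhs (conj oO Oz)) => y Oy; rewrite e.
    apply: (near_eq_is_derive nz).
    by apply: is_deriveN; exact: derivableP (d2 z Oz).
  split; first by move=> z Oz; exact: (@ex_derive _ _ _ _ _ _ _ (D z Oz)).
  by apply: IH C2 => z Oz; exact: (@derive_val _ _ _ _ _ _ _ (D z Oz)).
exact: H.
Qed.

Lemma pdN Om psi z k : derivable psi z (coord_dir k) ->
  pd k (fun z => - psi z) z = - pd k psi z.
Proof. by move=> H; exact: deriveN. Qed.

End ViscosityJets.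

(** * Duality of sub- and supersolutions under change of sign *)

Section Negation.
Context {R : realType} {n : nat}.
Implicit Types (z : spacetime R n) (k l : option 'I_n.+1) (psi f : spacetime R n -> R).
Implicit Types (Om : set (spacetime R n)) (u v : spacetime R n -> \bar R).

Lemma pd2N Om psi z k l : open Om -> class_C 2 Om psi -> Om z ->
  pd l (pd k (fun z => - psi z)) z = - pd l (pd k psi) z.
Proof.
move=> oO /class_C2[_ d1 _ d2 _] Oz.
have nz : \forall y \near z, (- pd k psi) y = pd k (fun z => - psi z) y.
  by apply: filterS (open_nbhs_nbhs (conj oO Oz)) => y Oy; rewrite pdN//; exact: d1.
have D : is_derive z (coord_dir l) (pd k (fun z => - psi z)) (- pd l (pd k psi) z).
  apply: (near_eq_is_derive nz).
  by apply: is_deriveN; exact: derivableP (d2 k l z Oz).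
exact: (@derive_val _ _ _ _ _ _ _ D).
Qed.

Lemma dtN Om psi z : class_C 2 Om psi -> Om z -> dt (fun z => - psi z) z = - dt psi z.
Proof. by move=> /class_C2[_ d1 _ _ _] Oz; rewrite /dt pdN//; exact: d1. Qed.

Lemma gradN Om psi z : class_C 2 Om psi -> Om z ->
  grad (fun z => - psi z) z = - grad psi z.
Proof.
move=> /class_C2[_ d1 _ _ _] Oz; apply/rowP => i; rewrite !mxE pdN//; exact: d1.
Qed.

Lemma hessN Om psi z : open Om -> class_C 2 Om psi -> Om z ->
  hess (fun z => - psi z) z = - hess psi z.
Proof.
by move=> oO C2 Oz; apply/matrixP => i j; rewrite !mxE; exact: (pd2N _ _ oO C2 Oz).
Qed.

Lemma inf_laplacianN Om psi z : open Om -> class_C 2 Om psi -> Om z ->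
  inf_laplacian (fun z => - psi z) z = - inf_laplacian psi z.
Proof.
move=> oO C2 Oz; rewrite /inf_laplacian (gradN C2 Oz) (hessN oO C2 Oz) -mulNr.
congr (_ / _); last by apply: eq_bigr => i _; rewrite mxE sqrrN.
rewrite -sumrN; apply: eq_bigr => i _; rewrite -sumrN; apply: eq_bigr => j _.
by rewrite !mxE mulrNN mulrN.
Qed.

Lemma leeBN (x y : \bar R) (p q : R) :
  (- y - (- q)%:E <= - x - (- p)%:E)%E = (x - p%:E <= y - q%:E)%E.
Proof. by rewrite -leeN2 !fin_num_oppeB// !EFinN !oppeK. Qed.

Lemma viscosity_subsolutionN Om u : open Om -> viscosity_subsolution Om u ->
  viscosity_supersolution Om (fun z => - u z)%E.
Proof.
move=> oO [ufin usc Hu]; split.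
- by move=> z Oz; rewrite eqe_oppLR; exact: ufin.
- move=> z a az; have [|W zW HW] := usc z (- a); first by rewrite EFinN lteNr.
  by exists W => // y Wy; rewrite lteNr -EFinN; exact: HW.
- move=> psi z C2 Oz Hmin; have C2' := class_CN oO C2.
  have [H1 H2] : (grad (fun z => - psi z) z != 0 ->
      dt (fun z => - psi z) z - inf_laplacian (fun z => - psi z) z <= 0) /\
    (grad (fun z => - psi z) z = 0 ->
      dt (fun z => - psi z) z - max_eigenvalue (hess (fun z => - psi z) z) <= 0).
    by apply: Hu => // y Oy; rewrite -leeBN !opprK; exact: Hmin.
  move: H1 H2; rewrite (dtN C2 Oz) (gradN C2 Oz) (hessN oO C2 Oz) (inf_laplacianN oO C2 Oz).
  rewrite -[in min_eigenvalue _](opprK (hess psi z)) min_eigenvalueN oppr_eq0 => H1 H2.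
  split => g; first by have := H1 g; lra.
  by have := H2 (etrans (congr1 -%R g) (oppr0 _)); lra.
Qed.

Lemma viscosity_subsolution_of_super Om u : open Om ->
  viscosity_supersolution Om (fun z => - u z)%E -> viscosity_subsolution Om u.
Proof.
move=> oO [ufin lsc Hu]; split.
- by move=> z Oz; have := ufin z Oz; rewrite eqe_oppLR.
- move=> z a az; have [|W zW HW] := lsc z (- a); first by rewrite EFinN lteN2.
  by exists W => // y /HW; rewrite EFinN lteN2.
- move=> psi z C2 Oz Hmax; have C2' := class_CN oO C2.
  have [H1 H2] : (grad (fun z => - psi z) z != 0 ->
      dt (fun z => - psi z) z - inf_laplacian (fun z => - psi z) z >= 0) /\
    (grad (fun z => - psi z) z = 0 ->
      dt (fun z => - psi z) z - min_eigenvalue (hess (fun z => - psi z) z) >= 0).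
    by apply: Hu => // y Oy; rewrite leeBN; exact: Hmax.
  move: H1 H2; rewrite (dtN C2 Oz) (gradN C2 Oz) (hessN oO C2 Oz) (inf_laplacianN oO C2 Oz).
  rewrite min_eigenvalueN oppr_eq0 => H1 H2.
  split => g; first by have := H1 g; lra.
  by have := H2 (etrans (congr1 -%R g) (oppr0 _)); lra.
Qed.

Lemma lower_class_upper Om f u : open Om ->
  lower_class Om f u <-> upper_class Om (fun z => - f z) (fun z => - u z)%E.
Proof.
move=> oO; split=> -[H1 H2]; split.
- exact: viscosity_subsolutionN.
- by move=> z /H2; rewrite limf_einfN EFinN leeN2.
- exact: viscosity_subsolution_of_super.
- by move=> z /H2; rewrite limf_einfN EFinN leeN2.
Qed.

Lemma lower_perronE Om f : open Om ->
  lower_perron Om f = (fun z => - upper_perron Om (fun z => - f z)%R z)%E.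
Proof.
move=> oO; apply/funext => z; rewrite /lower_perron /upper_perron /ereal_inf oppeK.
congr ereal_sup; apply/seteqP; split => x /=.
  move=> [v Lv <-]; exists (- v z)%E; last by rewrite oppeK.
  by exists (fun z => - v z)%E => //; apply/(lower_class_upper _ _ oO).
move=> [_ [u Uu <-] <-]; exists (fun z => - u z)%E => //.
apply/(lower_class_upper _ _ oO); rewrite (_ : (fun _ => _) = u)//.
by apply/funext => y; rewrite oppeK.
Qed.

Lemma viscosity_solutionN Om u : open Om -> viscosity_solution Om u ->
  viscosity_solution Om (fun z => - u z)%E.
Proof.
move=> oO [H1 H2]; split; last exact: viscosity_subsolutionN.
apply: viscosity_subsolution_of_super => //; rewrite (_ : (fun _ => _) = u)//.
by apply/funext => y; rewrite oppeK.
Qed.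

End Negation.

(** * The real-valued upper class *)

Section RealUpperClass.
Context {R : realType} {n : nat}.
Local Notation V := 'rV[R]_n.+1.
Variables (Om : set (spacetime R n)) (f : spacetime R n -> R) (M : R).
Hypotheses (oOm : open Om) (bOm : bounded_set Om).
Implicit Types (z : spacetime R n) (v b : spacetime R n -> R) (N C : set (spacetime R n)).

(* The part of the upper class that matters for the infimum: after truncation
   at a bound [M] of the boundary data, supersolutions are real valued. *)
Definition real_upper v : Prop :=
  [/\ forall z, Om z -> lsc_at v z, forall z, Om z -> jet_super v z,
      forall z, Om z -> v z <= M &
      forall z, boundary Om z -> forall e, 0 < e -> \forall y \near z, Om y -> f z - e < v y].

Lemma boundary_notin z : boundary Om z -> ~ Om z.
Proof. by move=> [_ nz] Oz; apply: nz; exact: (open_nbhs_nbhs (conj oOm Oz)). Qed.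

Lemma closure_boundary z : closure Om z -> ~ Om z -> boundary Om z.
Proof. by move=> cz nz; split => // /interior_subset. Qed.

Lemma near_open z N : open N -> N z -> \forall y \near z, N y.
Proof. by move=> oN Nz; apply: open_nbhs_nbhs; split. Qed.

Lemma real_upper_cst : (forall z, boundary Om z -> f z <= M) -> real_upper (fun=> M).
Proof.
move=> fM; split=> [z _|z _|//|z bz e e0].
- by apply: lsc_at_continuous; exact: cst_continuous.
- exact: jet_super_cst.
- by apply: filterE => y _; have := fM z bz; lra.
Qed.

Lemma real_upper_min v b : real_upper v -> real_upper b ->
  real_upper (fun z => Num.min (v z) (b z)).
Proof.
move=> [v1 v2 v3 v4] [b1 b2 b3 b4]; split.
- by move=> z Oz; apply: lsc_at_min; [exact: v1|exact: b1].
- move=> z Oz; have [vb|/ltW bv] := leP (v z) (b z).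
    apply: (jet_super_touch (v := v)) (v2 z Oz); first by rewrite min_l.
    by apply: filterE => y; rewrite ge_min lexx.
  apply: (jet_super_touch (v := b)) (b2 z Oz); first by rewrite min_r.
  by apply: filterE => y; rewrite ge_min lexx orbT.
- by move=> z Oz; rewrite ge_min v3.
- move=> z bz e e0; apply: filterS2 (v4 z bz e e0) (b4 z bz e e0) => y H1 H2 Oy.
  by rewrite lt_min H1// H2.
Qed.

Lemma compact_closure_Om : compact (closure Om).
Proof.
apply: st_bounded_closed_compact; last exact: closed_closure.
have [B [_ HB]] := bOm.
have cB (B' : R) : closed [set z : spacetime R n | `|z| <= B'].
  rewrite (_ : mkset _ = (fun z : spacetime R n => `|z|) @^-1` [set s | s <= B'])//.
  by apply: preimage_closed; [move=> y _; exact: norm_continuous|exact: closed_le].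
exists B; split; first exact: num_real.
move=> B' BB' z cz.
suff : closure [set z : spacetime R n | `|z| <= B'] z.
  by rewrite -(iffLR (closure_id _) (cB B')).
by apply: closureS cz => y; exact: HB.
Qed.

Lemma time_bound : exists2 T, 0 < T & forall z, Om z -> `|z.2| <= T.
Proof.
have [B [_ HB]] := bOm; exists (`|B| + 1); first by rewrite ltr_wpDl.
move=> z Oz; have B1 : B < `|B| + 1 by have := ler_norm B; lra.
have : Num.max `|z.1| `|z.2| <= `|B| + 1 by exact: (HB _ B1 z Oz).
by rewrite ge_max => /andP[].
Qed.

Lemma time_bound_closure : exists2 T, 0 < T & forall z, closure Om z -> `|z.2| <= T.
Proof.
have [T T0 HT] := time_bound; exists (T + 1) => [|z cz]; first by rewrite ltr_wpDr.
have [|y [Oy zy]] := cz (ball z 1); first exact: nbhsx_ballx.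
have := HT y Oy; have : `|z.2 - y.2| <= 1.
  by case: zy => _; rewrite -ball_normE => /ltW.
by move=> h1 h2; rewrite -(subrK y.2 z.2) (le_trans (ler_normD _ _))// addrC lerD.
Qed.

(** Comparison with a constant. If [v] drops below [m], then [v], extended by [m] off [Om], plus a
    small multiple of time attains its minimum over the closure inside [Om]; the jet there has zero
    gradient and Hessian and negative time slope. *)
Lemma real_upper_ge m v : (forall z, boundary Om z -> m <= f z) -> real_upper v ->
  forall z, Om z -> m <= v z.
Proof.
move=> mf [v1 v2 v3 v4] z1 Oz1; rewrite leNgt; apply/negP => vm.
have [T T0 HT] := time_bound_closure.
(* Over the closure the tilt varies by at most [2 * T * c], half of the gap [m - v z1], so a minimum
   off [Om] is excluded. *)
pose c := (m - v z1) / (4 * T).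
have T4 : 0 < 4 * T by rewrite mulr_gt0.
have c0 : 0 < c by rewrite divr_gt0// subr_gt0.
have cT : c * (4 * T) = m - v z1 by rewrite /c divfK// gt_eqF.
pose g z := if `[< Om z >] then v z else m.
have gin z : Om z -> g z = v z by move=> Oz; rewrite /g asboolT.
have gout z : ~ Om z -> g z = m by move=> Oz; rewrite /g asboolF.
have [|z cz|z0 cz0 Hmin] := @lsc_compact_min R _ (fun z => g z + c * z.2) (closure Om) compact_closure_Om.
- by exists z1; apply: subset_closure.
- apply: (@lsc_atD _ _ g (fun z => c * z.2)); last first.
    apply: lsc_at_continuous; apply: (@continuousM _ _ (fun=> c) (fun z : spacetime R n => z.2)).
      exact: cst_continuous.
    exact: cvg_snd.
  have [Oz|nOz] := pselect (Om z).
    apply: near_eq_lsc_at (v1 z Oz).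
    by apply: filterS (near_open oOm Oz) => y /gin ->.
  move=> e e0; have bz := closure_boundary cz nOz.
  apply: filterS (v4 z bz e e0) => y H; rewrite gout//.
  have [Oy|nOy] := pselect (Om y).
    by rewrite gin//; apply: le_lt_trans (H Oy); rewrite lerD2r mf.
  by rewrite gout// gtrBl.
have [Oz0|nOz0] := pselect (Om z0); last first.
  have := Hmin z1 (subset_closure Oz1); rewrite gout// gin//.
  have := HT z0 cz0; have := HT z1 (subset_closure Oz1); rewrite !ler_norml.
  by move=> /andP[? ?] /andP[? ?]; nra.
have [e [es _]] : par_super (- c) (0 : V) 0.
  apply: (v2 z0 Oz0); exists 0; apply: filterS (near_open oOm Oz0) => y Oy.
  have := Hmin y (subset_closure Oy); rewrite !gin// /quad qfE mulmx0 !dot0l; lra.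
by rewrite qfE mulmx0 dot0l; lra.
Qed.

Definition glue v b N z := if `[< N z >] then Num.min (v z) (b z) else v z.

Lemma glue_le v b N z : glue v b N z <= v z.
Proof. by rewrite /glue; case: asboolP => // _; rewrite ge_min lexx. Qed.

Lemma glue_le_in v b N z : N z -> glue v b N z <= b z.
Proof. by move=> Nz; rewrite /glue asboolT// ge_min lexx orbT. Qed.

(** Off the closed set [C] the glued function is [v], so nothing changes near the edge of [N] or
    near the boundary of [Om]. Inside [N] it is a minimum, and [b] has to satisfy the equation only
    where it is strictly the smaller one. *)
Lemma real_upper_glue v b N C : real_upper v -> open N -> closed C ->
  C `<=` N -> N `<=` Om -> (forall z, N z -> ~ C z -> v z <= b z) ->
  (forall z, N z -> lsc_at b z) -> (forall z, N z -> b z < v z -> jet_super b z) ->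
  real_upper (glue v b N).
Proof.
move=> [v1 v2 v3 v4] oN cC CN NOm vb b1 b2.
have out z : ~ C z -> glue v b N z = v z.
  by move=> nC; rewrite /glue; case: asboolP => // Nz; rewrite min_l// vb.
have outn z : ~ C z -> \forall y \near z, v y = glue v b N y.
  by move=> nC; apply: filterS (near_open (closed_openC cC) nC) => y /out.
split.
- move=> z Oz; have [Cz|nC] := pselect (C z); last first.
    by apply: near_eq_lsc_at (v1 z Oz); exact: outn.
  have Nz := CN z Cz.
  apply: near_eq_lsc_at (lsc_at_min (v1 z Oz) (b1 z Nz)).
  by apply: filterS (near_open oN Nz) => y Ny; rewrite /glue asboolT.
- move=> z Oz; have [[Nz bv]|H] := pselect (N z /\ b z < v z).
    apply: (jet_super_touch (v := b)) (b2 z Nz bv).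
      by rewrite /glue asboolT// min_r// ltW.
    by apply: filterS (near_open oN Nz) => y; exact: glue_le_in.
  apply: (jet_super_touch (v := v)) (v2 z Oz); last by apply: filterE => y; exact: glue_le.
  rewrite /glue; case: asboolP => // Nz; rewrite min_l// leNgt.
  by apply/negP => bv; apply: H.
- by move=> z Oz; apply: le_trans (glue_le _ _ _ _) (v3 z Oz).
- move=> z bz e e0; have nC : ~ C z by move=> /CN/NOm; exact: boundary_notin.
  by apply: filterS2 (outn z nC) (v4 z bz e e0) => y <-.
Qed.

End RealUpperClass.

(** * Spatial regularisation by a reflection coupling *)

Section QuarticRoot.
Context {R : realType}.
Implicit Types (s S a : R).

(** Applied to [dot (x - y) (x - y)] this is the square root of the Euclidean distance; the argument
    stays polynomial in the displacements. *)
Definition root4 s : R := Num.sqrt (Num.sqrt s).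

Lemma root4_ge0 s : 0 <= root4 s. Proof. exact: sqrtr_ge0. Qed.

Lemma root4X s : 0 <= s -> root4 s ^+ 4 = s.
Proof. by move=> s0; rewrite (exprM _ 2 2) !sqr_sqrtr ?sqrtr_ge0. Qed.

Lemma root4_X4 a : 0 <= a -> root4 (a ^+ 4) = a.
Proof.
move=> a0; rewrite /root4 (exprM _ 2 2) sqrtr_sqr ger0_norm ?sqr_ge0//.
by rewrite sqrtr_sqr ger0_norm.
Qed.

Lemma root4_le s a : 0 <= a -> s <= a ^+ 4 -> root4 s <= a.
Proof.
move=> a0 sa; rewrite -(root4_X4 a0).
by rewrite /root4 !ler_wsqrtr.
Qed.

Lemma le_root4 s a : 0 <= a -> a ^+ 4 <= s -> a <= root4 s.
Proof.
move=> a0 sa; rewrite -(root4_X4 a0).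
by rewrite /root4 !ler_wsqrtr.
Qed.

Lemma root4_tangent s S : 0 < s -> 0 <= S ->
  root4 S <= root4 s * (1 + (S - s) / s / 4).
Proof.
move=> s0 S0; have [d dE] : exists d, d = (S - s) / s by eexists.
have SE : S = s * (1 + d) by rewrite dE; field; rewrite gt_eqF.
have d1 : -1 <= d.
  by rewrite dE ler_pdivlMr//; lra.
rewrite -dE; have a0 : 0 <= 1 + d / 4 by lra.
apply: root4_le; first by rewrite mulr_ge0 ?root4_ge0.
rewrite exprMn root4X ?(ltW s0)// SE ler_pM2l//.
have : 1 + d / 2 <= (1 + d / 4) ^+ 2 by have := sqr_ge0 d; lra.
have b0 : 0 <= 1 + d / 2 by lra.
move=> h; rewrite (exprM _ 2 2).
apply: (@le_trans _ _ ((1 + d / 2) ^+ 2)); first by have := sqr_ge0 d; lra.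
by rewrite ler_pXn2r// nnegrE// sqr_ge0.
Qed.

(** The exact second-order coefficient of the fourth root is [- 3 / 32 = - 6 / 64]; weakening it to
    [- 5 / 64] leaves room for the higher-order terms when the relative increment is at most
    [1 / 8]. *)
Lemma root4_second_order s S : 0 < s -> 0 <= S -> `|S - s| <= s / 8 ->
  root4 S <= root4 s * (1 + (S - s) / s / 4 - 5 / 64 * ((S - s) / s) ^+ 2).
Proof.
move=> s0 S0; have [d dE] : exists d, d = (S - s) / s by eexists.
have SE : S = s * (1 + d) by rewrite dE; field; rewrite gt_eqF.
rewrite -dE SE (_ : s * (1 + d) - s = s * d); last by ring.
rewrite normrM gtr0_norm// ler_pM2l// ler_norml => /andP[d1 d2].
set a := 1 + d / 4 - _.
have dd : d ^+ 2 <= 1 / 64 by nra.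
have dd0 := sqr_ge0 d.
have a0 : 0 <= a by rewrite /a; lra.
apply: root4_le; first by rewrite mulr_ge0 ?root4_ge0.
rewrite exprMn root4X ?(ltW s0)// ler_pM2l// (exprM _ 2 2).
(* An intermediate bound for the square root of [1 + d], with its coefficient [1 / 8] weakened to
   [1 / 10], so that the root can be taken twice. *)
pose b := 1 + d / 2 - d ^+ 2 / 10.
have b0 : 0 <= b by rewrite /b; lra.
have ab : b <= a ^+ 2.
  have -> : a ^+ 2 = b + d ^+ 2 * ((1 / 4 - 5 / 64 * d) ^+ 2 - 5 / 32 + 1 / 10).
    by rewrite /a /b; field.
  by rewrite lerDl mulr_ge0//; nra.
apply: (@le_trans _ _ (b ^+ 2)); last by rewrite ler_pXn2r// nnegrE// sqr_ge0.
have -> : b ^+ 2 = 1 + d + d ^+ 2 * (1 / 20 - d / 10 + d ^+ 2 / 100).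
  by rewrite /b; field.
by rewrite lerDl mulr_ge0//; lra.
Qed.

End QuarticRoot.

(** * The reflection coupling and the transport of jets from x to y *)

Section Doubling.
Context {R : realType} {n : nat}.
Local Notation V := 'rV[R]_n.+1.
Implicit Types (x y h e q d xi : V).

Definition pen (L k : R) (x0 : V) (t0 : R) x y (t : R) : R :=
  L * root4 (dot (x - y) (x - y)) + k * dot (x - x0) (x - x0) + k * (t - t0) ^+ 2.

(* Reflection coupling: moving [y] by [h] and [x] by [- (h . e) q], with [q]
   close to [e = (x - y) / |x - y|], moves [x - y] radially at double speed and
   so exploits the concavity of the square root of the distance. *)
Lemma root4_reflection e q sg c : 0 < sg -> sphere e -> sphere q ->
  dot q e = c -> 9 / 11 <= c ->
  exists2 X, qf X e <= - (Num.sqrt sg / (5 * sg ^+ 2)) + 1 / 10 &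
  exists2 dl, 0 < dl & forall h, `|h| < dl ->
    root4 (dot (sg *: e - dot h e *: q - h) (sg *: e - dot h e *: q - h)) <=
    Num.sqrt sg + dot (- (Num.sqrt sg * (1 + c) / (2 * sg)) *: e) h + 2^-1 * qf X h.
Proof.
move=> sg0 es qs qe c9.
have c1 : c <= 1.
  have := cauchy_schwarz q e; rewrite qe (_ : dot q q = 1)// (_ : dot e e = 1)//; nra.
have s0 : 0 < sg ^+ 2 by rewrite exprn_gt0.
have [be [beE be0]] : exists be, be = Num.sqrt sg /\ 0 < be.
  by exists (Num.sqrt sg); split => //; rewrite sqrtr_gt0.
rewrite -beE.
have r4 : root4 (sg ^+ 2) = be by rewrite /root4 sqrtr_sqr gtr0_norm.
(* The quadratic part of [root4_second_order] at the squared distance [sg ^+ 2 + (l + Q)], where [l]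
   is linear and [Q] quadratic in [h]. The linear part gives [Q / 4], the concave part gives
   [5 / 64] times the square of [l], and [1 / 10] times the identity absorbs the cubic cross
   term. *)
pose X := (2 * (be / sg ^+ 2)) *: ((4^-1 - 5 / 16 * (1 + c) ^+ 2) *: outer e e
   + 2^-1 *: outer e q + 4^-1%:M) + (1 / 10)%:M.
have qX h : 2^-1 * qf X h = be / sg ^+ 2 * (4^-1 * (dot h e ^+ 2 + 2 * (dot h e * dot h q) + dot h h)
    - 5 / 16 * (1 + c) ^+ 2 * dot h e ^+ 2) + 1 / 20 * dot h h.
  by rewrite /X !(qfDl, qfZl, qf_scalar, qf_outer) (dotC e h) (dotC q h); field; rewrite gt_eqF.
exists X.
  have -> : qf X e = 2 * (2^-1 * qf X e) by field.
  rewrite qX (dotC e q) qe (_ : dot e e = 1)//.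
  have -> : - (be / (5 * sg ^+ 2)) = - (be / sg ^+ 2) / 5 by field; rewrite gt_eqF.
  have : 0 < be / sg ^+ 2 by rewrite divr_gt0.
  move: (be / sg ^+ 2) => w w0.
  (* At [c = 9 / 11] the product is [30 / 121], above [1 / 5], and it increases with [c] from
     there. *)
  have k0 : 0 <= (1 + c) * (5 * c - 3) / 8 - 1 / 5 by nra.
  by have := mulr_ge0 (ltW w0) k0; lra.
(* [160 / 64] is [5 / 64] times 2 from the cross term, 4 from [labs] and 4 from [Q4]. *)
have [C [CE C0]] : exists C, C = be / sg ^+ 2 / sg ^+ 2 * (160 / 64 * sg) /\ 0 < C.
  by eexists; split => //; apply: mulr_gt0; [rewrite !divr_gt0|nra].
have N0 : (0 : R) < n.+1%:R by rewrite ltr0n.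
pose dl := Num.min 1 (Num.min (sg ^+ 2 / 8 / (4 * sg * n.+1%:R * `|e| + 4 * n.+1%:R))
   (1 / 20 / (C * n.+1%:R * (`|e| + 1)))).
have P1 : 0 < 4 * sg * n.+1%:R * `|e| + 4 * n.+1%:R.
  by rewrite ltr_wpDl ?mulr_gt0// !mulr_ge0// ltW.
have P2 : 0 < C * n.+1%:R * (`|e| + 1) by apply: mulr_gt0; [exact: mulr_gt0|rewrite ltr_wpDl].
exists dl; first by rewrite !lt_min ltr01 !divr_gt0.
move=> h; rewrite !lt_min (ltr_pdivlMr _ _ P1) (ltr_pdivlMr _ _ P2) => /andP[h1 /andP[hA hB]].
have hh0 := dot_ge0 h; have nh0 := normr_ge0 h; have ne0 := normr_ge0 e.
have he : `|dot h e| <= n.+1%:R * (`|h| * `|e|) by exact: dot_abs_le.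
have hh : dot h h <= n.+1%:R * `|h|.
  by apply: le_trans (dot_le_sqr_norm h) _; rewrite ler_pM2l// expr2 ler_piMl// ltW.
have [l lE] : exists l, l = - (2 * sg * (1 + c) * dot h e) by eexists.
have [Q QE] : exists Q, Q = dot h e ^+ 2 + 2 * (dot h e * dot h q) + dot h h by eexists.
have he2 : dot h e ^+ 2 <= dot h h by have := cauchy_schwarz h e; rewrite (_ : dot e e = 1)// mulr1.
have hq2 : dot h q ^+ 2 <= dot h h by have := cauchy_schwarz h q; rewrite (_ : dot q q = 1)// mulr1.
have Q0 : 0 <= Q.
  have := dot_ge0 (dot h e *: q + h).
  rewrite !(dotDl, dotDr, dotZl, dotZr) (_ : dot q q = 1)// (dotC q h) QE; lra.
have Q4 : Q <= 4 * dot h h.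
  by have := sqr_ge0 (dot h e - dot h q); rewrite QE; lra.
have labs : `|l| <= 4 * sg * `|dot h e|.
  rewrite lE normrN !normrM (gtr0_norm sg0) (ger0_norm (_ : 0 <= 2)) ?ler0n//.
  rewrite (ger0_norm (_ : 0 <= 1 + c)); last by lra.
  by rewrite ler_wpM2r//; nra.
set S := dot _ _.
have SE : S = sg ^+ 2 + (l + Q).
  rewrite /S !(dotBl, dotBr, dotZl, dotZr) (_ : dot q q = 1)// (_ : dot e e = 1)//.
  by rewrite (dotC e q) qe (dotC e h) (dotC q h) lE QE; ring.
have lQ : `|l + Q| <= sg ^+ 2 / 8.
  apply: le_trans (ler_normD _ _) _; rewrite (ger0_norm Q0).
  have : 4 * sg * `|dot h e| <= 4 * sg * (n.+1%:R * (`|h| * `|e|)) by rewrite ler_pM2l// mulr_gt0.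
  lra.
have := @root4_second_order R (sg ^+ 2) S s0 (dot_ge0 _).
rewrite SE [sg ^+ 2 + _]addrC addrK => /(_ lQ); rewrite r4 => /le_trans; apply.
rewrite dotZl (dotC e h) qX -QE.
have sq : l ^+ 2 - 2 * `|l| * Q <= (l + Q) ^+ 2.
  have : - (`|l| * Q) <= l * Q by rewrite -mulNr ler_wpM2r// lerNl -normrN ler_norm.
  by have := sqr_ge0 Q; lra.
have CQ : be / sg ^+ 2 / sg ^+ 2 * (5 / 64 * (2 * `|l| * Q)) <= 1 / 20 * dot h h.
  have lQ' : `|l| * Q <= 4 * sg * `|dot h e| * (4 * dot h h).
    by apply: ler_pM.
  apply: (@le_trans _ _ (C * (`|dot h e| * dot h h))).
    rewrite CE -!mulrA ler_pM2l// ler_pM2l ?invr_gt0// ler_pM2l ?invr_gt0//; lra.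
  rewrite mulrA ler_wpM2r//.
  apply: (@le_trans _ _ (C * (n.+1%:R * (`|h| * `|e|)))); first by rewrite ler_pM2l.
  apply: (le_trans _ (ltW hB)).
  have -> : `|h| * (C * n.+1%:R * (`|e| + 1)) = C * (n.+1%:R * (`|h| * `|e|)) + C * n.+1%:R * `|h|.
    by ring.
  by rewrite lerDl !mulr_ge0// ltW.
have -> : be * (1 + (l + Q) / sg ^+ 2 / 4 - 5 / 64 * ((l + Q) / sg ^+ 2) ^+ 2) =
   be + be / sg ^+ 2 * ((l + Q) / 4) - be / sg ^+ 2 / sg ^+ 2 * (5 / 64 * (l + Q) ^+ 2).
  by field; rewrite gt_eqF.
have W0 : 0 < be / sg ^+ 2 / sg ^+ 2 by rewrite !divr_gt0.
have := ler_wpM2l (ltW W0) sq.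
have e1 : - (be * (1 + c) / (2 * sg)) * dot h e = be / sg ^+ 2 * (l / 4).
  by rewrite lE; field; rewrite gt_eqF.
have e2 : be / sg ^+ 2 / sg ^+ 2 * l ^+ 2 = be / sg ^+ 2 * (4 * (1 + c) ^+ 2 * dot h e ^+ 2).
  by rewrite lE; field; rewrite gt_eqF.
rewrite e1; move: CQ e2.
rewrite mulrBr.
move: (be / sg ^+ 2 / sg ^+ 2) W0 => W W0.
move: (be / sg ^+ 2) => U; lra.
Qed.

End Doubling.

Section DoublingJet.
Context {R : realType} {n : nat}.
Local Notation V := 'rV[R]_n.+1.

(** As [w] lies below [v (y, t)] plus a penalty smooth in x, its gradient at x is forced to be that
    of the penalty, [N *: q], while the gradient transported to y is [A *: e]. Moving y by [h] and x
    by [- dot h e *: q] therefore converts the inequality for [v] in direction [e] into the one for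
    [w] in direction [q]. *)
Lemma doubling_jet (v w : spacetime R n -> R) (k r : R) (x0 x y : V) (t0 t d : R) :
  let L := 40 * k * (1 + r) in
  0 < k -> 0 < r -> 0 < d -> x != y -> dot (x - y) (x - y) <= 1 ->
  dot (x - x0) (x - x0) <= r ^+ 2 -> `|t - t0| <= r ->
  w (x, t) = v (y, t) + pen L k x0 t0 x y t ->
  (forall h h' s, `|h| < d -> `|h'| < d -> `|s| < d ->
     w (x + h', t + s) <= v (y + h, t + s) + pen L k x0 t0 (x + h') (y + h) (t + s)) ->
  jet_super v (y, t) -> jet_super w (x, t).
Proof.
move=> L k0 r0 d0 xy dxy xi2 tr wE wle jv a p X [K /st_nearP[d1 d10 Hw]].
have L0 : 0 < L by rewrite !mulr_gt0// addr_gt0.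
have LE : L = 40 * k * (1 + r) by [].
clearbody L.
have xy0 : x - y != 0 by rewrite subr_eq0.
have s0 := dot_gt0 xy0.
have [sg [sg0 sg2 sg1]] : exists sg, [/\ 0 < sg, sg ^+ 2 = dot (x - y) (x - y) & sg <= 1].
  exists (Num.sqrt (dot (x - y) (x - y))); rewrite sqrtr_gt0 sqr_sqrtr ?dot_ge0//.
  by split => //; rewrite -sqrtr1 ler_wsqrtr.
have [e [es eE]] : exists e, sphere e /\ x - y = sg *: e.
  exists (sg^-1 *: (x - y)); rewrite scalerA mulfV ?scale1r ?gt_eqF//; split => //.
  by rewrite /sphere/= dotZl dotZr -sg2 expr2 mulKf ?mulVf// gt_eqF.
have ee : dot e e = 1 by exact: es.
have [be [beE be0 be2]] : exists be, [/\ be = Num.sqrt sg, 0 < be & be ^+ 2 = sg].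
  by exists (Num.sqrt sg); rewrite sqrtr_gt0 sqr_sqrtr// ltW.
have r4 : root4 (dot (x - y) (x - y)) = be.
  by rewrite -sg2 /root4 sqrtr_sqr gtr0_norm.
have besg : sg <= be.
  have : be <= 1 by rewrite beE -sqrtr1 ler_wsqrtr.
  by rewrite -be2 => b1; rewrite expr2 ler_piMl// ltW.
(* The slope of [L] times the square root of the distance, at distance [sg]. *)
have [A AE] : exists A, A = L * be / (2 * sg) by eexists.
have Asg : A * (2 * sg) = L * be by rewrite AE divfK// mulf_neq0// gt_eqF.
have A20 : 20 * k * (1 + r) <= A.
  rewrite AE ler_pdivlMr ?mulr_gt0//.
  have -> : 20 * k * (1 + r) * (2 * sg) = L * sg by rewrite LE; ring.
  by rewrite ler_pM2l.
have A0 : 0 < A by apply: lt_le_trans A20; rewrite !mulr_gt0// addr_gt0.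
have [xi xiE] : exists xi, xi = x - x0 by eexists.
rewrite -xiE in xi2.
have xie := cauchy_schwarz xi e; rewrite ee mulr1 in xie.
have xier : `|dot xi e| <= r.
  by rewrite -(ler_pXn2r (_ : 0 < 2)%N)// ?nnegrE ?(ltW r0)// real_normK ?num_real//; lra.
pose g := A *: e + (2 * k) *: xi.
have kr2 : 20 * (k * r) <= A by nra.
have ge : dot g e = A + 2 * k * dot xi e by rewrite /g dotDl !dotZl ee mulr1.
have kxi : `|2 * k * dot xi e| <= 2 * (k * r).
  by rewrite !normrM (ger0_norm (_ : 0 <= 2)) ?ler0n// (gtr0_norm k0) -mulrA ler_pM2l// ler_pM2l.
have ge9 : 9 / 10 * A <= dot g e.
  by move: kxi; rewrite ler_norml ge => /andP[? ?]; lra.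
have g0 : g != 0.
  by apply/eqP => g0; move: ge9; rewrite g0 dot0l; lra.
have [c0 c00 qs] := normalize g0.
have [N [q [N0 qq gE]]] : exists N q, [/\ 0 < N, dot q q = 1 & g = N *: q].
  exists c0^-1, (c0 *: g); split => //; first by rewrite invr_gt0.
  by rewrite scalerA mulVf ?scale1r// gt_eqF.
have [c cE] : exists c, dot q e = c by eexists.
have geN : dot g e = N * c by rewrite gE dotZl cE.
have N2 : N ^+ 2 = A ^+ 2 + 2 * A * (2 * k * dot xi e) + 4 * k ^+ 2 * dot xi xi.
  have -> : N ^+ 2 = dot g g by rewrite gE dotZl dotZr qq; ring.
  by rewrite /g !(dotDl, dotDr, dotZl, dotZr) ee (dotC e xi); ring.
have NA : N <= 11 / 10 * A.
  rewrite -(ler_pXn2r (_ : 0 < 2)%N)// ?nnegrE ?(ltW N0)//; last by nra.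
  move: kxi; rewrite ler_norml => /andP[_ kxi].
  have k2 : 4 * k ^+ 2 * dot xi xi <= (2 * (k * r)) ^+ 2.
    have -> : (2 * (k * r)) ^+ 2 = 4 * k ^+ 2 * r ^+ 2 by ring.
    by rewrite ler_pM2l// mulr_gt0// exprn_gt0.
  have kr0 : 0 <= 2 * (k * r) by rewrite !mulr_ge0// ltW.
  have : 2 * A * (2 * k * dot xi e) <= 2 * A * (2 * (k * r)) by rewrite ler_pM2l// mulr_gt0.
  have kr10 : 10 * (2 * (k * r)) <= A by move: kr2; clear; lra.
  move: (2 * (k * r)) kr0 k2 kr10 => G; rewrite N2 => G0 k2 G20 h.
  have GA : G <= A / 10 by lra.
  by move: GA G0 k2 h A0; clear; nra.
(* The tilt of [g] by [(2 * k) *: xi] has length at most [2 * (k * r)], hence at most [A / 10]; so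
   [dot g e] is at least [9 / 10 * A] and the length [N] of [g] at most [11 / 10 * A]. *)
have c9 : 9 / 11 <= c.
  rewrite leNgt; apply/negP => c9; have : N * c < N * (9 / 11) by rewrite ltr_pM2l.
  by rewrite -geN; move: ge9 NA; clear; lra.
have r4s : root4 (sg ^+ 2) = be by rewrite sg2.
have SE h : dot (x + h - y) (x + h - y) = sg ^+ 2 + (2 * sg * dot e h + dot h h).
  have -> : x + h - y = sg *: e + h by rewrite addrAC eE.
  by rewrite dotDl !dotDr !dotZl !dotZr (dotC h e) ee; ring.
have XE h : dot (x + h - x0) (x + h - x0) = dot xi xi + 2 * dot xi h + dot h h.
  have -> : x + h - x0 = xi + h by rewrite addrAC xiE.
  by rewrite dotDl !dotDr (dotC h xi); ring.
have gdef : g = A *: e + (2 * k) *: xi by [].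
clearbody g.
have pg : p = g.
  have [_ pE _] : [/\ 0 = 0 :> R, p = g & forall h, qf X h <= qf (2 * (L * be / (4 * sg ^+ 2) + k))%:M h]; last by [].
  pose dd := Num.min d d1; have dd0 : 0 < dd by rewrite lt_min d0.
  apply: (@quad_le_quad R n 0 p X 0 0 g _ 0 dd dd0) => h s.
  rewrite lt_min => /andP[hd hd1] _.
  have := Hw (x + h) t; rewrite /= (addrC x) addrK subrr normr0 => /(_ hd1 d10).
  have := wle 0 h 0; rewrite !normr0 !addr0 => /(_ d0 hd d0).
  rewrite wE (addrC h) /pen r4 SE XE -xiE => h1 h2.
  have u0 : 0 <= sg ^+ 2 + (2 * sg * dot e h + dot h h) by rewrite -SE dot_ge0.
  have := @root4_tangent R (sg ^+ 2) _ (exprn_gt0 2 sg0) u0.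
  rewrite (_ : _ - sg ^+ 2 = 2 * sg * dot e h + dot h h); last by ring.
  rewrite r4s => /(ler_wpM2l (ltW L0)).
  have -> : L * (be * (1 + (2 * sg * dot e h + dot h h) / sg ^+ 2 / 4)) =
    L * be + A * dot e h + L * be / (4 * sg ^+ 2) * dot h h.
    by rewrite AE; field; rewrite gt_eqF.
  rewrite /quad qf_scalar gdef dotDl !dotZl => h3.
  by move: h1 h2 h3; rewrite /quad; clear; lra.
have [X' X'e [dl dl0 HX']] := root4_reflection sg0 es qq cE c9.
rewrite -beE in X'e HX'.
have pq : dot p q = N by rewrite pg gE dotZl qq mulr1.
pose T h : V := - (dot h e *: q).
have [dT dT0 HT] : exists2 dT, 0 < dT & forall h, `|h| < dT -> `|T h| < Num.min d d1.
  have m0 : 0 < Num.min d d1 by rewrite lt_min d0.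
  have D0 : 0 < n.+1%:R * (`|e| * `|q|) + 1 by rewrite ltr_wpDl ?mulr_ge0.
  exists (Num.min d d1 / (n.+1%:R * (`|e| * `|q|) + 1)); first by rewrite divr_gt0.
  move=> h; rewrite ltr_pdivlMr// => hT; rewrite /T normrN normrZ.
  apply: le_lt_trans hT; apply: (@le_trans _ _ (n.+1%:R * (`|h| * `|e|) * `|q|)).
    by rewrite ler_wpM2r// dot_abs_le.
  have -> : `|h| * (n.+1%:R * (`|e| * `|q|) + 1) = n.+1%:R * (`|h| * `|e|) * `|q| + `|h| by ring.
  by rewrite lerDl.
have Tq h u : dot u (T h) = - (dot h e * dot u q) by rewrite /T dotNr dotZr.
have qfT h : qf X (T h) = dot h e ^+ 2 * qf X q by rewrite /T -scaleNr qfZ sqrrN.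
pose p' := (- N + 2 * k * dot xi q) *: e - L *: (- (be * (1 + c) / (2 * sg)) *: e).
pose X'' := (qf X q - 2 * k) *: outer e e - L *: X'.
have p'h h : dot p' h = (- N + 2 * k * dot xi q) * dot h e + L * (be * (1 + c) / (2 * sg) * dot h e).
  by rewrite /p' dotBl !dotZl (dotC h e); ring.
have X''h h : qf X'' h = (qf X q - 2 * k) * dot h e ^+ 2 - L * qf X' h.
  by rewrite /X'' qfDl qfNl !qfZl qf_outer (dotC e h) expr2.
have /jv [e' [e's [c' pe'] qe']] : jet v (y, t) (a - 2 * k * (t - t0)) p' X''.
  exists (K + k); apply/st_nearP.
  exists (Num.min (Num.min dT dl) (Num.min d d1)); first by rewrite !lt_min dT0 dl0 d0.
  move=> y' t' /=.
  have [h hE] : exists h, y' = y + h by exists (y' - y); rewrite addrC subrK.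
  have [s sE] : exists s, t' = t + s by exists (t' - t); rewrite addrC subrK.
  rewrite hE sE !(addrC y) !(addrC t) !addrK !lt_min.
  move=> /andP[/andP[hdT hdl] /andP[hd hd1]] /andP[_ /andP[sd sd1]].
  have := HT h hdT; rewrite lt_min => /andP[Td Td1].
  have := Hw (x + T h) (t + s).
  rewrite /= (addrC x) (addrC t) !addrK => /(_ Td1 sd1).
  have := wle h (T h) s hd Td sd.
  rewrite wE (addrC y) (addrC t) (addrC x) /pen r4 -xiE.
  rewrite (addrC (T h)) XE Tq (_ : dot (T h) (T h) = dot h e ^+ 2); last first.
    by rewrite Tq (dotC _ q) Tq qq; ring.
  have -> : x + T h - (h + y) = sg *: e - dot h e *: q - h.
    by rewrite -eE /T; apply/rowP => i; rewrite !mxE; ring.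
  have := ler_wpM2l (ltW L0) (HX' h hdl); rewrite dotZl (dotC e h).
  rewrite /quad Tq qfT pq.
  rewrite p'h X''h; move: (root4 _) => R4; move: (v _) (v _) (w _) => ev ev' ew.
  move: (dot h e) (qf X' h) (qf X q) (dot xi q) (dot xi xi) => he X'h Xq xiq xixi.
  move: (be * (1 + c) / (2 * sg)) => B1; clear; lra.
have gxi : N = A * c + 2 * k * dot xi q.
  by rewrite -pq pg gdef dotDl !dotZl -cE (dotC e q).
have p'A : p' = A *: e.
  have -> : p' = (- N + 2 * k * dot xi q + L * (be * (1 + c) / (2 * sg))) *: e.
    by rewrite /p' scalerA -scalerBl mulrN opprK.
  by congr (_ *: _); rewrite gxi AE; field; rewrite gt_eqF.
have A2 : A ^+ 2 = c' ^+ 2.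
  have : dot p' p' = A ^+ 2 by rewrite p'A dotZl dotZr ee; ring.
  by rewrite pe' dotZl dotZr (_ : dot e' e' = 1)// => <-; ring.
(* The supersolution property of [v] supplies some unit vector parallel to [A *: e]; it is [e] up to
   sign, and the form is even. *)
have qfe : qf X'' e = qf X'' e'.
  have : qf X'' p' = A ^+ 2 * qf X'' e by rewrite p'A qfZ.
  rewrite pe' qfZ -A2 => /mulfI ->//.
  by rewrite expf_neq0// gt_eqF.
exists q; split; first exact: qq.
  by exists N; rewrite pg.
move: qe'; rewrite -qfe /X'' qfDl qfNl !qfZl qf_outer ee => qe.
(* Here the distance [sg] being at most 1 is what bounds the concavity gain from below. *)
have b1 : 1 / 5 <= be / (5 * sg ^+ 2).
  rewrite ler_pdivlMr ?mulr_gt0 ?exprn_gt0//.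
  have : sg ^+ 2 <= sg by rewrite expr2 ler_piMl// ltW.
  by move: besg; clear; lra.
have := ler_wpM2l (ltW L0) X'e.
have := ler_wpM2l (ltW L0) b1.
have : `|k * (t - t0)| <= k * r by rewrite normrM gtr0_norm// ler_pM2l.
rewrite ler_norml => /andP[h1 h2].
have kr0 : 0 < k * r by rewrite mulr_gt0.
(* The net gain [L / 10] is twice [2 * k + 2 * (k * r)], the cost of the spatial Hessian and of the
   time derivative of the localising terms. *)
have L10 : L / 10 = 4 * k + 4 * (k * r) by rewrite LE; field.
move: qe h1 h2 k0 kr0 L10; clear; move: (be / (5 * sg ^+ 2)) => W; lra.
Qed.

End DoublingJet.

Section SpatialRegularisation.
Context {R : realType} {n : nat}.
Local Notation V := 'rV[R]_n.+1.

Lemma lsc_at_comp (S T : topologicalType) (g : S -> T) (v : T -> R) x :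
  {for x, continuous g} -> lsc_at v (g x) -> lsc_at (fun y => v (g y)) x.
Proof. by move=> cg lv e e0; exact: cg (lv e e0). Qed.

Lemma continuous_pair (S : topologicalType) (g1 : S -> V) (g2 : S -> R) (x : S) :
  {for x, continuous g1} -> {for x, continuous g2} ->
  {for x, continuous (fun y => (g1 y, g2 y) : spacetime R n)}.
Proof.
move=> c1 c2 P [[A B] /= [hA hB] HAB].
have h1 : nbhs x (g1 @^-1` A) by exact: c1.
have h2 : nbhs x (g2 @^-1` B) by exact: c2.
have h3 : nbhs x (fun y => P (g1 y, g2 y)).
  by apply: filterS2 h1 h2 => y Ay By; apply: HAB.
exact: h3.
Qed.

Lemma continuous_root4 : continuous (@root4 R).
Proof.
move=> s; apply: (@continuous_comp _ _ _ Num.sqrt Num.sqrt); exact: sqrt_continuous.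
Qed.

Lemma continuous_dot_sub (S : topologicalType) (g1 g2 : S -> V) (x : S) :
  {for x, continuous g1} -> {for x, continuous g2} ->
  {for x, continuous (fun y => dot (g1 y - g2 y) (g1 y - g2 y))}.
Proof.
move=> c1 c2.
have -> : (fun y => dot (g1 y - g2 y) (g1 y - g2 y)) = qf 1%:M \o (fun y => g1 y - g2 y).
  by apply/funext => y; rewrite /= qf_scalar mul1r.
apply: continuous_comp; last exact: continuous_qf.
exact: continuousB.
Qed.

Lemma continuous_pen (S : topologicalType) (gx gy : S -> V) (gt : S -> R) (L k : R) x0 t0 (x : S) :
  {for x, continuous gx} -> {for x, continuous gy} -> {for x, continuous gt} ->
  {for x, continuous (fun p => pen L k x0 t0 (gx p) (gy p) (gt p))}.
Proof.
move=> cx cy ct; rewrite /pen.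
have cc (c : R) : {for x, continuous (fun=> c : R)} by exact: cst_continuous.
have ccV (c : V) : {for x, continuous (fun=> c : V)} by exact: cst_continuous.
apply: (@continuousD _ _ _ (fun p => L * root4 (dot (gx p - gy p) (gx p - gy p)) + k * dot (gx p - x0) (gx p - x0))
  (fun p => k * (gt p - t0) ^+ 2)); last first.
  apply: (@continuousM _ _ (fun=> k) (fun p => (gt p - t0) ^+ 2)) => //.
  apply: (@continuous_comp _ _ _ (fun p => gt p - t0) (fun s => s ^+ 2)); last exact: exprn_continuous.
  exact: (@continuousB _ _ _ gt (fun=> t0)).
apply: (@continuousD _ _ _ (fun p => L * root4 (dot (gx p - gy p) (gx p - gy p)))
   (fun p => k * dot (gx p - x0) (gx p - x0))).
  apply: (@continuousM _ _ (fun=> L) (fun p => root4 (dot (gx p - gy p) (gx p - gy p)))) => //.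
  apply: (@continuous_comp _ _ _ (fun p => dot (gx p - gy p) (gx p - gy p)) (@root4 R)); last exact: continuous_root4.
  exact: continuous_dot_sub.
apply: (@continuousM _ _ (fun=> k) (fun p => dot (gx p - x0) (gx p - x0))) => //.
exact: (@continuous_dot_sub _ gx (fun=> x0)).
Qed.

Lemma st_ballE (z y : spacetime R n) (r : R) :
  ball z r y <-> `|y.1 - z.1| < r /\ `|y.2 - z.2| < r.
Proof.
split=> -[h1 h2].
  by split; [move: h1|move: h2]; rewrite -ball_normE /ball_/= distrC.
by split; rewrite -ball_normE /ball_/= distrC.
Qed.

Variables (Om : set (spacetime R n)) (f : spacetime R n -> R) (m M : R).
Hypotheses (oOm : open Om) (bOm : bounded_set Om).
Hypotheses (mf : forall z, boundary Om z -> m <= f z) (mM : m <= M).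
Variables (x0 : V) (t0 r : R).
Hypotheses (r0 : 0 < r) (r1 : r <= 1) (rn : 9 * n.+1%:R * r ^+ 2 <= 1).
Hypothesis boxOm : forall x t, `|x - x0| <= 2 * r -> `|t - t0| <= 2 * r -> Om (x, t).

(* [kpen] makes the penalty exceed the oscillation [M - m] of the class at
   distance [r] from the base point; [Lpen] is the slope needed by [doubling_jet]. *)
Definition kpen : R := (M - m + 1) / r ^+ 2.
Definition Lpen : R := 40 * kpen * (1 + r).

Lemma kpen_gt0 : 0 < kpen.
Proof.
have D0 : 0 < M - m + 1 by move: mM; lra.
by rewrite divr_gt0// exprn_gt0.
Qed.

Lemma Lpen_gt0 : 0 < Lpen.
Proof.
by apply: mulr_gt0; [apply: mulr_gt0 => //; exact: kpen_gt0|rewrite addr_gt0].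
Qed.

Lemma kpenr : kpen * r ^+ 2 = M - m + 1.
Proof. by rewrite divfK// expf_neq0// gt_eqF. Qed.

Lemma Lpenr : M - m + 1 <= Lpen * r.
Proof.
rewrite /Lpen; have k0 := kpen_gt0; have := kpenr.
have : r ^+ 2 <= r by rewrite expr2 ler_piMl// ltW.
move=> rr <-; have := ler_wpM2l (ltW k0) rr; have := mulr_gt0 k0 r0.
by have := mulr_gt0 (mulr_gt0 k0 r0) r0; lra.
Qed.

Lemma pen_ge (x y : V) t :
  [/\ 0 <= pen Lpen kpen x0 t0 x y t,
      kpen * dot (x - x0) (x - x0) <= pen Lpen kpen x0 t0 x y t,
      kpen * (t - t0) ^+ 2 <= pen Lpen kpen x0 t0 x y t &
      Lpen * root4 (dot (x - y) (x - y)) <= pen Lpen kpen x0 t0 x y t].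
Proof.
have h1 : 0 <= Lpen * root4 (dot (x - y) (x - y)) by rewrite mulr_ge0 ?root4_ge0// ltW// Lpen_gt0.
have h2 : 0 <= kpen * dot (x - x0) (x - x0) by rewrite mulr_ge0 ?dot_ge0// ltW// kpen_gt0.
have h3 : 0 <= kpen * (t - t0) ^+ 2 by rewrite mulr_ge0 ?sqr_ge0// ltW// kpen_gt0.
by rewrite /pen; split; lra.
Qed.

(** The infimum over y is glued into [v]. Members of the class oscillate by at most [M - m], so
    wherever the infimum beats [v] the penalty is below [M - m + 1]; this keeps x well inside the
    cylinder and y close to x, where [doubling_jet] applies. *)
Lemma spatial_regularisation v : real_upper Om f M v ->
  exists v1, [/\ real_upper Om f M v1, forall z, v1 z <= v z &
    forall x y t, `|x - x0| < 2 * r -> `|y - x0| <= 2 * r -> `|t - t0| < 2 * r ->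
      v1 (x, t) <= v (y, t) + pen Lpen kpen x0 t0 x y t].
Proof.
move=> Uv; have [v1 v2 v3 v4] := Uv.
have vm := real_upper_ge oOm bOm mf Uv.
pose B : set V := [set y | `|y - x0| <= 2 * r].
pose G y z := v (y, z.2) + pen Lpen kpen x0 t0 z.1 y z.2.
pose w (z : spacetime R n) := inf [set G y z | y in B].
have wmin z : `|z.2 - t0| <= 2 * r ->
    (exists2 y, B y & w z = G y z) /\ forall y, B y -> w z <= G y z.
  move=> zt.
  have [|y By|y By Hy] := @lsc_compact_min R _ (fun y => G y z) B (@compact_rV_ball _ _ x0 (2 * r)).
  - by exists x0; rewrite /B/= subrr normr0 mulr_ge0// ltW.
  - apply: (@lsc_atD _ _ (fun y => v (y, z.2)) (fun y => pen Lpen kpen x0 t0 z.1 y z.2)).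
      apply: (@lsc_at_comp _ _ (fun y => (y, z.2)) v); last exact: v1 (boxOm By zt).
      by apply: continuous_pair; [exact: (fun _ H => H)|exact: cst_continuous].
    by apply: lsc_at_continuous; apply: continuous_pen; [exact: cst_continuous|exact: (fun _ H => H)|exact: cst_continuous].
  have wE : w z = G y z.
    apply/eqP; rewrite eq_le; apply/andP; split.
      apply: ge_inf; last by exists y.
      by exists (G y z) => _ [y' By' <-]; exact: Hy.
    apply: lb_le_inf; first by exists (G y z); exists y.
    by move=> _ [y' By' <-]; exact: Hy.
  by split; [exists y|move=> y' By'; rewrite wE; exact: Hy].
pose N : set (spacetime R n) := ball (x0, t0) (2 * r).
(* Outside this cylinder one of the two localising terms alone reaches [M - m + 1], so there [w]
   exceeds [M] and hence [v]. *)
pose C : set (spacetime R n) := [set z | dot (z.1 - x0) (z.1 - x0) <= r ^+ 2 /\ `|z.2 - t0| <= r].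
have r20 : 0 < 2 * r by rewrite mulr_gt0.
have dotr (x : V) : dot (x - x0) (x - x0) <= r ^+ 2 -> `|x - x0| <= r.
  move=> H; rewrite -(ler_pXn2r (_ : 0 < 2)%N)// ?nnegrE ?(ltW r0)//.
  exact: le_trans (sqr_norm_le_dot _) H.
have NP z : N z -> `|z.1 - x0| < 2 * r /\ `|z.2 - t0| < 2 * r by move=> /st_ballE.
have oN : open N by exact: ball_open.
exists (glue v w N); split; last 2 first.
- by move=> z; exact: glue_le.
- move=> x y t xr yr tr; apply: le_trans (glue_le_in _ _ _) _; first exact/st_ballE.
  by apply: (wmin (x, t) (ltW tr)).2.
apply: (@real_upper_glue _ _ Om f M oOm v w N C Uv oN).
- rewrite (_ : C = (fun z : spacetime R n => dot (z.1 - x0) (z.1 - x0)) @^-1` [set s | s <= r ^+ 2]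
     `&` (fun z : spacetime R n => `|z.2 - t0|) @^-1` [set s | s <= r])//.
  apply: closedI; (apply: preimage_closed; last exact: closed_le) => z _.
    apply: (@continuous_dot_sub _ (fun z : spacetime R n => z.1) (fun=> x0)); [exact: cvg_fst|exact: cst_continuous].
  apply: (@continuous_comp _ _ _ (fun z : spacetime R n => z.2 - t0) (fun s : R => `|s|)); last exact: norm_continuous.
  by apply: (@continuousB _ _ _ (fun z : spacetime R n => z.2) (fun=> t0)); [exact: cvg_snd|exact: cst_continuous].
- by move=> z [/dotr h1 h2]; apply/st_ballE => /=; split; lra.
- by move=> z /NP[h1 h2]; rewrite [z]surjective_pairing; apply: boxOm; exact: ltW.
- move=> z Nz nC; have [h1 h2] := NP z Nz.
  have Oz : Om z by rewrite [z]surjective_pairing; apply: boxOm; exact: ltW.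
  have [[y By ->] _] := wmin z (ltW h2).
  have [_ p1 p2 _] := pen_ge z.1 y z.2.
  apply: (le_trans (v3 z Oz)).
  have mv := vm _ (boxOm By (ltW h2)).
  suff : M - m + 1 <= pen Lpen kpen x0 t0 z.1 y z.2 by rewrite /G; lra.
  rewrite -kpenr; have k0 := kpen_gt0.
  have [hd|/ltW hd] := leP (dot (z.1 - x0) (z.1 - x0)) (r ^+ 2); last first.
    by apply: le_trans p1; rewrite ler_pM2l.
  apply: le_trans p2; rewrite ler_pM2l// -[leRHS]real_normK ?num_real//.
  rewrite ler_pXn2r// ?nnegrE ?(ltW r0)// leNgt; apply/negP => ht.
  by apply: nC; split => //; exact: ltW.
- move=> z Nz; have [h1 h2] := NP z Nz.
  apply: (@lsc_marginal R _ _ B G w z (@compact_rV_ball _ _ x0 (2 * r))).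
  + move=> y By; apply: (@lsc_atD _ _ (fun p : spacetime R n * V => v (p.2, p.1.2))
       (fun p : spacetime R n * V => pen Lpen kpen x0 t0 p.1.1 p.2 p.1.2)).
      apply: (@lsc_at_comp _ _ (fun p : spacetime R n * V => (p.2, p.1.2)) v); last first.
        exact: v1 (boxOm By (ltW h2)).
      apply: continuous_pair; first exact: cvg_snd.
      by apply: (@continuous_comp _ _ _ (fun p : spacetime R n * V => p.1) (fun z : spacetime R n => z.2)); [exact: cvg_fst|exact: cvg_snd].
    apply: lsc_at_continuous; apply: continuous_pen.
    * by apply: (@continuous_comp _ _ _ (fun p : spacetime R n * V => p.1) (fun z : spacetime R n => z.1)); [exact: cvg_fst|exact: cvg_fst].
    * exact: cvg_snd.
    * by apply: (@continuous_comp _ _ _ (fun p : spacetime R n * V => p.1) (fun z : spacetime R n => z.2)); [exact: cvg_fst|exact: cvg_snd].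
  + by move=> y By; exact: (wmin z (ltW h2)).2.
  + apply: filterS (near_open oN Nz) => z' /NP[_ h2'].
    by have [[y By ->] _] := wmin z' (ltW h2'); exists y.
- move=> z Nz wv; have [h1 h2] := NP z Nz.
  have Oz : Om z by rewrite [z]surjective_pairing; apply: boxOm; exact: ltW.
  have [[y By wE] _] := wmin z (ltW h2).
  have mv := vm _ (boxOm By (ltW h2)).
  have vM := v3 z Oz.
  have [p0 p1 p2 p3] := pen_ge z.1 y z.2.
  have k0 := kpen_gt0; have kr := kpenr.
  have pD : pen Lpen kpen x0 t0 z.1 y z.2 < M - m + 1 by move: wv; rewrite wE /G; lra.
  have dr : dot (z.1 - x0) (z.1 - x0) < r ^+ 2.
    by rewrite -(ltr_pM2l k0) kr; exact: le_lt_trans p1 pD.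
  have tr : `|z.2 - t0| < r.
    rewrite -(ltr_pXn2r (_ : 0 < 2)%N)// ?nnegrE ?(ltW r0)// real_normK ?num_real//.
    by rewrite -(ltr_pM2l k0) kr; exact: le_lt_trans p2 pD.
  have xr := dotr _ (ltW dr).
  have xyr : `|z.1 - y| < r.
    rewrite ltNge; apply/negP => xyr.
    have : r <= root4 (dot (z.1 - y) (z.1 - y)).
      apply: le_root4; first exact: ltW.
      apply: le_trans (sqr_norm_le_dot _); apply: (@le_trans _ _ (r ^+ 2)).
        by rewrite (exprM _ 2 2) [leLHS]expr2 ler_piMl ?sqr_ge0// expr_le1// ltW.
      by rewrite ler_pXn2r// nnegrE// ltW.
    move=> /(ler_wpM2l (ltW Lpen_gt0)) H.
    by have := Lpenr; lra.
  have yr : `|y - x0| < 2 * r.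
    rewrite -(subrKA z.1); apply: le_lt_trans (ler_normD _ _) _; rewrite distrC; lra.
  rewrite [z]surjective_pairing.
  apply: (@doubling_jet R n v w kpen r x0 z.1 y t0 z.2
     (Num.min (2 * r - `|y - x0|) (2 * r - `|z.2 - t0|)) k0 r0).
  + by rewrite lt_min !subr_gt0 yr h2.
  + apply/eqP => zy; move: wv; rewrite wE /G -zy -surjective_pairing.
    by have [? _ _ _] := pen_ge z.1 z.1 z.2; lra.
  + apply: le_trans (dot_le_sqr_norm _) _; apply: le_trans rn.
    have rr : `|z.1 - y| ^+ 2 <= r ^+ 2 by rewrite ler_pXn2r ?nnegrE// ltW.
    have N0 : (0 : R) <= n.+1%:R by rewrite ler0n.
    apply: le_trans (ler_wpM2l N0 rr) _; rewrite ler_wpM2r ?sqr_ge0//.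
    by rewrite ler_peMl// ler1n.
  + exact: ltW.
  + exact: ltW.
  + by rewrite -surjective_pairing wE.
  + move=> h h' s; rewrite !lt_min => /andP[hy _] _ /andP[_ hs].
    apply: (wmin (z.1 + h', z.2 + s) _).2 => /=.
      by rewrite addrAC; apply: le_trans (ler_normD _ _) _; lra.
    by rewrite /B/= addrAC; apply: le_trans (ler_normD _ _) _; lra.
  + by apply: v2; exact: boxOm By (ltW h2).
Qed.

End SpatialRegularisation.

(** * Regularity in time *)

Section TimeRegularity.
Context {R : realType} {n : nat}.
Local Notation V := 'rV[R]_n.+1.
Variables (Om : set (spacetime R n)) (f : spacetime R n -> R) (m M : R).
Hypotheses (oOm : open Om) (bOm : bounded_set Om).
Hypotheses (mf : forall z, boundary Om z -> m <= f z) (mM : m <= M).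
Variables (x0 : V) (t0 r : R).
Hypotheses (r0 : 0 < r).
Hypothesis boxOm : forall x t, `|x - x0| <= 2 * r -> `|t - t0| <= 2 * r -> Om (x, t).

Let k := kpen m M r.

(** [2 * A + 2 * k] is the second derivative of the paraboloids in every unit direction. The last
    summand makes the inequality strict and lets the barrier rise by [M - m + 1] within time
    [r / 2]. *)
Definition speed A : R := 2 * A + 2 * kpen m M r + (M - m + 1) * 2 / r.

Lemma paraboloidE sA sk B (y0 : V) c s0 (z z' : spacetime R n) :
  let be (z : spacetime R n) := c + sA * dot (z.1 - y0) (z.1 - y0)
     + sk * dot (z.1 - x0) (z.1 - x0) + B * (z.2 - s0) in
  be z' = be z + quad B ((2 * sA) *: (z.1 - y0) + (2 * sk) *: (z.1 - x0))
     (2 * sA + 2 * sk)%:M 0 (z'.1 - z.1) (z'.2 - z.2).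
Proof.
move=> be; rewrite /be /quad qf_scalar.
have e (w : V) : dot (z'.1 - w) (z'.1 - w) =
    dot (z.1 - w) (z.1 - w) + 2 * dot (z.1 - w) (z'.1 - z.1) + dot (z'.1 - z.1) (z'.1 - z.1).
  have {1 2}-> : z'.1 - w = (z.1 - w) + (z'.1 - z.1) by rewrite [RHS]addrC subrKA.
  by rewrite (dotDl _ (z'.1 - z.1)) !(dotDr _ (z'.1 - z.1)) (dotC (z'.1 - z.1) (z.1 - w)); ring.
by rewrite (e y0) (e x0) (dotDl (_ *: _)) !dotZl; field.
Qed.

Lemma continuous_paraboloid sA sk B (y0 : V) c s0 :
  continuous (fun z : spacetime R n => c + sA * dot (z.1 - y0) (z.1 - y0)
     + sk * dot (z.1 - x0) (z.1 - x0) + B * (z.2 - s0)).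
Proof.
move=> z.
have cc (a : R) : {for z, continuous (fun=> a : R)} by exact: cst_continuous.
have cd (a : R) (w : V) : {for z, continuous (fun z : spacetime R n => a * dot (z.1 - w) (z.1 - w))}.
  apply: (@continuousM _ _ (fun=> a) (fun z : spacetime R n => dot (z.1 - w) (z.1 - w))) => //.
  by apply: (@continuous_dot_sub R n _ (fun z : spacetime R n => z.1) (fun=> w)); [exact: cvg_fst|exact: cst_continuous].
apply: (@continuousD _ _ _ (fun z : spacetime R n => c + sA * dot (z.1 - y0) (z.1 - y0) + sk * dot (z.1 - x0) (z.1 - x0))
  (fun z : spacetime R n => B * (z.2 - s0))).
  apply: (@continuousD _ _ _ (fun z : spacetime R n => c + sA * dot (z.1 - y0) (z.1 - y0))
    (fun z : spacetime R n => sk * dot (z.1 - x0) (z.1 - x0))) => //.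
  exact: (@continuousD _ _ _ (fun=> c) (fun z : spacetime R n => sA * dot (z.1 - y0) (z.1 - y0))).
apply: (@continuousM _ _ (fun=> B) (fun z : spacetime R n => z.2 - s0)) => //.
by apply: (@continuousB _ _ _ (fun z : spacetime R n => z.2) (fun=> s0)); [exact: cvg_snd|exact: cst_continuous].
Qed.

Lemma near_time_gt s (z : spacetime R n) : s < z.2 -> \forall y \near z, s < y.2.
Proof.
move=> sz; apply/(st_nearP z); exists (z.2 - s); first by rewrite subr_gt0.
by move=> x t _ /=; rewrite ltr_norml => /andP[? _]; lra.
Qed.

Lemma near_time_lt s (z : spacetime R n) : z.2 < s -> \forall y \near z, y.2 < s.
Proof.
move=> sz; apply/(st_nearP z); exists (s - z.2); first by rewrite subr_gt0.
by move=> x t _ /=; rewrite ltr_norml => /andP[_ ?]; lra.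
Qed.

Lemma k_gt0 : 0 < k. Proof. exact: kpen_gt0. Qed.

Lemma speed_gt A : 2 * A + 2 * k < speed A.
Proof. by rewrite /speed ltrDl divr_gt0// mulr_gt0//; move: mM; lra. Qed.

Lemma speed_far A s : 0 <= A -> r / 2 <= s -> M - m + 1 <= speed A * s.
Proof.
move=> A0 rs; have k0 := k_gt0.
have e : speed A * (r / 2) = (2 * A + 2 * k) * (r / 2) + (M - m + 1).
  by rewrite /speed -/k; field; rewrite gt_eqF.
have B0 : 0 <= speed A by apply: le_trans (ltW (speed_gt A)); lra.
apply: (le_trans _ (ler_wpM2l B0 rs)); rewrite e lerDr mulr_ge0//; [lra|].
by rewrite divr_ge0// ltW.
Qed.

Lemma kfar (x : V) : r ^+ 2 <= dot (x - x0) (x - x0) -> M - m + 1 <= k * dot (x - x0) (x - x0).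
Proof. by move=> H; rewrite -(kpenr m M r0) ler_pM2l// k_gt0. Qed.

Lemma sup_norm_le (x : V) : dot (x - x0) (x - x0) <= r ^+ 2 -> `|x - x0| <= r.
Proof.
move=> H; rewrite -(ler_pXn2r (_ : 0 < 2)%N)// ?nnegrE ?(ltW r0)//.
exact: le_trans (sqr_norm_le_dot _) H.
Qed.

(* Barrier from above, glued in for times after [s0]. *)
Lemma forward_regularisation v c A (y0 : V) s0 : real_upper Om f M v ->
  `|s0 - t0| <= r / 2 -> 0 <= A -> m <= c ->
  (forall x, `|x - x0| < 2 * r ->
     v (x, s0) <= c + A * dot (x - y0) (x - y0) + k * dot (x - x0) (x - x0)) ->
  exists v', [/\ real_upper Om f M v', forall z, v' z <= v z &
    forall x t, `|x - x0| < 2 * r -> `|t - t0| < 2 * r -> s0 < t ->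
      v' (x, t) <= c + A * dot (x - y0) (x - y0) + k * dot (x - x0) (x - x0)
        + speed A * (t - s0)].
Proof.
move=> Uv s0r A0 mc Hs; have [v1 v2 v3 v4] := Uv; have k0 := k_gt0.
pose be (z : spacetime R n) := c + A * dot (z.1 - y0) (z.1 - y0)
     + k * dot (z.1 - x0) (z.1 - x0) + speed A * (z.2 - s0).
(* Keeping [v] up to time [s0] avoids any condition at the initial slice: [b] is below [v] strictly
   only after [s0], where it is the smooth paraboloid. *)
pose b z := if z.2 <= s0 then v z else be z.
pose N : set (spacetime R n) := ball (x0, t0) (2 * r).
pose C : set (spacetime R n) := [set z | dot (z.1 - x0) (z.1 - x0) <= r ^+ 2 /\ `|z.2 - t0| <= r].
have r20 : 0 < 2 * r by rewrite mulr_gt0.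
have NP z : N z -> `|z.1 - x0| < 2 * r /\ `|z.2 - t0| < 2 * r by move=> /st_ballE.
have NOm z : N z -> Om z.
  by move=> /NP[h1 h2]; rewrite [z]surjective_pairing; apply: boxOm; exact: ltW.
have oN : open N by exact: ball_open.
exists (glue v b N); split; last 2 first.
- by move=> z; exact: glue_le.
- move=> x t xr tr st; apply: le_trans (glue_le_in _ _ _) _; first exact/st_ballE.
  by rewrite /b /= (leNgt t) st.
apply: (@real_upper_glue _ _ Om f M oOm v b N C Uv oN) => //.
- rewrite (_ : C = (fun z : spacetime R n => dot (z.1 - x0) (z.1 - x0)) @^-1` [set s | s <= r ^+ 2]
     `&` (fun z : spacetime R n => `|z.2 - t0|) @^-1` [set s | s <= r])//.
  apply: closedI; (apply: preimage_closed; last exact: closed_le) => z _.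
    apply: (@continuous_dot_sub _ _ _ (fun z : spacetime R n => z.1) (fun=> x0)); [exact: cvg_fst|exact: cst_continuous].
  apply: (@continuous_comp _ _ _ (fun z : spacetime R n => z.2 - t0) (fun s : R => `|s|)); last exact: norm_continuous.
  by apply: (@continuousB _ _ _ (fun z : spacetime R n => z.2) (fun=> t0)); [exact: cvg_snd|exact: cst_continuous].
- by move=> z [/sup_norm_le h1 h2]; apply/st_ballE => /=; split; lra.
- move=> z Nz nC; rewrite /b; case: (leP z.2 s0) => // st; have [h1 h2] := NP z Nz.
  apply: (le_trans (v3 z (NOm z Nz))).
  have d1 := dot_ge0 (z.1 - y0); have d2 := dot_ge0 (z.1 - x0).
  have B0 : 0 <= speed A by apply: le_trans (ltW (speed_gt A)); lra.
  have st0 : 0 <= z.2 - s0 by rewrite subr_ge0 ltW.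
  have p1 := mulr_ge0 A0 d1; have p2 := mulr_ge0 (ltW k0) d2; have p3 := mulr_ge0 B0 st0.
  have [hd|/ltW hd] := leP (dot (z.1 - x0) (z.1 - x0)) (r ^+ 2); last first.
    by have := kfar hd; rewrite /be; lra.
  (* Here the time is more than [r] away from [t0] and later than [s0], which is within [r / 2] of
     [t0]. *)
  have ht : r / 2 <= z.2 - s0.
    have zr : r < `|z.2 - t0| by rewrite ltNge; apply/negP => zr; apply: nC.
    move: zr s0r; rewrite ler_norml; case: (leP 0 (z.2 - t0)) => h /=.
      by rewrite ger0_norm// => ? /andP[? ?]; lra.
    by rewrite ltr0_norm// => ? /andP[? ?]; lra.
  by have := speed_far A0 ht; rewrite /be; lra.
- move=> z Nz; have [h1 h2] := NP z Nz.
  have cbe : {for z, continuous be} by exact: continuous_paraboloid.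
  have [zs|sz] := leP z.2 s0; last first.
    apply: (@near_eq_lsc_at _ _ be); last exact: lsc_at_continuous.
    have H := near_time_gt sz.
    by apply: filterS H => y sy; rewrite /b (leNgt y.2) sy.
  have bz : b z = v z by rewrite /b zs.
  move=> e e0; rewrite bz.
  have L1 := v1 z (NOm z Nz) e e0; have L2 := lsc_at_continuous cbe e0.
  case: (ltgtP z.2 s0) zs => // [zs|zs] _.
    have H := near_time_lt zs.
    by apply: filterS2 H L1 => y sy; rewrite /b ltW.
  have vb : v z <= be z.
    by have := Hs z.1 h1; rewrite -zs -surjective_pairing /be zs subrr mulr0 addr0.
  apply: filterS2 L1 L2 => y; rewrite /b; case: (leP y.2 s0) => // _ _.
  by apply: le_lt_trans; rewrite lerD2r.
- move=> z Nz bv; have [h1 h2] := NP z Nz.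
  have sz : s0 < z.2 by rewrite ltNge; apply/negP => sz; move: bv; rewrite /b sz ltxx.
  apply: (@jet_super_smooth _ _ b z (speed A) ((2 * A) *: (z.1 - y0) + (2 * k) *: (z.1 - x0))
     (2 * A + 2 * k)%:M 0).
    by move=> e es _; rewrite qf_scalar (_ : dot e e = 1)// mulr1 ltW// speed_gt.
  have H := near_time_gt sz.
  apply: filterS H => y sy; rewrite /b (leNgt y.2) (leNgt z.2) sy sz /=.
  have E : be y = be z + quad (speed A) ((2 * A) *: (z.1 - y0) + (2 * k) *: (z.1 - x0))
     (2 * A + 2 * k)%:M 0 (y.1 - z.1) (y.2 - z.2) by exact: paraboloidE.
  by rewrite E.
Qed.

(* Comparison with a strict subsolution issued from time [t1]. *)
Lemma backward_bound v c A (x1 : V) t1 : real_upper Om f M v ->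
  `|t1 - t0| <= r / 2 -> 0 <= A -> c <= M ->
  (forall y, `|y - x0| <= 2 * r -> c - A * dot (y - x1) (y - x1) <= v (y, t1)) ->
  forall y s, `|y - x0| <= 2 * r -> t1 <= s -> s <= t0 + 2 * r ->
    c - A * dot (y - x1) (y - x1) - k * dot (y - x0) (y - x0) - speed A * (s - t1) <= v (y, s).
Proof.
move=> Uv t1r A0 cM Ht y s yr ts st; have [v1 v2 v3 v4] := Uv; have k0 := k_gt0.
have vm := real_upper_ge oOm bOm mf Uv.
have B0 : 0 <= speed A by apply: le_trans (ltW (speed_gt A)); lra.
pose be (z : spacetime R n) := - c + A * dot (z.1 - x1) (z.1 - x1)
     + k * dot (z.1 - x0) (z.1 - x0) + speed A * (z.2 - t1).
pose Q : set (spacetime R n) := [set z | `|z.1 - x0| <= 2 * r /\ t1 <= z.2 <= t0 + 2 * r].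
have QOm z : Q z -> Om z.
  move=> [h1 /andP[h2 h3]]; rewrite [z]surjective_pairing; apply: boxOm => //.
  by move: t1r; rewrite !ler_norml => /andP[? ?]; apply/andP; split; lra.
have Qy : Q (y, s) by split => //=; rewrite ts st.
have [|z Qz|z Qz Hmin] := @lsc_compact_min R _ (fun z => v z + be z) Q (@compact_cylinder _ _ x0 (2 * r) t1 (t0 + 2 * r)).
- by exists (y, s).
- apply: (@lsc_atD _ _ v be); first exact: v1 (QOm z Qz).
  by apply: lsc_at_continuous; exact: continuous_paraboloid.
suff F0 : 0 <= v z + be z by have := Hmin _ Qy; rewrite /be/=; rewrite /be in F0; lra.
(* A negative minimum cannot lie at time [t1] by the hypothesis on that slice, nor far from [x0] or
   later than [t1 + r / 2], where the barrier exceeds the oscillation. It is an interior minimum, at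
   which the time slope [- speed A] contradicts the equation. *)
rewrite leNgt; apply/negP => F0.
have [h1 /andP[h2 h3]] := Qz; have mz := vm z (QOm z Qz).
have d1 := dot_ge0 (z.1 - x1); have d2 := dot_ge0 (z.1 - x0).
have st0 : 0 <= z.2 - t1 by rewrite subr_ge0.
have p1 := mulr_ge0 A0 d1; have p2 := mulr_ge0 (ltW k0) d2; have p3 := mulr_ge0 B0 st0.
have zt : t1 < z.2.
  rewrite lt_neqAle h2 andbT; apply/eqP => zt.
  by have := Ht z.1 h1; rewrite zt -surjective_pairing; move: F0; rewrite /be; lra.
have zd : dot (z.1 - x0) (z.1 - x0) < r ^+ 2.
  by rewrite ltNge; apply/negP => /kfar; move: F0; rewrite /be; lra.
have zr := sup_norm_le (ltW zd).
have zs : z.2 - t1 < r / 2.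
  rewrite ltNge; apply/negP => zs; have := speed_far A0 zs.
  by move: F0; rewrite /be; lra.
have [e [es _]] : par_super (- speed A) (- ((2 * A) *: (z.1 - x1) + (2 * k) *: (z.1 - x0)))
    (- (2 * A + 2 * k)%:M).
  apply: (v2 z (QOm z Qz)); exists 0; apply/st_nearP.
  have t1t : t1 - t0 <= r / 2 by move: t1r; rewrite ler_norml => /andP[].
  exists (Num.min (r / 2) (z.2 - t1)); first by rewrite lt_min divr_gt0// subr_gt0.
  move=> x' t'; rewrite !lt_min => /andP[hx _] /andP[]; rewrite !ltr_norml => /andP[a1 a2] /andP[a3 a4].
  have Q' : Q (x', t').
    split => /=; last by move: (r0) t1t zs a2 a3; clear - oOm bOm mf mM boxOm r0 k => *; apply/andP; split; lra.
    rewrite -(subrKA z.1); apply: le_trans (ler_normD _ _) _.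
    by move: (r0) hx zr; clear - oOm bOm mf mM boxOm r0 k; lra.
  have E : be (x', t') = be z + quad (speed A) ((2 * A) *: (z.1 - x1) + (2 * k) *: (z.1 - x0))
     (2 * A + 2 * k)%:M 0 (x' - z.1) (t' - z.2) by exact: paraboloidE.
  by have := Hmin _ Q'; rewrite E /quad dotNl qfNl /=; clear - oOm bOm mf mM boxOm r0 k; lra.
rewrite qfNl qf_scalar (_ : dot e e = 1)// mulr1 lerN2 leNgt.
by rewrite speed_gt.
Qed.

End TimeRegularity.

(** * The Perron infimum *)

Section PerronInfimum.
Context {R : realType} {n : nat}.
Local Notation V := 'rV[R]_n.+1.
Variables (Om : set (spacetime R n)) (f : spacetime R n -> R) (m M : R).
Hypotheses (oOm : open Om) (bOm : bounded_set Om).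
Hypotheses (mf : forall z, boundary Om z -> m <= f z) (mM : m <= M).
Hypothesis fM : forall z, boundary Om z -> f z <= M.

Local Notation U := (real_upper Om f M).

(** Applied to a squared distance, this replaces the square-root modulus by a paraboloid at an
    arbitrarily small cost, so that the barriers in time apply. *)
Lemma root4_le_affine (e s : R) : 0 < e -> 0 <= s -> root4 s <= e + e ^- 3 * s.
Proof.
move=> e0 s0; have i0 : 0 <= e ^- 3 * s by rewrite mulr_ge0// invr_ge0 exprn_ge0// ltW.
have [h|h] := leP (root4 s) e; first by lra.
apply: (@le_trans _ _ (e ^- 3 * s)); last by lra.
rewrite -[X in _ * X](root4X s0) ler_pdivlMl ?exprn_gt0// [leRHS]exprSr.
by rewrite ler_wpM2r ?root4_ge0// ler_pXn2r// ?nnegrE ?root4_ge0// ltW.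
Qed.

Lemma dist_sum_le (x y w : V) (d : R) : `|x - w| <= d -> `|y - w| <= d -> `|x - y| <= 2 * d.
Proof. by move=> h1 h2; rewrite -(subrKA w); apply: le_trans (ler_normD _ _) _; rewrite (distrC w); lra. Qed.

Lemma dot_small (x : V) (d : R) : d <= 1 -> `|x| <= 2 * d -> dot x x <= 4 * n.+1%:R * d.
Proof.
move=> d1 xd; have x0 := normr_ge0 x; have N0 : (0 : R) <= n.+1%:R by [].
apply: le_trans (dot_le_sqr_norm x) _.
have : `|x| ^+ 2 <= 4 * d by nra.
by move=> /(ler_wpM2l N0); lra.
Qed.

Lemma time_diff_le (s t w d : R) : `|s - w| <= d -> `|t - w| <= d -> s - t <= 2 * d.
Proof. by rewrite !ler_norml => /andP[? ?] /andP[? ?]; lra. Qed.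

(** One-sided equicontinuity up to a change of function: [N] is independent of [v] and of [z'],
    while [v'] may depend on both. An infimum over the class needs no more. *)
Lemma equi_upper z0 e : Om z0 -> 0 < e ->
  exists2 N, nbhs z0 N & forall v, U v -> forall z', N z' ->
    exists2 v', U v' & forall z, N z -> v' z <= v z' + e.
Proof.
move=> Oz0 e0.
have [d d0 Hd] := (st_nearP _ _).1 (near_open oOm Oz0).
set x0 := z0.1 in Hd; set t0 := z0.2 in Hd.
have N0 : (0 : R) < n.+1%:R by rewrite ltr0n.
(* [d / 3] keeps the closed box of radius [2 * r] inside [Om]; the last entry, with [r <= 1], gives
   the bound on [r ^+ 2] that keeps Euclidean distances below 1. *)
pose r := Num.min (d / 3) (Num.min 1 (1 / (9 * n.+1%:R))).
have r0 : 0 < r by rewrite !lt_min !divr_gt0 ?ltr01 ?mulr_gt0.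
have [rd r1 rn'] : [/\ r <= d / 3, r <= 1 & r <= 1 / (9 * n.+1%:R)].
  by rewrite !ge_min !lexx !orbT.
have rn : 9 * n.+1%:R * r ^+ 2 <= 1.
  move: rn'; rewrite ler_pdivlMr ?mulr_gt0// => rn'.
  have : r ^+ 2 <= r by rewrite expr2 ler_piMl// ltW.
  have N9 : 0 <= 9 * n.+1%:R :> R by rewrite mulr_ge0.
  by move=> /(ler_wpM2l N9); lra.
have boxOm x t : `|x - x0| <= 2 * r -> `|t - t0| <= 2 * r -> Om (x, t).
  by move=> h1 h2; apply: Hd; [apply: le_lt_trans h1 _|apply: le_lt_trans h2 _]; lra.
have [k kE] : exists k, k = kpen m M r by eexists.
have k0 : 0 < k by rewrite kE; exact: kpen_gt0.
have [L LE] : exists L, L = Lpen m M r by eexists.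
have L0 : 0 < L by rewrite LE; exact: Lpen_gt0.
pose e1 := e / (8 * L).
have e10 : 0 < e1 by rewrite divr_gt0// mulr_gt0.
have [A [A0 HA]] : exists A, 0 <= A /\ forall s, 0 <= s -> L * root4 s <= e / 8 + A * s.
  exists (L * e1 ^- 3); split; first by rewrite mulr_ge0 ?invr_ge0 ?exprn_ge0// ltW.
  move=> s s0; apply: le_trans (ler_wpM2l (ltW L0) (root4_le_affine e10 s0)) _.
  have Le1 : L * e1 = e / 8 by rewrite /e1; field; rewrite gt_eqF.
  by rewrite mulrDr Le1 mulrA.
have [B [BE B0]] : exists B, B = speed m M r A /\ 0 < B.
  exists (speed m M r A); split => //; apply: lt_trans (speed_gt mM r0 A).
  by rewrite -kE; lra.
(* The sum of the coefficients of [rho] in the error terms; [rho] is then chosen so that together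
   they cost at most [e / 8]. *)
pose S := 4 * A * n.+1%:R + 8 * k * n.+1%:R + k + 2 * B.
have S0 : 0 <= S.
  by rewrite !addr_ge0 ?mulr_ge0// ?ltW.
pose rho := Num.min (r / 2) (e / (8 * (S + 1))).
have S10 : 0 < 8 * (S + 1) by lra.
have rho0 : 0 < rho by rewrite lt_min !divr_gt0.
have [rhor rhoe] : rho <= r / 2 /\ rho <= e / (8 * (S + 1)) by rewrite !ge_min !lexx orbT.
have rho1 : rho <= 1 by lra.
have Srho : S * rho <= e / 8.
  move: rhoe; rewrite ler_pdivlMr// => rhoe; have := mulr_ge0 S0 (ltW rho0); lra.
have Arho (x y : V) : `|x - x0| <= rho -> `|y - x0| <= rho ->
    A * dot (x - y) (x - y) <= 4 * A * n.+1%:R * rho.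
  move=> h1 h2; have := ler_wpM2l A0 (dot_small rho1 (dist_sum_le h1 h2)); lra.
have krho (x : V) : `|x - x0| <= rho -> k * dot (x - x0) (x - x0) <= 4 * k * n.+1%:R * rho.
  move=> h1; have h2 : `|x - x0| <= 2 * rho by lra.
  have := ler_wpM2l (ltW k0) (dot_small rho1 h2); lra.
have kt (t : R) : `|t - t0| <= rho -> k * (t - t0) ^+ 2 <= k * rho.
  move=> h1; rewrite ler_pM2l// -real_normK ?num_real//.
  by have := normr_ge0 (t - t0); nra.
have B1 := ltW B0; have k1 := ltW k0.
have p1 : 0 <= 4 * A * n.+1%:R * rho by rewrite !mulr_ge0// ltW.
have p2 : 0 <= 4 * k * n.+1%:R * rho by rewrite !mulr_ge0// ltW.
have p3 : 0 <= k * rho by rewrite !mulr_ge0// ltW.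
have p4 : 0 <= B * rho by rewrite !mulr_ge0// ltW.
have SE : S * rho = 4 * A * n.+1%:R * rho + 2 * (4 * k * n.+1%:R * rho) + k * rho + 2 * (B * rho).
  by rewrite /S; ring.
have [q1 q2] : rho < 2 * r /\ rho <= 2 * r by split; lra.
have lt2 (a : R) : a <= rho -> a < 2 * r by move=> /le_lt_trans; apply.
have le2 (a : R) : a <= rho -> a <= 2 * r by move=> /le_trans; apply.
have Bt (s t : R) : `|s - t0| <= rho -> `|t - t0| <= rho -> B * (s - t) <= B * (2 * rho).
  by move=> sr tr; rewrite ler_pM2l//; exact: time_diff_le sr tr.
exists [set z | `|z.1 - x0| <= rho /\ `|z.2 - t0| <= rho].
  by apply/st_nearP; exists rho => // x t /ltW h1 /ltW h2.
move=> v Uv [y0 s0] [/= y0r s0r]; have [v1 v2 v3 v4] := Uv.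
have [w [Uw wv Hw]] := spatial_regularisation oOm bOm mf mM r0 r1 rn boxOm Uv.
rewrite -kE -LE in Hw.
have vm := real_upper_ge oOm bOm mf Uv.
have Oy0 : Om (y0, s0) by apply: boxOm; exact: le2.
pose c := v (y0, s0) + e / 8 + k * (s0 - t0) ^+ 2.
have [|x xr|v' [Uv' v'w Hv']] := @forward_regularisation R n Om f m M oOm mM x0 t0 r r0 boxOm
    w c A y0 s0 Uw (le_trans s0r rhor) A0.
- have := vm _ Oy0; have := mulr_ge0 k1 (sqr_ge0 (s0 - t0)); rewrite /c.
  by move: e0; clear - oOm bOm mf mM fM; lra.
- rewrite -kE; have := Hw x y0 s0 xr (le2 _ y0r) (lt2 _ s0r).
  have := HA _ (dot_ge0 (x - y0)); rewrite /pen /c; clear - oOm bOm mf mM fM; lra.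
rewrite -kE -BE in Hv'.
have k4 := krho _ y0r.
exists v' => // -[x t] [/= xr tr].
(* After [s0] the forward barrier started from [(y0, s0)] bounds [v']. Up to [s0], the spatial
   modulus bounds [v] at time [t] from below by a paraboloid with top near [w (x, t)], and
   [backward_bound] carries this bound up to [(y0, s0)]. *)
have [ts|st] := leP t s0; last first.
  have := Hv' x t (lt2 _ xr) (lt2 _ tr) st; have := Arho x y0 xr y0r.
  have := krho x xr; have := kt s0 s0r; have := Bt t s0 tr s0r.
  rewrite /c; move: SE Srho p1 p2 p3 p4 e0; clear - oOm bOm mf mM fM; lra.
apply: le_trans (v'w _) _.
pose c' := w (x, t) - e / 8 - k * dot (x - x0) (x - x0) - k * (t - t0) ^+ 2.
have c'M : c' <= M.
  have Ox : Om (x, t) by apply: boxOm; exact: le2.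
  have [_ _ /(_ _ Ox) wM _] := Uw.
  have := mulr_ge0 k1 (dot_ge0 (x - x0)); have := mulr_ge0 k1 (sqr_ge0 (t - t0)).
  by rewrite /c'; move: wM e0; clear - oOm bOm mf mM fM; lra.
have Hc' y : `|y - x0| <= 2 * r -> c' - A * dot (y - x) (y - x) <= v (y, t).
  move=> yr; have := Hw x y t (lt2 _ xr) yr (lt2 _ tr); have := HA _ (dot_ge0 (x - y)).
  have -> : dot (y - x) (y - x) = dot (x - y) (x - y) by rewrite -opprB dotNl dotNr opprK.
  by rewrite /pen /c'; clear - oOm bOm mf mM fM; lra.
have s2 : s0 <= t0 + 2 * r.
  by move: (le2 _ s0r); rewrite ler_norml; clear - oOm bOm mf mM fM r => /andP[_ ?]; lra.
have := @backward_bound R n Om f m M oOm bOm mf mM x0 t0 r r0 boxOm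
    v c' A x t Uv (le_trans tr rhor) A0 c'M Hc' y0 s0 (le2 _ y0r) ts s2.
rewrite -kE -BE.
have := Arho y0 x y0r xr; have := krho x xr; have := kt t tr; have := Bt s0 t s0r tr.
rewrite /c'; move: SE Srho k4 p1 p2 p3 p4 e0; clear - oOm bOm mf mM fM; lra.
Qed.

Definition perron z : R := inf [set v z | v in U].

Lemma perron_le v z : Om z -> U v -> perron z <= v z.
Proof.
move=> Oz Uv; apply: ge_inf; last by exists v.
by exists m => _ [w Uw <-]; exact: (real_upper_ge oOm bOm mf Uw Oz).
Qed.

Lemma perron_approx z e : Om z -> 0 < e -> exists2 v, U v & v z < perron z + e.
Proof.
move=> Oz e0.
have [|_ [v Uv <-] vz] := @inf_adherent _ [set v z | v in U] e e0.
- split; first by exists M; exists (fun=> M) => //; exact: real_upper_cst.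
  by exists m => _ [w Uw <-]; exact: (real_upper_ge oOm bOm mf Uw Oz).
by exists v.
Qed.

(** Both inequalities come from the same one-sided estimate, with the almost optimal member chosen
    at [z0] for the first and at [z] for the second. *)
Lemma perron_near z0 e : Om z0 -> 0 < e ->
  \forall z \near z0, perron z <= perron z0 + e /\ perron z0 <= perron z + e.
Proof.
move=> Oz0 e0; have e2 : 0 < e / 2 by rewrite divr_gt0.
have [N N0 HN] := equi_upper Oz0 e2.
have N1 := nbhs_singleton N0; apply: filterS2 (near_open oOm Oz0) N0 => z Oz Nz; split.
  have [v Uv vz] := perron_approx Oz0 e2.
  have [v' Uv' /(_ z Nz) H] := HN v Uv z0 N1.
  by have := perron_le Oz Uv'; lra.
have [v Uv vz] := perron_approx Oz e2.
have [v' Uv' /(_ z0 N1) H] := HN v Uv z Nz.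
by have := perron_le Oz0 Uv'; lra.
Qed.

Lemma perron_lsc z : Om z -> lsc_at perron z.
Proof.
move=> Oz e e0; have e2 : 0 < e / 2 by rewrite divr_gt0.
by apply: filterS (perron_near Oz e2) => y [_]; lra.
Qed.

Lemma perron_usc z : Om z -> lsc_at (fun y => - perron y) z.
Proof.
move=> Oz e e0; have e2 : 0 < e / 2 by rewrite divr_gt0.
by apply: filterS (perron_near Oz e2) => y [+ _]; lra.
Qed.

Lemma perron_uniform_approx Q e : compact Q -> Q `<=` Om -> 0 < e ->
  exists2 v, U v & forall z, Q z -> v z <= perron z + e.
Proof.
move=> cQ QO e0; have e3 : 0 < e / 3 by rewrite divr_gt0.
(* The class directed downwards: since it is stable under minima, the members lying below a given
   one form a filter base, and compactness of [Q] selects a single member from the local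
   approximations. *)
pose F := filter_from U (fun v0 => [set v | U v /\ forall z, v z <= v0 z]).
have FF : Filter F.
  apply: filter_from_filter; first by exists (fun=> M); exact: real_upper_cst.
  move=> v w Uv Uw; exists (fun z => Num.min (v z) (w z)); first exact: real_upper_min.
  by move=> u [Uu le]; split; split => // z; have := le z; rewrite le_min => /andP[].
have [z Qz|v0 Uv0 H] := (iffLR (compact_near_coveringP Q)) cQ _ F (fun v z => v z <= perron z + e) FF.
  have Oz := QO z Qz.
  have [N Nz HN] := equi_upper Oz e3.
  have [v Uv vz] := perron_approx Oz e3.
  have [v' Uv' Hv'] := HN v Uv z (nbhs_singleton Nz).
  have Nh := perron_near Oz e3.
  exists (N `&` [set y | perron y <= perron z + e / 3 /\ perron z <= perron y + e / 3],
          [set w | U w /\ forall z, w z <= v' z]) => /=.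
    by split; [exact: filterI Nz Nh|exists v'].
  by move=> [y w] /= [[Ny [_ h2]] [_ le]]; have := le y; have := Hv' y Ny; lra.
by exists v0 => // z Qz; exact: (H v0 (conj Uv0 (fun z => lexx _)) z Qz).
Qed.

Lemma quad_shift a p X K (h1 h : V) s1 s :
  quad a p X K (h1 + h) (s1 + s) = quad a p X K h1 s1 +
    quad (a - 2 * K * s1) (p + 2^-1 *: (h1 *m (X + X^T))) X K h s.
Proof. by rewrite /quad qfD dotDr dotDl dotZl; ring. Qed.

(** Lowering [X] and raising [K] makes the contact of a jet strict. Contact then occurs at a nearby
    point, and the quadratic re-expanded there stays within the tolerance [kap] of
    [par_super_closed]. *)
Lemma shift_close a p (X : 'M[R]_n.+1) K kap : 0 < kap ->
  let X1 := X - kap%:M in let K1 := K + kap / 2 in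
  exists2 rho, 0 < rho & forall (h1 : V) (s1 : R), `|h1| <= rho -> `|s1| <= rho ->
    [/\ a - 2 * K1 * s1 <= a + kap,
        dot (p - (p + 2^-1 *: (h1 *m (X1 + X1^T)))) (p - (p + 2^-1 *: (h1 *m (X1 + X1^T)))) <= kap &
        forall e, sphere e -> qf X e <= qf X1 e + kap].
Proof.
move=> k0 X1 K1; pose Y := 2^-1 *: (X1 + X1^T).
have [C C0 HC] := @qf_abs_le R n (Y *m Y^T).
have D1 : 0 < 2 * `|K1| + 1 by have := normr_ge0 K1; lra.
have D2 : 0 < C + 1 by lra.
pose rho := Num.min 1 (Num.min (kap / (2 * `|K1| + 1)) (kap / (C + 1))).
have rho0 : 0 < rho by rewrite !lt_min ltr01 !divr_gt0.
exists rho => // h1 s1; rewrite !le_min => /andP[h11 /andP[_]] + /andP[_ /andP[+ _]].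
rewrite !ler_pdivlMr// => hk sk; split.
- have : `|2 * K1 * s1| <= kap.
    rewrite !normrM (ger0_norm (_ : 0 <= 2))//; have := normr_ge0 s1; lra.
  by rewrite ler_norml => /andP[? ?]; lra.
- rewrite opprD addNKr dotNl dotNr opprK scalemxAr -/Y.
  have -> : dot (h1 *m Y) (h1 *m Y) = qf (Y *m Y^T) h1 by rewrite qfE mulmxA [RHS]dot_trmx trmxK.
  apply: (le_trans (ler_norm _)); apply: (le_trans (HC h1)).
  have h0 := normr_ge0 h1.
  have : C * `|h1| ^+ 2 <= C * `|h1| by rewrite ler_wpM2l// expr2 ler_piMl.
  lra.
- by move=> e es; rewrite /X1 qfDl qfNl qf_scalar (_ : dot e e = 1)//; lra.
Qed.

Lemma quad_perturb a p X K kap (h : V) s :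
  quad a p (X - kap%:M) (K + kap / 2) h s = quad a p X K h s - kap / 2 * (dot h h + s ^+ 2).
Proof. by rewrite /quad qfDl qfNl qf_scalar; field. Qed.

Lemma box_in_Om z0 (P : set (spacetime R n)) rho : Om z0 -> nbhs z0 P -> 0 < rho ->
  exists2 r, 0 < r <= rho & forall z, `|z.1 - z0.1| <= r -> `|z.2 - z0.2| <= r -> Om z /\ P z.
Proof.
move=> Oz0 nP rho0; have [d d0 Hd] := (st_nearP _ _).1 (filterI (near_open oOm Oz0) nP).
exists (Num.min (d / 2) rho); first by rewrite lt_min rho0 divr_gt0//= ge_min lexx orbT.
move=> [x t] /=; rewrite !le_min => /andP[h1 _] /andP[h2 _].
by apply: Hd; lra.
Qed.

Lemma compact_box (z0 : spacetime R n) r :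
  compact [set z : spacetime R n | `|z.1 - z0.1| <= r /\ `|z.2 - z0.2| <= r].
Proof.
rewrite (_ : mkset _ = [set z | `|z.1 - z0.1| <= r /\ z0.2 - r <= z.2 <= z0.2 + r]).
  exact: compact_cylinder.
by apply/seteqP; split => z /= [h1 h2]; split => //; move: h2; rewrite ler_distl.
Qed.

Lemma continuous_quad a p X K (z0 : spacetime R n) (c : R) :
  continuous (fun z : spacetime R n => c + quad a p X K (z.1 - z0.1) (z.2 - z0.2)).
Proof.
have [E HE] := jet_test_function z0 c a p X K 0.
rewrite (_ : (fun _ => _) = peval E); first exact: continuous_peval.
by apply/funext => z; rewrite HE mul0r subr0.
Qed.

Lemma quad0 a p X K : quad a p X K (0 : V) 0 = 0.
Proof. by rewrite /quad qfE mul0mx !dot0r expr0n /= !mulr0; ring. Qed.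

(** Closeness at the single point [z0] suffices: a member [v] lies above [perron] everywhere and
    almost meets it at [z0], so the strict jet of [perron], slid upwards, touches [v] near [z0]. *)
Lemma perron_super z0 : Om z0 -> jet_super perron z0.
Proof.
move=> Oz0 a p X [K HK]; apply: par_super_closed => kap k0.
have [rho rho0 Hrho] := shift_close a p X K k0.
have [r /andP[r0 rrho] Hr] := box_in_Om Oz0 HK rho0.
set X1 := X - kap%:M in Hrho; set K1 := K + kap / 2 in Hrho.
pose P (z : spacetime R n) := quad a p X1 K1 (z.1 - z0.1) (z.2 - z0.2).
pose Q : set (spacetime R n) := [set z | `|z.1 - z0.1| <= r /\ `|z.2 - z0.2| <= r].
(* The strictness gained at Euclidean distance [r]; an error below it at [z0] forces the contact
   point into the interior of [Q]. *)
pose eta := kap / 2 * r ^+ 2.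
have eta0 : 0 < eta by rewrite mulr_gt0 ?divr_gt0// exprn_gt0.
have [v Uv vz0] := perron_approx Oz0 eta0; have [v1 v2 _ _] := Uv.
have Qz0 : Q z0 by rewrite /Q/= !subrr !normr0 ltW.
have [|z Qz|z [zx zt] Hmin] := @lsc_compact_min R _ (fun z => v z + (0 + quad (- a) (- p) (- X1) (- K1) (z.1 - z0.1) (z.2 - z0.2))) Q (@compact_box z0 r).
- by exists z0.
- apply: (@lsc_atD _ _ v (fun z => 0 + quad (- a) (- p) (- X1) (- K1) (z.1 - z0.1) (z.2 - z0.2))).
    by apply: v1; exact: (Hr z Qz.1 Qz.2).1.
  by apply: lsc_at_continuous; exact: continuous_quad.
have NP y : 0 + quad (- a) (- p) (- X1) (- K1) (y.1 - z0.1) (y.2 - z0.2) = - P y.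
  by rewrite /P /quad dotNl qfNl; ring.
have [Oz Hz] := Hr z zx zt.
have Hz0 := Hmin z0 Qz0; rewrite !NP in Hz0.
have P0 : P z0 = 0 by rewrite /P !subrr quad0.
have PE y : P y = quad a p X K (y.1 - z0.1) (y.2 - z0.2)
    - kap / 2 * (dot (y.1 - z0.1) (y.1 - z0.1) + (y.2 - z0.2) ^+ 2) by exact: quad_perturb.
have small : dot (z.1 - z0.1) (z.1 - z0.1) + (z.2 - z0.2) ^+ 2 < r ^+ 2.
  have k2 : 0 < kap / 2 by rewrite divr_gt0.
  rewrite -(ltr_pM2l k2) -/eta.
  have := perron_le Oz Uv; move: Hz0 Hz; rewrite P0 PE; lra.
have d0 := dot_ge0 (z.1 - z0.1); have t20 := sqr_ge0 (z.2 - z0.2).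
have zxr : `|z.1 - z0.1| < r.
  rewrite -(ltr_pXn2r (_ : 0 < 2)%N)// ?nnegrE ?(ltW r0)//.
  by apply: le_lt_trans (sqr_norm_le_dot _) _; lra.
have ztr : `|z.2 - z0.2| < r.
  by rewrite -(ltr_pXn2r (_ : 0 < 2)%N)// ?nnegrE ?(ltW r0)// real_normK ?num_real//; lra.
have [c1 c2 c3] := Hrho (z.1 - z0.1) (z.2 - z0.2) (le_trans zx rrho) (le_trans zt rrho).
do 3!eexists; split; [exact: c1|exact: c2|exact: c3|].
apply: (v2 z Oz); exists K1; apply/st_nearP.
exists (Num.min (r - `|z.1 - z0.1|) (r - `|z.2 - z0.2|)); first by rewrite lt_min !subr_gt0 zxr.
move=> x t; rewrite !lt_min => /andP[hx _] /andP[_ ht].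
have Qxt : Q (x, t).
  split => /=; [rewrite -(subrKA z.1); move: hx|rewrite -(subrKA z.2); move: ht];
    by move=> /ltW; rewrite lerBrDr; apply: le_trans; exact: ler_normD.
have := Hmin _ Qxt; rewrite !NP.
have -> : P (x, t) = P z + quad (a - 2 * K1 * (z.2 - z0.2))
    (p + 2^-1 *: ((z.1 - z0.1) *m (X1 + X1^T))) X1 K1 (x - z.1) (t - z.2).
  rewrite /P -quad_shift /=; congr (quad _ _ _ _ _ _).
    by rewrite [RHS]addrC subrKA.
  by rewrite [RHS]addrC subrKA.
by rewrite /=; clear - oOm bOm mf mM fM; lra.
Qed.

(* Perron's bump: if [perron] were not a subsolution at [z0], a strict
   supersolution dipping below it at [z0] could be glued to a member of the class. *)
Lemma perron_sub z0 : Om z0 -> jet_super (fun z => - perron z) z0.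
Proof.
move=> Oz0 a p X [K HK]; apply: par_super_closed => kap k0.
have [rho rho0 Hrho] := shift_close a p X K k0.
set X1 := X - kap%:M in Hrho; set K1 := K + kap / 2 in Hrho.
apply: contrapT => Hno.
(* The failure of the subsolution inequality persists at every point of the cylinder of radius [rho]
   and in every admissible direction: minus the quadratic is a strict supersolution there. *)
have {}Hno (h1 : V) (s1 : R) e : `|h1| <= rho -> `|s1| <= rho -> sphere e ->
    (exists c, p + 2^-1 *: (h1 *m (X1 + X1^T)) = c *: e) -> a - 2 * K1 * s1 < qf X1 e.
  move=> hr sr es pe; rewrite ltNge; apply/negP => qe; apply: Hno.
  have [c1 c2 c3] := Hrho h1 s1 hr sr.
  by do 3!eexists; split; [exact: c1|exact: c2|exact: c3|exists e].
have [r /andP[r0 rrho] Hr] := box_in_Om Oz0 HK rho0.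
(* Off [C] the strictness is at least [kap / 2 * (r ^+ 2 / 4)], that is [4 * del]: enough for the
   dip [del] of the bump and the error [2 * del] of [v]. *)
pose del := kap / 2 * r ^+ 2 / 16.
have del0 : 0 < del by rewrite divr_gt0// mulr_gt0 ?divr_gt0// exprn_gt0.
pose Q : set (spacetime R n) := [set z | `|z.1 - z0.1| <= r /\ `|z.2 - z0.2| <= r].
have QOm : Q `<=` Om by move=> z [h1 h2]; exact: (Hr z h1 h2).1.
have del2 : 0 < 2 * del by rewrite mulr_gt0.
have [v Uv Hv] := perron_uniform_approx (@compact_box z0 r) QOm del2.
pose b (z : spacetime R n) := (perron z0 - del) + quad (- a) (- p) (- X1) (- K1) (z.1 - z0.1) (z.2 - z0.2).
have bE z : b z = perron z0 - del - quad a p X1 K1 (z.1 - z0.1) (z.2 - z0.2).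
  by rewrite /b /quad dotNl qfNl; ring.
pose N : set (spacetime R n) := ball z0 r.
pose C : set (spacetime R n) := [set z | `|z.1 - z0.1| <= r / 2 /\ `|z.2 - z0.2| <= r / 2].
have NP z : N z -> `|z.1 - z0.1| < r /\ `|z.2 - z0.2| < r by move=> /st_ballE.
have Nz0 : N z0 by exact: ballxx.
suff Uw : U (glue v b N).
  have := perron_le Oz0 Uw; have := glue_le_in v b Nz0.
  by rewrite bE !subrr quad0; lra.
apply: (@real_upper_glue _ _ Om f M oOm v b N C Uv).
- exact: ball_open.
- apply: compact_closed; first exact: norm_hausdorff.
  exact: compact_box.
- by move=> z [h1 h2]; apply/st_ballE; split; lra.
- by move=> z /NP[/ltW h1 /ltW h2]; exact: (Hr z h1 h2).1.
- move=> z /NP[/ltW h1 /ltW h2] nC; have := Hv z (conj h1 h2).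
  have := (Hr z h1 h2).2; rewrite bE quad_perturb.
  have d0 := dot_ge0 (z.1 - z0.1); have t20 := sqr_ge0 (z.2 - z0.2).
  have far : r ^+ 2 / 4 <= dot (z.1 - z0.1) (z.1 - z0.1) + (z.2 - z0.2) ^+ 2.
    have e4 : r ^+ 2 / 4 = (r / 2) ^+ 2 by field.
    have r20 : 0 <= r / 2 by rewrite divr_ge0// ltW.
    have [hx|/ltW hx] := leP `|z.1 - z0.1| (r / 2); last first.
      have : (r / 2) ^+ 2 <= `|z.1 - z0.1| ^+ 2 by rewrite ler_pXn2r ?nnegrE.
      by have := sqr_norm_le_dot (z.1 - z0.1); lra.
    have ht : r / 2 <= `|z.2 - z0.2|.
      by rewrite leNgt; apply/negP => /ltW ht; apply: nC.
    have : (r / 2) ^+ 2 <= `|z.2 - z0.2| ^+ 2 by rewrite ler_pXn2r ?nnegrE.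
    by rewrite real_normK ?num_real//; lra.
  have k2 : 0 <= kap / 2 by rewrite divr_ge0// ltW.
  have := ler_wpM2l k2 far; rewrite /del in del0 *; lra.
- by move=> z _; apply: lsc_at_continuous; exact: continuous_quad.
- move=> z /NP[/ltW h1 /ltW h2] _.
  apply: (@jet_super_smooth _ _ b z (- (a - 2 * K1 * (z.2 - z0.2)))
    (- (p + 2^-1 *: ((z.1 - z0.1) *m (X1 + X1^T)))) (- X1) (- K1)).
    move=> e es [c pe]; rewrite qfNl lerN2 ltW//.
    apply: (Hno (z.1 - z0.1)) => //; [exact: le_trans rrho|exact: le_trans rrho|].
    by exists (- c); rewrite scaleNr -pe opprK.
  apply/(st_nearP z); exists 1 => // x t _ _; rewrite !bE /=.
  have -> : quad a p X1 K1 (x - z0.1) (t - z0.2) = quad a p X1 K1 (z.1 - z0.1) (z.2 - z0.2) +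
     quad (a - 2 * K1 * (z.2 - z0.2)) (p + 2^-1 *: ((z.1 - z0.1) *m (X1 + X1^T))) X1 K1 (x - z.1) (t - z.2).
    rewrite -quad_shift /=; congr (quad _ _ _ _ _ _).
      by rewrite [RHS]addrC subrKA.
    by rewrite [RHS]addrC subrKA.
  rewrite [in leRHS]/quad dotNl qfNl /quad; lra.
Qed.

End PerronInfimum.

(** * From the extended-real upper class to its real-valued part *)

Section UpperClassBridge.
Context {R : realType} {n : nat}.
Variables (Om : set (spacetime R n)) (f : spacetime R n -> R) (m M : R).
Hypotheses (oOm : open Om) (bOm : bounded_set Om).
Hypotheses (mf : forall z, boundary Om z -> m <= f z) (mM : m <= M).
Hypothesis fM : forall z, boundary Om z -> f z <= M.
Implicit Types (u : spacetime R n -> \bar R) (v : spacetime R n -> R) (z : spacetime R n).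

Lemma liminf_near u z e : ((f z)%:E <= limf_einf u (within Om (nbhs z)))%E -> 0 < e ->
  \forall y \near z, Om y -> ((f z - e)%:E < u y)%E.
Proof.
move=> fu e0; have : ((f z - e)%:E < limf_einf u (within Om (nbhs z)))%E.
  by apply: lt_le_trans fu; rewrite lte_fin gtrBl.
rewrite limf_einfE => /ereal_sup_gt[_ [W zW <-] lt].
have H : nbhs z (fun y => Om y -> W y) by exact: zW.
apply: filterS H => y HW Oy; apply: (lt_le_trans lt).
by apply: ge_ereal_inf; exists (u y) => //; exists y => //; exact: HW.
Qed.

Lemma near_le_liminf v z : (forall e, 0 < e -> \forall y \near z, Om y -> f z - e < v y) ->
  ((f z)%:E <= limf_einf (fun y => (v y)%:E) (within Om (nbhs z)))%E.
Proof.
move=> H; apply/lee_addgt0Pr => e e0; rewrite -leeBlDr// -EFinB limf_einfE.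
apply: le_ereal_sup_tmp; exists (ereal_inf ((fun y => (v y)%:E) @` [set y | Om y /\ f z - e < v y])).
  exists [set y | Om y /\ f z - e < v y] => //.
  have H' : nbhs z (fun y => Om y -> Om y /\ f z - e < v y).
    by apply: filterS (H e e0) => y Hy Oy; split => //; exact: Hy.
  exact: H'.
by apply: le_ereal_inf_tmp => _ [y [Oy fy] <-]; rewrite lee_fin ltW.
Qed.

Lemma lsc_subspace_near u z a : lower_semicontinuous (u : subspace Om -> \bar R) ->
  Om z -> (a%:E < u z)%E -> \forall y \near z, (a%:E < u y)%E.
Proof.
move=> lsc Oz az; have [W zW HW] := lsc z a az.
have H : @nbhs_subspace _ Om z W by exact: zW.
move: H; rewrite /nbhs_subspace mem_set// => H.
have H' : nbhs z (fun y => Om y -> W y) by exact: H.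
by apply: filterS2 (near_open oOm Oz) H' => y Oy /(_ Oy); exact: HW.
Qed.

(** Semicontinuity inside and the boundary condition outside bound [u] below near each point of the
    compact closure. The bound is what lets local jets be completed to global test functions. *)
Lemma upper_class_bounded_below u : upper_class Om f u ->
  exists c : R, forall z, Om z -> (c%:E <= u z)%E.
Proof.
move=> [[ufin lsc _] bu].
have near_lb z : closure Om z -> exists c : R, \forall y \near z, Om y -> (c%:E < u y)%E.
  move=> cz; have [Oz|nOz] := pselect (Om z); last first.
    by exists (f z - 1); apply: liminf_near => //; apply: bu; exact: closure_boundary.
  have [c cu] : exists c : R, (c%:E < u z)%E.
    case: (u z) (ufin z Oz) => [r| |]// _.
      by exists (r - 1); rewrite lte_fin gtrBl.
    by exists 0; rewrite ltry.
  by exists c; apply: filterS (lsc_subspace_near lsc Oz cu) => y.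
have cO := compact_closure_Om bOm.
have H := (iffLR (compact_near_coveringP _) cO) R (pinfty_nbhs R)
  (fun c z => Om z -> ((- c)%:E <= u z)%E) _.
have [z cz|c [_ Hc]] := H.
  have [c Hc] := near_lb z cz.
  exists ([set y | Om y -> (c%:E < u y)%E], [set c' | - c <= c']) => /=.
    by split; [exact: Hc|exact: nbhs_pinfty_ge (num_real _)].
  move=> [y c'] /= [Hy cc'] Oy; apply: le_trans (ltW (Hy Oy)).
  by rewrite lee_fin lerNl.
have cc1 : c < c + 1 by rewrite ltrDl.
by exists (- (c + 1)) => z Oz; exact: (Hc _ cc1 z (subset_closure Oz) Oz).
Qed.

(** A supersolution is never [-oo] on [Om], so its minimum with [M] is finite there and [fine] loses
    nothing. *)
Definition truncate u z : R := fine (Order.min (u z) M%:E).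

Lemma truncateE u z : u z != -oo%E -> (truncate u z)%:E = Order.min (u z) M%:E.
Proof.
move=> uz; rewrite /truncate fineK//; case: (u z) uz => [r| |] // _.
by rewrite -EFin_min.
Qed.

Lemma real_upper_truncate u : upper_class Om f u -> real_upper Om f M (truncate u).
Proof.
move=> Uu; have [c Hc] := upper_class_bounded_below Uu; have [su bu] := Uu.
have [ufin lsc _] := su.
have tE z : Om z -> (truncate u z)%:E = Order.min (u z) M%:E by move=> /ufin/truncateE.
have tu z : Om z -> ((truncate u z)%:E <= u z)%E by move=> Oz; rewrite tE// ge_min lexx.
have tM z : Om z -> truncate u z <= M by move=> Oz; rewrite -lee_fin tE// ge_min lexx orbT.
have lt_t a z : Om z -> (a%:E < u z)%E -> a < M -> a < truncate u z.
  by move=> Oz au aM; rewrite -lte_fin tE// lt_min au lte_fin.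
split => //.
- move=> z Oz e e0.
  have a1 : ((truncate u z - e)%:E < u z)%E.
    by apply: lt_le_trans (tu z Oz); rewrite lte_fin gtrBl.
  apply: filterS2 (near_open oOm Oz) (lsc_subspace_near lsc Oz a1) => y Oy H.
  by apply: lt_t => //; apply: lt_le_trans (tM z Oz); rewrite gtrBl.
(* Where [u] exceeds [M] the constant [M] touches the truncation from above; elsewhere a jet of the
   truncation is a jet of [u]. *)
- move=> z Oz; have [uM|/ltW Mu] := leP (u z) M%:E; last first.
    apply: (jet_super_touch (v := fun=> M)) (@jet_super_cst R n M z).
      by apply: EFin_inj; rewrite tE// min_r.
    by apply: filterS (near_open oOm Oz) => y /tM.
  have uz : u z = (truncate u z)%:E by rewrite tE// min_l.
  move=> a p X [K HK]; apply: (viscosity_supersolution_jet (K := K) oOm bOm su Hc Oz uz).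
  apply: filterS2 (near_open oOm Oz) HK => y Oy H.
  by apply: le_trans (tu y Oy); rewrite lee_fin.
- move=> z bz e e0; apply: filterS (liminf_near (bu z bz) e0) => y H Oy.
  apply: lt_t => //; first exact: H.
  by apply: lt_le_trans (fM bz); rewrite gtrBl.
Qed.

Lemma upper_class_real v : real_upper Om f M v -> upper_class Om f (fun z => (v z)%:E).
Proof.
move=> [v1 v2 _ v4]; split; first exact: (jet_super_viscosity (v := v)).
by move=> z bz; apply: near_le_liminf; exact: v4.
Qed.

Lemma upper_perronE z : Om z -> upper_perron Om f z = (perron Om f M z)%:E.
Proof.
move=> Oz; apply/eqP; rewrite eq_le; apply/andP; split.
  apply/lee_addgt0Pr => e e0.
  have [v Uv vz] := perron_approx oOm bOm mf fM Oz e0.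
  apply: (@le_trans _ _ (v z)%:E); last by rewrite -EFinD lee_fin ltW.
  apply: ge_ereal_inf; exists (v z)%:E => //.
  by exists (fun z => (v z)%:E) => //; exact: upper_class_real.
apply: le_ereal_inf_tmp => _ [u Uu <-].
apply: (@le_trans _ _ (truncate u z)%:E).
  by rewrite lee_fin (perron_le oOm bOm mf Oz)//; exact: real_upper_truncate.
by rewrite truncateE ?ge_min ?lexx//; case: Uu => -[ufin _ _] _; exact: ufin.
Qed.

Lemma upper_perron_solution : viscosity_solution Om (upper_perron Om f).
Proof.
split; last first.
  apply: (jet_super_viscosity oOm upper_perronE) => z Oz.
    by apply: (@perron_lsc R n Om f m M).
  by apply: (@perron_super R n Om f m M).
apply: viscosity_subsolution_of_super => //.
apply: (jet_super_viscosity (v := fun z => - perron Om f M z) oOm) => z Oz.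
- by rewrite upper_perronE.
- by apply: (@perron_usc R n Om f m M).
- by apply: (@perron_sub R n Om f m M).
Qed.

End UpperClassBridge.

Lemma boundary_bounded (R : realType) (n : nat) (Om : set (spacetime R n))
    (f : spacetime R n -> R) :
  bounded_set Om -> {within boundary Om, continuous f} ->
  exists2 B, 0 <= B & forall z, boundary Om z -> `|f z| <= B.
Proof.
move=> bOm cf.
have cb : compact (boundary Om).
  apply: subclosed_compact (compact_closure_Om bOm) _; last by move=> z [].
  apply: closedI; first exact: closed_closure.
  by apply: open_closedC; exact: open_interior.
have [B [_ HB]] := compact_bounded (continuous_compact cf cb).
exists (`|B| + 1); first by rewrite addr_ge0.
move=> z bz; apply: (HB (`|B| + 1)); last by exists z.
by have := ler_norm B; lra.
Qed.

Lemma upper_perron_viscosity_solution (R : realType) (n : nat) (Om : set (spacetime R n))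
    (f : spacetime R n -> R) :
  open Om -> bounded_set Om -> {within boundary Om, continuous f} ->
  viscosity_solution Om (upper_perron Om f).
Proof.
move=> oO bO cf; have [B B0 HB] := boundary_bounded bO cf.
apply: (@upper_perron_solution R n Om f (- B) B) => //.
- by move=> z /HB; rewrite ler_norml => /andP[].
- by lra.
- by move=> z /HB; rewrite ler_norml => /andP[].
Qed.

Theorem mainTheorem8 (R : realType) (n : nat) (Om : set (spacetime R n))
    (f : spacetime R n -> R)
    (dOm : domain Om) (bOm : bounded_set Om)
    (cf : {within boundary Om, continuous f}) :
  viscosity_solution Om (upper_perron Om f) /\
  viscosity_solution Om (lower_perron Om f).
Proof.
have [oOm _ _] := dOm.
split; first exact: upper_perron_viscosity_solution.
rewrite lower_perronE//; apply: viscosity_solutionN => //.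
apply: upper_perron_viscosity_solution => // z.
by apply: continuousN; exact: cf.
Qed.
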